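(* Let $\mathcal C$ be a Hom-finite, 2-Calabi--Yau, Krull--Schmidt triangulated category over a finite field $k=\mathbb F_q$ with a cluster tilting object $T$. For any weighted quantum cluster functions $f*_{\epsilon'}X_M$ and $g*_{\epsilon''}X_N$ (that is, $f\in\mathbb Z_{\mathrm{MG}}(\epsilon')$, $\mathrm{mt}\,\epsilon'=M$, $g\in\mathbb Z_{\mathrm{MG}}(\epsilon'')$, $\mathrm{mt}\,\epsilon''=N$) such that $\mathrm{Hom}_{\mathcal C}(M,\Sigma N)\neq0$, in $A_{n,\lambda}$ one has $$|\mathbb P\mathrm{Hom}_{\mathcal C}(M,\Sigma N)|\,(f*_{\epsilon'}X_M)\cdot(g*_{\epsilon''}X_N)$$ $$=\sum_{\mathbb P\epsilon\in\mathbb P\mathrm{Hom}_{\mathcal C}(M,\Sigma N)}\bigl(g^+_{\rm ext}*_\epsilon f_{\rm spec}*_\epsilon\mathbb T_{fg}\bigr)*_\epsilon X_{\mathrm{mt}\epsilon}+\sum_{\mathbb P\eta\in\mathbb P\mathrm{Hom}_{\mathcal C}(N,\Sigma M)}\bigl(g_{\rm skew}*_\eta f_{\rm spec}*_\eta\mathbb T_{gf}\bigr)*_\eta X_{\mathrm{mt}\eta}$$ $$=\sum_{\mathbb P\epsilon\in\mathbb P\mathrm{Hom}_{\mathcal C}(M,\Sigma N)}\bigl(f_{\rm spec}*_\epsilon\mathbb T_{fg}\bigr)*_\epsilon X_{\mathrm{mt}\epsilon}+\sum_{\mathbb P\eta\in\mathbb P\mathrm{Hom}_{\mathcal C}(N,\Sigma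 M)}\bigl(g^-_{\rm ext}*_\eta g_{\rm skew}*_\eta f_{\rm spec}*_\eta\mathbb T_{gf}\bigr)*_\eta X_{\mathrm{mt}\eta}.$$
   Context: Setting. $\Sigma$ is the shift of $\mathcal C$, $T=T^{(1)}\oplus\dots\oplus T^{(n)}$ with pairwise non-isomorphic indecomposable summands, $B=\mathrm{End}_{\mathcal C}(T)$, $F=\mathrm{Hom}_{\mathcal C}(T,-):\mathcal C\to\mathrm{mod}\,B$, $S_i$ the simple top of $FT^{(i)}$. For $B$-modules, $\langle X,Y\rangle=\dim\mathrm{Hom}_B(X,Y)-\dim\mathrm{Ext}^1_B(X,Y)$ and $\langle X,Y\rangle_a=\langle X,Y\rangle-\langle Y,X\rangle$, which descends to $K_0(\mathrm{mod}\,B)$. For $X\in\mathcal C$ there is a triangle $\Sigma T_4\to X\to\Sigma^2T_3\to\Sigma^2T_4$ with $T_3,T_4\in\mathrm{add}\,T$; $\mathrm{coind}X=[FT_3]-[FT_4]\in K_0(\mathrm{proj}B)\cong\mathbb Z^n$. For $\mathbf d\in\mathbb N^n$, $p(L,\mathbf d)\in\mathbb Z^n$ is $p(L,\mathbf d)_i=-(\mathrm{coind}L)_i+\langle S_i,\mathbf d\rangle_a$. $\lambda:\mathbb Z^n\times\mathbb Z^n\to\mathbb Z$ is a fixed skew-symmetric bilinear form; $A_{n,\lambda}$ is the skew-polynomial algebra with basis $X^{\mathbf e}$ ($\mathbf e\in\mathbb Z^n$) over a field containing $q^{1/2}$ (e.g. $\mathbb Q(q^{1/2})$), and $X^{\mathbf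 e}X^{\mathbf f}=q^{\frac12\lambda(\mathbf e,\mathbf f)}X^{\mathbf e+\mathbf f}$. $\mathrm{Gr}_{\mathbf d}(FL)$ is the set of submodules of $FL$ of dimension vector $\mathbf d$; $X_L=\sum_{\mathbf d}|\mathrm{Gr}_{\mathbf d}(FL)|X^{p(L,\mathbf d)}$. For $\epsilon\in\mathrm{Hom}_{\mathcal C}(M,\Sigma N)$ with triangle $N\xrightarrow{i}L\xrightarrow{p}M\xrightarrow{\epsilon}\Sigma N$ put $\mathrm{qt}\epsilon=M,\mathrm{st}\epsilon=N,\mathrm{mt}\epsilon=L$, and let $\psi_\epsilon:\coprod_{\mathbf d}\mathrm{Gr}_{\mathbf d}(FL)\to\coprod_{\mathbf e,\mathbf f}\mathrm{Gr}_{\mathbf e}(FM)\times\mathrm{Gr}_{\mathbf f}(FN)$, $L_0\mapsto(Fp(L_0),(Fi)^{-1}(L_0))$; $\psi_{\epsilon,\mathbf d}$ is its restriction to $\mathrm{Gr}_{\mathbf d}(FL)$. $\mathbb P\mathrm{Hom}$ is the set of lines; sums over $\mathbb P\epsilon$ use a representative $\epsilon$. Weight functions. $\mathbb Z_{\mathrm{MG}}$ is the set of functions $f(M_0,N_0,\epsilon)\in\frac12\mathbb Z$ for $M_0\subseteq FM$, $N_0\subseteq FN$ submodules ($M,N\in\mathcal C$) and $\epsilon$ a morphism of type $\mathrm{qt}\epsilon\to\Sigma\,\mathrm{st}\epsilon$, vanishing unless $M=\mathrm{qt}\epsilon$, $N=\mathrm{st}\epsilon$. $\mathbb Z_{\mathrm{MG}}(\epsilon)$: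 those vanishing at every $\rho\neq\epsilon$; then write $f(M_0,N_0)$. For $f,g\in\mathbb Z_{\mathrm{MG}}$, $f*_\eta g\in\mathbb Z_{\mathrm{MG}}(\eta)$ equals $f+g$ at $\eta$ and $0$ elsewhere. For $f\in\mathbb Z_{\mathrm{MG}}(\epsilon)$ with $\epsilon\in\mathrm{Hom}(M,\Sigma N)$, $L=\mathrm{mt}\epsilon$, the weighted quantum cluster function is $$f*_\epsilon X_L=\sum_{\mathbf d}\sum_{\mathbf e,\mathbf f}\sum_{(M_0,N_0)\in\mathrm{Gr}_{\mathbf e}(FM)\times\mathrm{Gr}_{\mathbf f}(FN)}|\psi_{\epsilon,\mathbf d}^{-1}(M_0,N_0)|\,q^{f(M_0,N_0)}X^{p(L,\mathbf d)}.$$ Given $f*_{\epsilon'}X_M$, $g*_{\epsilon''}X_N$: for $\epsilon\in\mathrm{Hom}(M,\Sigma N)$, $\mathbb T_{fg}\in\mathbb Z_{\mathrm{MG}}(\epsilon)$ is $\mathbb T_{fg}(M_0,N_0,\epsilon)=f(\psi_{\epsilon'}(M_0))+g(\psi_{\epsilon''}(N_0))$, and for $\eta\in\mathrm{Hom}(N,\Sigma M)$, $\mathbb T_{gf}(N_0,M_0,\eta)=g(\psi_{\epsilon''}(N_0))+f(\psi_{\epsilon'}(M_0))$. Special weight functions. Put $l(M,N,M_0,N_0)=\dim_k\mathrm{Hom}_B(M_0,FN/N_0)$, and let $M_0,N_0$ have dimension vectors $\mathbf e,\mathbf f$, $\epsilon\in\mathrm{Hom}(M,\Sigma N)$, $\eta\in\mathrm{Hom}(N,\Sigma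 M)$. Then $f_{\rm spec}(M_0,N_0,\epsilon)=\frac12\lambda(p(M,\mathbf e),p(N,\mathbf f))-l(M,N,M_0,N_0)$ (for all $M,N,\epsilon$); $g_{\rm skew}(N_0,M_0,\eta)=\lambda(p(M,\mathbf e),p(N,\mathbf f))$; $g^+_{\rm ext}(M_0,N_0,\epsilon)=\dim_k(\mathrm{Im}\,\alpha'_{N_0,M_0}\cap\mathrm{Hom}_{\mathcal C}(N,\Sigma M))$; $g^-_{\rm ext}(N_0,M_0,\eta)=\dim_k\Sigma p\,\mathrm{Ker}\,\alpha_{M_0,N_0}$. Here lift the inclusions $M_0\subseteq FM$, $N_0\subseteq FN$ through $\mathcal C\to\mathcal C/(\Sigma T)\simeq\mathrm{mod}B$ to morphisms $\iota_M:\tilde M_0\to M$, $\iota_N:\tilde N_0\to N$ in $\mathcal C$. $(T)$, $(\Sigma T)$ are the ideals of morphisms factoring through direct sums of copies of $T$, resp. $\Sigma T$; $\mathrm{Hom}_{\Sigma T}$, $\mathrm{Hom}_{\Sigma^2T}$ are the spaces of morphisms of $\mathcal C$ factoring through sums of copies of $\Sigma T$, resp. $\Sigma^2T$. Then $\alpha_{M_0,N_0}:\mathrm{Hom}_{\mathcal C}(\Sigma^{-1}M,\tilde N_0)\oplus\mathrm{Hom}_{\mathcal C}(\Sigma^{-1}M,N)\to\mathrm{Hom}_{\mathcal C/(T)}(\Sigma^{-1}\tilde M_0,\tilde N_0)\oplus\mathrm{Hom}_{\mathcal C}(\Sigma^{-1}\tilde M_0,N)\oplus\mathrm{Hom}_{\mathcal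 C/(\Sigma T)}(\Sigma^{-1}M,N)$, $(a,b)\mapsto(a\Sigma^{-1}\iota_M,\ \iota_Na\Sigma^{-1}\iota_M-b\Sigma^{-1}\iota_M,\ \iota_Na-b)$; $\alpha'_{N_0,M_0}:\mathrm{Hom}_{\Sigma T}(\tilde N_0,\Sigma\tilde M_0)\oplus\mathrm{Hom}_{\mathcal C}(N,\Sigma\tilde M_0)\oplus\mathrm{Hom}_{\Sigma^2T}(N,\Sigma M)\to\mathrm{Hom}_{\mathcal C}(\tilde N_0,\Sigma M)\oplus\mathrm{Hom}_{\mathcal C}(N,\Sigma M)$, $(a,b,c)\mapsto(\Sigma\iota_M a+c\iota_N+\Sigma\iota_M b\iota_N,\ -c-\Sigma\iota_M b)$. $p$ is the projection onto $\mathrm{Hom}_{\mathcal C}(\Sigma^{-1}M,N)$, $\Sigma p\,\mathrm{Ker}\,\alpha_{M_0,N_0}\subseteq\mathrm{Hom}_{\mathcal C}(M,\Sigma N)$ is the shift of $p\,\mathrm{Ker}\,\alpha_{M_0,N_0}$, and $\mathrm{Hom}_{\mathcal C}(N,\Sigma M)$ is viewed as the second summand of the target of $\alpha'_{N_0,M_0}$.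
   Formalization: Coordinates of coind in Z^n are dim_k Hom_B(-,S_i), not multiplicities of FT^(i); dimension vectors count multiplicities of the S_i. These are the usual ones if End_B(S_i)=k; otherwise the literal formula fails (type A_2 over F_{q^2} viewed over F_q). *)

(* Defs.v *)
From HB Require Import structures.
From mathcomp Require Import all_boot all_order all_algebra all_field.
From mathcomp Require Import boolp.

Set Implicit Arguments.
Unset Strict Implicit.
Unset Printing Implicit Defensive.

Import Order.TTheory GRing.Theory Num.Theory.
Local Open Scope ring_scope.

Section FiniteVectorSpaces.
Variables (k : finFieldType) (V : vectType k).

HB.instance Definition _ := isCountable.Build {vspace V}
  (pcan_pickleK (can_pcan (@VectorInternalTheory.vs2mxK k V))).
HB.instance Definition _ := isFinite.Build {vspace V}
  (pcan_enumP (can_pcan (@VectorInternalTheory.vs2mxK k V))).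

(* [vspan P] turns a classical predicate that is closed under linear
   combinations into a subspace; see [mem_vspan]. *)
Definition vspan (P : V -> Prop) : {vspace V} :=
  (\sum_(x : finvect_type V | `[< P x >]) <[(x : V)]>)%VS.

Lemma mem_vspan (P : V -> Prop) :
  P 0 -> (forall a x y, P x -> P y -> P (a *: x + y)) ->
  forall x, (x \in vspan P) <-> P x.
Proof.
move=> P0 PL x; split=> [|Px]; last first.
  apply: (subvP (sumv_sup (x : finvect_type V) _ (subvv _))); last exact: memv_line.
  exact/asboolP.
case/memv_sumP=> w w_in ->.
elim/big_ind: _ => // [y z Py Pz|y /asboolP Py].
  by rewrite -[y]scale1r; apply: PL.
have /vlineP[c ->] := w_in y (asboolT Py).
by rewrite -[_ *: _]addr0; apply: PL.
Qed.

End FiniteVectorSpaces.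

(* Hom-finiteness is built in: morphism spaces are finite-dimensional. *)
Record linCat (k : fieldType) := LinCat {
  ob :> Type;
  chom : ob -> ob -> vectType k;
  idm : forall X, chom X X;
  cmp : forall X Y Z, chom Y Z -> chom X Y -> chom X Z;
  cmp1m : forall X Y (f : chom X Y), cmp (idm Y) f = f;
  cmpm1 : forall X Y (f : chom X Y), cmp f (idm X) = f;
  cmpA : forall X Y Z W (h : chom Z W) (g : chom Y Z) (f : chom X Y),
    cmp h (cmp g f) = cmp (cmp h g) f;
  cmp_linl : forall X Y Z (f : chom X Y), linear (fun g : chom Y Z => cmp g f);
  cmp_linr : forall X Y Z (g : chom Y Z), linear (fun f : chom X Y => cmp g f)
}.

Arguments idm {k l} X.
Arguments cmp {k l X Y Z} _ _.

Declare Scope cat_scope.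
Delimit Scope cat_scope with cat.
Notation "g \oc f" := (cmp g f) (at level 40, left associativity) : cat_scope.
Local Open Scope cat_scope.

Section Category.
Variables (k : fieldType) (C : linCat k).

Definition is_iso (X Y : C) (f : chom X Y) : Prop :=
  exists g : chom Y X, g \oc f = idm X /\ f \oc g = idm Y.

Definition isomorphic (X Y : C) : Prop := exists f : chom X Y, is_iso f.

Definition is_zero (X : C) : Prop := idm X = 0.

Definition is_dirsum (I : finType) (X_ : I -> C) (S : C) : Prop :=
  exists (inj : forall i, chom (X_ i) S) (prj : forall i, chom S (X_ i)),
    [/\ forall i, prj i \oc inj i = idm (X_ i),
        forall i j, i != j -> prj j \oc inj i = 0 &
        \sum_i inj i \oc prj i = idm S].

Definition is_dirsum2 (X Y S : C) : Prop :=
  is_dirsum (fun b : bool => if b then X else Y) S.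

Definition additive_cat : Prop :=
  forall (I : finType) (X_ : I -> C), exists S, is_dirsum X_ S.

Definition indecomposable (X : C) : Prop :=
  ~ is_zero X /\
  forall Y Z, is_dirsum2 Y Z X -> is_zero Y \/ is_zero Z.

Definition local_end (X : C) : Prop :=
  ~ is_zero X /\ forall f : chom X X, is_iso f \/ is_iso (idm X - f).

Definition krull_schmidt : Prop :=
  forall X : C, exists (m : nat) (X_ : 'I_m -> C),
    is_dirsum X_ X /\ forall i, local_end (X_ i).

Definition in_add (T X : C) : Prop :=
  exists (m : nat) (S Y : C),
    is_dirsum (fun _ : 'I_m => T) S /\ is_dirsum2 X Y S.

(* The ideal (T): morphisms factoring through a finite direct sum of copies
   of T. *)
Definition through (T : C) (X Y : C) (f : chom X Y) : Prop :=
  exists (m : nat) (S : C) (g : chom S Y) (h : chom X S),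
    is_dirsum (fun _ : 'I_m => T) S /\ f = g \oc h.

Record endofunctor := Endofunctor {
  fob :> C -> C;
  fmap : forall X Y, chom X Y -> chom (fob X) (fob Y);
  fmap1 : forall X, fmap (idm X) = idm (fob X);
  fmapM : forall X Y Z (g : chom Y Z) (f : chom X Y),
    fmap (g \oc f) = fmap g \oc fmap f;
  fmap_lin : forall X Y, linear (@fmap X Y)
}.

End Category.

Arguments fmap {k C} e {X Y} _.

(* The shift [sh] is an autoequivalence with a chosen quasi-inverse [sh'] (the
   functor Sigma^-1), not necessarily a strict automorphism. [dist_iso],
   [dist_id] and [dist_cone] are TR1, [dist_rot] is TR2, [dist_mor] is TR3 and
   [dist_oct] is the octahedral axiom. *)
Record triCat (k : fieldType) := TriCat {
  tcat :> linCat k;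
  sh : endofunctor tcat;
  sh' : endofunctor tcat;
  shK : forall X, chom X (sh (sh' X));
  shK_iso : forall X, is_iso (shK X);
  shK_nat : forall X Y (f : chom X Y), shK Y \oc f = fmap sh (fmap sh' f) \oc shK X;
  sh'K : forall X, chom X (sh' (sh X));
  sh'K_iso : forall X, is_iso (sh'K X);
  sh'K_nat : forall X Y (f : chom X Y),
    sh'K Y \oc f = fmap sh' (fmap sh f) \oc sh'K X;
  tri_additive : additive_cat tcat;
  dist : forall X Y Z, chom X Y -> chom Y Z -> chom Z (sh X) -> Prop;
  dist_iso : forall X Y Z X' Y' Z'
      (f : chom X Y) (g : chom Y Z) (h : chom Z (sh X))
      (f' : chom X' Y') (g' : chom Y' Z') (h' : chom Z' (sh X'))
      (a : chom X X') (b : chom Y Y') (c : chom Z Z'),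
    is_iso a -> is_iso b -> is_iso c ->
    b \oc f = f' \oc a -> c \oc g = g' \oc b -> fmap sh a \oc h = h' \oc c ->
    dist f g h -> dist f' g' h';
  dist_id : forall X Z : tcat, is_zero Z ->
    dist (idm X) (0 : chom X Z) (0 : chom Z (sh X));
  dist_cone : forall X Y (f : chom X Y),
    exists (Z : tcat) (g : chom Y Z) (h : chom Z (sh X)), dist f g h;
  dist_rot : forall X Y Z (f : chom X Y) (g : chom Y Z) (h : chom Z (sh X)),
    dist f g h <-> dist g h (- fmap sh f);
  dist_mor : forall X Y Z X' Y' Z'
      (f : chom X Y) (g : chom Y Z) (h : chom Z (sh X))
      (f' : chom X' Y') (g' : chom Y' Z') (h' : chom Z' (sh X'))
      (a : chom X X') (b : chom Y Y'),
    dist f g h -> dist f' g' h' -> b \oc f = f' \oc a ->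
    exists c : chom Z Z', c \oc g = g' \oc b /\ fmap sh a \oc h = h' \oc c;
  dist_oct : forall X Y Z Z1 Y1 X1
      (f : chom X Y) (f' : chom Y Z1) (f'' : chom Z1 (sh X))
      (g : chom Y Z) (g' : chom Z X1) (g'' : chom X1 (sh Y))
      (h' : chom Z Y1) (h'' : chom Y1 (sh X)),
    dist f f' f'' -> dist g g' g'' -> dist (g \oc f) h' h'' ->
    exists (u : chom Z1 Y1) (w : chom Y1 X1),
      [/\ dist u w (fmap sh f' \oc g''),
          u \oc f' = h' \oc g, h'' \oc u = f'',
          w \oc h' = g' & g'' \oc w = fmap sh f \oc h'']
}.

Arguments sh {k t}.
Arguments sh' {k t}.
Arguments shK {k t} X.
Arguments dist {k t X Y Z} _ _ _.

Section Triangulated.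
Variables (k : fieldType) (C : triCat k).

(* Sigma^2 is a Serre functor: Hom(X,Y) ~ D Hom(Y, Sigma^2 X), naturally in X
   and Y. *)
Definition two_CY : Prop :=
  exists phi : forall X Y : C, chom X Y -> 'Hom(chom Y (sh (sh X)), k^o),
    [/\ forall X Y, linear (@phi X Y),
        forall X Y, bijective (@phi X Y),
        forall X Y Y' (g : chom Y Y') (f : chom X Y) (h : chom Y' (sh (sh X))),
          phi X Y' (g \oc f) h = phi X Y f (h \oc g) &
        forall X X' Y (a : chom X' X) (f : chom X Y) (h : chom Y (sh (sh X'))),
          phi X' Y (f \oc a) h = phi X Y f (fmap sh (fmap sh a) \oc h)].

Definition cluster_tilting (T : C) : Prop :=
  (forall X : C, in_add T X <-> (forall f : chom T (sh X), f = 0)) /\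
  (forall X : C, in_add T X <-> (forall f : chom X (sh T), f = 0)).

Record mor := Mor { qt : C; st : C; arr : chom qt (sh st) }.

Record tri (e : mor) := Tri {
  mt : C;
  tin : chom (st e) mt;
  tpr : chom mt (qt e);
  tdist : dist tin tpr (arr e)
}.

End Triangulated.

(* [rmod] is mod B for B = End(T), with composition as product: since F(X) =
   Hom(T, X) is acted on by precomposition, modules are right modules. *)

Section Modules.
Variables (k : finFieldType) (C : triCat k) (T : C).

Record rmod := RMod {
  rcar :> vectType k;
  ract : rcar -> chom T T -> rcar;
  ract_linl : forall b, linear (ract^~ b);
  ract_linr : forall x, linear (ract x);
  ract1 : forall x, ract x (idm T) = x;
  ractM : forall x b c, ract x (b \oc c) = ract (ract x b) c
}.

Definition rhom (X Y : rmod) : {vspace 'Hom(X, Y)} :=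
  vspan (fun f : 'Hom(X, Y) => forall x b, f (ract x b) = ract (f x) b).

(* Yoneda Ext^1 in terms of module structures (y, x) b = (y b + D b x, x b) on
   the vector space Y (+) X: such a D is a 1-cocycle, and two of them give
   equivalent extensions iff they differ by a 1-coboundary. *)
Definition ext_cocycles (X Y : rmod) : {vspace 'Hom(chom T T, 'Hom(X, Y))} :=
  vspan (fun D : 'Hom(chom T T, 'Hom(X, Y)) => forall b c x,
    D (b \oc c) x = ract (D b x) c + D c (ract x b)).

Definition ext_coboundaries (X Y : rmod) : {vspace 'Hom(chom T T, 'Hom(X, Y))} :=
  vspan (fun D : 'Hom(chom T T, 'Hom(X, Y)) => exists h : 'Hom(X, Y),
    forall b x, D b x = ract (h x) b - h (ract x b)).

Definition dim_ext1 (X Y : rmod) : nat :=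
  \dim (ext_cocycles X Y) - \dim (ext_coboundaries X Y).

Definition euler (X Y : rmod) : int := (\dim (rhom X Y))%:Z - (dim_ext1 X Y)%:Z.

Definition euler_a (X Y : rmod) : int := euler X Y - euler Y X.

Definition is_subm (X : rmod) (U : {vspace X}) : Prop :=
  forall x b, x \in U -> ract x b \in U.

Definition subm (X : rmod) : Type := {U : {vspace X} | `[< is_subm U >]}.

Lemma submP (X : rmod) (U : subm X) : is_subm (val U).
Proof. exact/asboolP/(valP U). Qed.

Definition mksubm (X : rmod) (U : {vspace X}) (hU : is_subm U) : subm X :=
  exist _ U (asboolT hU).

Section SubQuotient.
Variables (X : rmod) (U : subm X).

Definition sub_act (x : subvs_of (val U)) (b : chom T T) : subvs_of (val U) :=
  vsproj (val U) (ract (vsval x) b).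

Lemma sub_actE x b : vsval (sub_act x b) = ract (vsval x) b.
Proof. by rewrite vsprojK //; apply/submP/subvsP. Qed.

Fact sub_act_linl b : linear (sub_act^~ b).
Proof. by move=> a x y; rewrite /sub_act linearP ract_linl linearP. Qed.
Fact sub_act_linr x : linear (sub_act x).
Proof. by move=> a b c; rewrite /sub_act ract_linr linearP. Qed.
Fact sub_act1 x : sub_act x (idm T) = x.
Proof. by apply: val_inj; rewrite /= sub_actE ract1. Qed.
Fact sub_actM x b c : sub_act x (b \oc c) = sub_act (sub_act x b) c.
Proof. by apply: val_inj; rewrite /= !sub_actE ractM. Qed.

Definition sub_mod : rmod := RMod sub_act_linl sub_act_linr sub_act1 sub_actM.

(* The quotient X / U is carried by the complement U^C, onto which X is
   projected along U. *)
Definition quo_proj : 'End(X) := daddv_pi (val U)^C (val U).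

Lemma quo_proj_in x : quo_proj x \in ((val U)^C)%VS.
Proof. exact: memv_pi. Qed.

Lemma quo_proj_id x : x \in ((val U)^C)%VS -> quo_proj x = x.
Proof. by apply: daddv_pi_id; rewrite capvC capv_compl. Qed.

Lemma quo_projB x : x - quo_proj x \in val U.
Proof.
have cap0 : ((val U)^C :&: val U = 0)%VS by rewrite capvC capv_compl.
have x_in : x \in ((val U)^C + val U)%VS by rewrite addvC addv_complf memvf.
rewrite -{1}(daddv_pi_add cap0 x_in) addrC addKr; exact: memv_pi.
Qed.

Lemma quo_proj0 x : x \in val U -> quo_proj x = 0.
Proof.
move=> xU; have := quo_projB x; rewrite -(memvN) opprB => h.
have pU : quo_proj x \in val U by rewrite -[quo_proj x](subrK x) memvD.
by apply/eqP; rewrite -memv0 -(capv_compl (val U)) memv_cap pU quo_proj_in.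
Qed.

Definition quo_act (x : subvs_of ((val U)^C)%VS) (b : chom T T) :
    subvs_of ((val U)^C)%VS :=
  vsproj ((val U)^C)%VS (quo_proj (ract (vsval x) b)).

Lemma quo_actE x b : vsval (quo_act x b) = quo_proj (ract (vsval x) b).
Proof. by rewrite vsprojK // quo_proj_in. Qed.

Fact quo_act_linl b : linear (quo_act^~ b).
Proof. by move=> a x y; rewrite /quo_act linearP ract_linl !linearP. Qed.
Fact quo_act_linr x : linear (quo_act x).
Proof. by move=> a b c; rewrite /quo_act ract_linr !linearP. Qed.
Fact quo_act1 x : quo_act x (idm T) = x.
Proof. by apply: val_inj; rewrite /= quo_actE ract1 quo_proj_id // subvsP. Qed.
Fact quo_actM x b c : quo_act x (b \oc c) = quo_act (quo_act x b) c.
Proof.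
apply: val_inj; rewrite /= !quo_actE ractM; set y := ract _ b.
apply/eqP; rewrite -subr_eq0 -linearB /=.
suff -> : ract y c - ract (quo_proj y) c = ract (y - quo_proj y) c.
  by rewrite (quo_proj0 (submP c (quo_projB y))).
by have := ract_linl c (-1) (quo_proj y) y; rewrite !scaleN1r ![- _ + _]addrC => ->.
Qed.

Definition quo_mod : rmod := RMod quo_act_linl quo_act_linr quo_act1 quo_actM.

End SubQuotient.

Definition maximal_subm (X : rmod) (U : {vspace X}) : Prop :=
  [/\ is_subm U, U <> fullv &
      forall V : {vspace X}, is_subm V -> (U <= V)%VS -> V = U \/ V = fullv].

Definition rad_space (X : rmod) : {vspace X} :=
  (\bigcap_(U : {vspace X} | `[< maximal_subm U >]) U)%VS.

Fact rad_subm (X : rmod) : is_subm (rad_space X).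
Proof.
move=> x b; rewrite /rad_space memvE => /subv_bigcapP xU.
rewrite memvE; apply/subv_bigcapP=> U maxU; have /asboolP[subU _ _] := maxU.
by rewrite -memvE subU // memvE xU.
Qed.

Definition rtop (X : rmod) : rmod := quo_mod (mksubm (rad_subm (X := X))).

Definition F_act (X : C) (x : chom T X) (b : chom T T) : chom T X := x \oc b.

Definition F (X : C) : rmod :=
  @RMod (chom T X) (@F_act X) (fun b => @cmp_linl _ _ _ _ _ b)
    (fun x => @cmp_linr _ _ _ _ _ x) (@cmpm1 _ _ _ _)
    (fun x b c => @cmpA _ _ _ _ _ _ x b c).


Definition Fmap (X Y : C) (f : chom X Y) : 'Hom(F X, F Y) :=
  linfun (fun x : chom T X => f \oc x).

Lemma FmapE (X Y : C) (f : chom X Y) (x : F X) : Fmap f x = f \oc x.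
Proof.
pose h := GRing.isLinear.Build k (F X) (F Y) _ _ (@cmp_linr _ _ T X Y f).
pose l : {linear F X -> F Y} := HB.pack (fun x : chom T X => f \oc x) h.
exact: (lfunE l x).
Qed.

Section Psi.
Variables (e : mor C) (E : tri e) (L0 : subm (F (mt E))).

Fact psi1_subm : is_subm (Fmap (tpr E) @: val L0)%VS.
Proof.
move=> _ b /memv_imgP[x xL ->]; apply/memv_imgP; exists (ract x b).
  exact: (submP b xL).
by rewrite !FmapE /= /F_act cmpA.
Qed.

Fact psi2_subm : is_subm (Fmap (tin E) @^-1: val L0)%VS.
Proof.
move=> x b; rewrite -!memv_preim !FmapE /= => xL.
by have := submP (U := L0) b xL; rewrite /= /F_act cmpA.
Qed.

Definition psi : subm (F (qt e)) * subm (F (st e)) :=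
  (mksubm psi1_subm, mksubm psi2_subm).

End Psi.

(* A lift to C of the inclusion M0 <= FM along C -> C/(Sigma T) ~ mod B. *)
Record lifting (M : C) (M0 : subm (F M)) := Lifting {
  lob : C;
  lmor : chom lob M;
  lmor_inj : injective (Fmap lmor);
  lmor_img : limg (Fmap lmor) = val M0
}.

Section Alpha.
Variables (M N M' N' : C) (iM : chom M' M) (iN : chom N' N).

(* The first and third components are representatives of classes modulo (T)
   and (Sigma T). *)
Definition alpha (ab : chom (sh' M) N' * chom (sh' M) N) :
    chom (sh' M') N' * chom (sh' M') N * chom (sh' M) N :=
  (ab.1 \oc fmap sh' iM,
   iN \oc ab.1 \oc fmap sh' iM - ab.2 \oc fmap sh' iM,
   iN \oc ab.1 - ab.2).

Definition ker_alpha (ab : chom (sh' M) N' * chom (sh' M) N) : Prop :=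
  [/\ through T (alpha ab).1.1, (alpha ab).1.2 = 0 &
      through (sh T) (alpha ab).2].

Definition shift_p_ker : {vspace chom M (sh N)} :=
  vspan (fun e : chom M (sh N) => exists2 ab, ker_alpha ab &
    e = fmap sh ab.2 \oc shK M).

Definition alpha' (a : chom N' (sh M')) (b : chom N (sh M')) (c : chom N (sh M)) :
    chom N' (sh M) * chom N (sh M) :=
  (fmap sh iM \oc a + c \oc iN + fmap sh iM \oc b \oc iN,
   - c - fmap sh iM \oc b).

Definition im_alpha'_cap : {vspace chom N (sh M)} :=
  vspan (fun h : chom N (sh M) => exists a b c,
    [/\ through (sh T) a, through (sh (sh T)) c & alpha' a b c = (0, h)]).

End Alpha.

(* Values are rationals; [ZMG_at] requires them to be half-integers. The
   vanishing outside M = qt e, N = st e is built into the type. *)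
Definition ZMG : Type :=
  forall e : mor C, subm (F (qt e)) -> subm (F (st e)) -> rat.

Definition half_integral (f : ZMG) : Prop :=
  forall e M0 N0, 2%:R * f e M0 N0 \is a Num.int.

Definition ZMG_at (e : mor C) (f : ZMG) : Prop :=
  half_integral f /\ forall r, r <> e -> forall M0 N0, f r M0 N0 = 0.

Definition concentrated (e : mor C)
    (h : subm (F (qt e)) -> subm (F (st e)) -> rat) : ZMG :=
  fun r => match pselect (e = r) with
    | left er => match er in _ = r' return
                   subm (F (qt r')) -> subm (F (st r')) -> rat
                 with erefl => h end
    | right _ => fun _ _ => 0
    end.

Lemma concentratedE (e : mor C) h M0 N0 :
  concentrated (e := e) h M0 N0 = h M0 N0.
Proof.
rewrite /concentrated; case: pselect => // ee.
by rewrite (Prop_irrelevance ee erefl).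
Qed.

Definition star (e : mor C) (f g : ZMG) : ZMG :=
  concentrated (e := e) (fun M0 N0 => f e M0 N0 + g e M0 N0).

(* T_fg for e in Hom(M, Sigma N) is [TT E1 f E2 g e], and T_gf for
   e in Hom(N, Sigma M) is [TT E2 g E1 f e]. *)
Definition TT (e1 : mor C) (E1 : tri e1) (f1 : ZMG)
    (e2 : mor C) (E2 : tri e2) (f2 : ZMG)
    (e : chom (mt E1) (sh (mt E2))) : ZMG :=
  concentrated (e := Mor e) (fun M0 N0 =>
    f1 e1 (psi (E := E1) M0).1 (psi (E := E1) M0).2 +
    f2 e2 (psi (E := E2) N0).1 (psi (E := E2) N0).2).

Section Characters.
Variables (n : nat) (T_ : 'I_n -> C).

Definition simple (i : 'I_n) : rmod := rtop (F (T_ i)).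

(* The coordinates of the class of X in K_0(mod B) = Z^n on the basis of
   simples. The division is exact: Hom_B(F T_j, X) has length the multiplicity
   of S_j in X over the division algebra End_B(S_j), which over a finite field
   may be larger than k. *)
Definition dvec (X : rmod) : {ffun 'I_n -> nat} :=
  [ffun j => \dim (rhom (F (T_ j)) X) %/ \dim (rhom (simple j) (simple j))]%N.

Definition euler_a_dvec (i : 'I_n) (d : {ffun 'I_n -> nat}) : int :=
  \sum_j (d j)%:Z * euler_a (simple i) (simple j).

(* The coordinates of [P] in K_0(proj B) given by the duality
   <P, S_i> = dim_k Hom_B(P, S_i) with the simples. The class [F T_j] is sent to
   dim_k End_B(S_j) times the j-th unit vector, that is, to the j-th unit vector
   when End_B(S_j) = k. *)
Definition K0proj (P : rmod) : 'rV[int]_n :=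
  \row_i (\dim (rhom P (simple i)))%:Z.

Definition is_coind (X : C) (c : 'rV[int]_n) : Prop :=
  exists (T3 T4 : C) (f : chom (sh T4) X) (g : chom X (sh (sh T3)))
         (h : chom (sh (sh T3)) (sh (sh T4))),
    [/\ in_add T T3, in_add T T4, dist f g h & c = K0proj (F T3) - K0proj (F T4)].

Section Specials.
Variables (lam : 'rV[int]_n -> 'rV[int]_n -> int) (coind : C -> 'rV[int]_n).
Variable lft : forall (M : C) (M0 : subm (F M)), lifting M0.

Definition pvec (L : C) (d : {ffun 'I_n -> nat}) : 'rV[int]_n :=
  \row_i (- coind L 0 i + euler_a_dvec i d).

Definition lhom (M N : C) (M0 : subm (F M)) (N0 : subm (F N)) : nat :=
  \dim (rhom (sub_mod M0) (quo_mod N0)).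

Definition f_spec : ZMG := fun e M0 N0 =>
  2%:R^-1 * (lam (pvec (qt e) (dvec (sub_mod M0)))
                 (pvec (st e) (dvec (sub_mod N0))))%:~R
  - (lhom M0 N0)%:R.

Definition g_skew : ZMG := fun e N0 M0 =>
  (lam (pvec (st e) (dvec (sub_mod M0))) (pvec (qt e) (dvec (sub_mod N0))))%:~R.

Definition g_ext_plus : ZMG := fun e M0 N0 =>
  (\dim (im_alpha'_cap (lmor (lft M0)) (lmor (lft N0))))%:R.

Definition g_ext_minus : ZMG := fun e N0 M0 =>
  (\dim (shift_p_ker (lmor (lft M0)) (lmor (lft N0))))%:R.

(* v stands for q^(1/2). *)
Section Algebra.
Variables (K : fieldType) (v : K) (A : algType K) (Xb : 'rV[int]_n -> A).

Definition skew_polynomial_algebra : Prop :=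
  [/\ Xb 0 = 1,
      forall e f, Xb e * Xb f = v ^ lam e f *: Xb (e + f),
      forall (s : seq 'rV[int]_n) (c : 'rV[int]_n -> K), uniq s ->
        \sum_(e <- s) c e *: Xb e = 0 -> forall e, e \in s -> c e = 0 &
      forall a, exists (s : seq 'rV[int]_n) (c : 'rV[int]_n -> K),
        a = \sum_(e <- s) c e *: Xb e].

Definition qpow (x : rat) : K := v ^ numq (2%:R * x).

(* The sum over d is restricted to the dimension vectors of submodules of FL. *)
Definition wqcf (e : mor C) (E : tri e) (f : ZMG) : A :=
  \sum_(d <- undup [seq dvec (sub_mod L0) | L0 : subm (F (mt E))])
  \sum_(M0 : subm (F (qt e))) \sum_(N0 : subm (F (st e)))
    (#|[set L0 : subm (F (mt E)) |
         (dvec (sub_mod L0) == d) && (psi L0 == (M0, N0))]|%:R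
     * qpow (f e M0 N0)) *: Xb (pvec (mt E) d).

End Algebra.
End Specials.
End Characters.
End Modules.

Arguments TT {k C T e1} E1 f1 {e2} E2 f2 e.
Arguments star {k C T} e f g.
Arguments wqcf {k C T n} T_ coind {K} v {A} Xb {e} E f.
Arguments f_spec {k C} T {n} T_ lam coind.
Arguments g_skew {k C} T {n} T_ lam coind.

Definition lines (k : finFieldType) (V : vectType k) : {set {vspace V}} :=
  [set l : {vspace V} | \dim l == 1%N].

Definition skew_bilinear (n : nat) (lam : 'rV[int]_n -> 'rV[int]_n -> int) : Prop :=
  [/\ forall e e' f, lam (e + e') f = lam e f + lam e' f,
      forall e f f', lam e (f + f') = lam e f + lam e f' &
      forall e f, lam f e = - lam e f].

(* Main.v *)
From HB Require Import structures.
Require Import Defs.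
From mathcomp Require Import all_boot all_order all_algebra all_field.
From mathcomp Require Import boolp zify ring.

Set Implicit Arguments.
Unset Strict Implicit.
Unset Printing Implicit Defensive.

Import Order.TTheory GRing.Theory Num.Theory.
Local Open Scope ring_scope.
Local Open Scope cat_scope.

(** Write F for Hom(T, -), q for the order of k, and p(M0) for the exponent
    attached to a submodule M0 of FM. Every expression in the theorem is a
    combination of the monomials X^(p(M0) + p(N0)), for submodules M0 of FM and
    N0 of FN, and the identities hold for each pair (M0, N0) separately. Three
    facts about the triangles N -> L -> M -> Sigma N are behind this.

    - A submodule L0 of FL lying over (M0, N0) has exponent p(M0) + p(N0),
      whatever the triangle ([pvec_psi]). Compared with M0 and N0, the dimension
      vector of L0 lacks that of the kernel FK of FN -> FL. The coindex of L
      differs from those of M and N by the antisymmetrized Euler form with FK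
      ([coind_hom_defect]), which compensates exactly.
    - If there is such an L0, then they form a torsor under Hom_B(M0, FN / N0)
      ([card_psi_fiber]); f_spec divides by the order of this group.
    - There is such an L0 exactly when the map M -> Sigma N lies in a certain
      subspace W ([gluing], [gluing_submodule], [submodule_gluing]). With the
      roles of M and N exchanged there is a subspace W' of Hom(N, Sigma M), and
      W' is the orthogonal of W for the Calabi-Yau pairing, so that
      dim W + dim W' = dim Hom(M, Sigma N) ([dim_gluing]). The spaces whose
      dimensions define g_ext^- and g_ext^+ are W and W'
      ([shift_p_ker_gluing], [im_alpha'_gluing]).

    Let w and w' be the dimensions of W and W', and [m] the number of lines in a
    space of dimension m. Up to a common power of q^(1/2), the coefficients at
    (M0, N0) of the three members of the theorem are
    [w + w'], [w] q^w' + [w'] and [w] + [w'] q^w, which are equal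
    ([nlines_add]).

    The statement on coindices is proved with dimensions of Hom spaces. The
    pairing of the coindex of X with the class of FY is expressed without a
    choice of triangle ([coind_hom]) and is additive on triangles that F turns
    into injections ([coind_hom_add]); an octahedron reduces the general triangle
    to those. Its values at X and Sigma X add up to the antisymmetrized Euler
    form ([coind_hom_suspension]), since Ext^1 between modules FY and FX is the
    intersection of two ideals in Hom(Y, Sigma X) ([dim_ext1F]). Finally
    coindices are computed by functors Hom(T', -) with T' in add T, which are
    exact on modules. So the antisymmetrized Euler form is additive on short
    exact sequences, and is determined by dimension vectors ([devissage]). *)

(** * Linear algebra *)

Section LinearMaps.
Variables (k : fieldType) (U V : vectType k).

Definition mklin (f : U -> V) (Hf : linear f) : 'Hom(U, V) :=
  linfun (HB.pack_for {linear U -> V} f (GRing.isLinear.Build k U V _ _ Hf)).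

Lemma mklinE (f : U -> V) (Hf : linear f) x : mklin Hf x = f x.
Proof. by rewrite /mklin lfunE. Qed.

End LinearMaps.

(** * Hom-finite categories *)

Section LinearCategory.
Variables (k : fieldType) (C : linCat k).
Implicit Types X Y Z W : C.

Definition lpost X Y Z (g : chom Y Z) : 'Hom(chom X Y, chom X Z) :=
  mklin (@cmp_linr _ _ X _ _ g).
Definition lpre X Y Z (f : chom X Y) : 'Hom(chom Y Z, chom X Z) :=
  mklin (@cmp_linl _ _ _ _ Z f).

Lemma lpostE X Y Z (g : chom Y Z) (f : chom X Y) : lpost X g f = g \oc f.
Proof. exact: mklinE. Qed.
Lemma lpreE X Y Z (f : chom X Y) (g : chom Y Z) : lpre Z f g = g \oc f.
Proof. exact: mklinE. Qed.

Lemma cmp0m X Y Z (f : chom X Y) : (0 : chom Y Z) \oc f = 0.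
Proof. by rewrite -lpreE linear0. Qed.
Lemma cmpm0 X Y Z (g : chom Y Z) : g \oc (0 : chom X Y) = 0.
Proof. by rewrite -lpostE linear0. Qed.
Lemma cmpDm X Y Z (g g' : chom Y Z) (f : chom X Y) :
  (g + g') \oc f = g \oc f + g' \oc f.
Proof. by rewrite -!lpreE linearD. Qed.
Lemma cmpmD X Y Z (g : chom Y Z) (f f' : chom X Y) :
  g \oc (f + f') = g \oc f + g \oc f'.
Proof. by rewrite -!lpostE linearD. Qed.
Lemma cmpNm X Y Z (g : chom Y Z) (f : chom X Y) : (- g) \oc f = - (g \oc f).
Proof. by rewrite -!lpreE linearN. Qed.
Lemma cmpmN X Y Z (g : chom Y Z) (f : chom X Y) : g \oc (- f) = - (g \oc f).
Proof. by rewrite -!lpostE linearN. Qed.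
Lemma cmpBm X Y Z (g g' : chom Y Z) (f : chom X Y) :
  (g - g') \oc f = g \oc f - g' \oc f.
Proof. by rewrite -!lpreE linearB. Qed.
Lemma cmpmB X Y Z (g : chom Y Z) (f f' : chom X Y) :
  g \oc (f - f') = g \oc f - g \oc f'.
Proof. by rewrite -!lpostE linearB. Qed.
Lemma cmpZm X Y Z a (g : chom Y Z) (f : chom X Y) :
  (a *: g) \oc f = a *: (g \oc f).
Proof. by rewrite -!lpreE linearZ. Qed.
Lemma cmpmZ X Y Z a (g : chom Y Z) (f : chom X Y) :
  g \oc (a *: f) = a *: (g \oc f).
Proof. by rewrite -!lpostE linearZ. Qed.
Lemma cmp_suml X Y Z (I : finType) (P : pred I) (g : I -> chom Y Z) (f : chom X Y) :
  (\sum_(i | P i) g i) \oc f = \sum_(i | P i) g i \oc f.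
Proof. by rewrite -lpreE linear_sum; apply: eq_bigr => i _; exact: lpreE. Qed.
Lemma cmp_sumr X Y Z (I : finType) (P : pred I) (g : chom Y Z) (f : I -> chom X Y) :
  g \oc (\sum_(i | P i) f i) = \sum_(i | P i) g \oc f i.
Proof. by rewrite -lpostE linear_sum; apply: eq_bigr => i _; exact: lpostE. Qed.

Lemma is_iso_id X : is_iso (idm X).
Proof. by exists (idm X); rewrite cmp1m. Qed.

Lemma is_iso_comp X Y Z (g : chom Y Z) (f : chom X Y) :
  is_iso g -> is_iso f -> is_iso (g \oc f).
Proof.
case=> g' [g'g gg'] [f' [f'f ff']]; exists (f' \oc g'); split.
  by rewrite -cmpA (cmpA g') g'g cmp1m.
by rewrite -cmpA (cmpA f) ff' cmp1m.
Qed.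

Lemma zero_from X Y (f : chom X Y) : is_zero X -> f = 0.
Proof. by move=> X0; rewrite -(cmpm1 f) X0 cmpm0. Qed.
Lemma zero_to X Y (f : chom X Y) : is_zero Y -> f = 0.
Proof. by move=> Y0; rewrite -(cmp1m f) Y0 cmp0m. Qed.

Lemma zero_object : additive_cat C -> exists Z : C, is_zero Z.
Proof.
move=> addC; have T0 : 'I_0 -> C by case.
have [S [inj [prj [_ _ sum1]]]] := addC _ T0.
by exists S; rewrite /is_zero -sum1 big_ord0.
Qed.

(** Morphisms that factor through a finite direct sum of copies of [R],
    written without the direct sum: this form needs no choice of the sum and
    is visibly preserved by composition and by linear functors. *)
Definition sum_through (R X Y : C) (f : chom X Y) : Prop :=
  exists (m : nat) (u : 'I_m -> chom R Y) (w : 'I_m -> chom X R),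
    f = \sum_a u a \oc w a.

Lemma through_sum (R X Y : C) (f : chom X Y) :
  additive_cat C -> through R f <-> sum_through R f.
Proof.
move=> addC; split.
  case=> m [S [g [h [[inj [prj [_ _ sum1]]] ->]]]].
  exists m, (fun a => g \oc inj a), (fun a => prj a \oc h).
  rewrite -{1}(cmp1m h) -sum1 cmp_suml cmp_sumr; apply: eq_bigr => a _.
  by rewrite !cmpA.
case=> m [u [w ->]].
have [S [inj [prj [pi0 pi1 sum1]]]] := addC _ (fun _ : 'I_m => R).
exists m, S, (\sum_a u a \oc prj a), (\sum_a inj a \oc w a); split.
  by exists inj, prj.
rewrite cmp_suml; apply: eq_bigr => a _.
rewrite cmp_sumr (bigD1 a) //= big1 => [|b ba].
  by rewrite addr0 cmpA -(cmpA (u a)) pi0 cmpm1.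
by rewrite cmpA -(cmpA (u a)) pi1 // cmpm0 cmp0m.
Qed.

Lemma sum_through_comp (R X Y X' Y' : C) (g : chom Y Y') (f : chom X Y)
    (h : chom X' X) :
  sum_through R f -> sum_through R (g \oc f \oc h).
Proof.
case=> m [u [w ->]]; exists m, (fun a => g \oc u a), (fun a => w a \oc h).
by rewrite cmp_sumr cmp_suml; apply: eq_bigr => a _; rewrite !cmpA.
Qed.

Lemma sum_through_post (R X Y Y' : C) (g : chom Y Y') (f : chom X Y) :
  sum_through R f -> sum_through R (g \oc f).
Proof. by move/(sum_through_comp g (idm _)); rewrite cmpm1. Qed.

Lemma in_add_sum (R X : C) : in_add R X -> sum_through R (idm X).
Proof.
case=> m [S [Y [[inj [prj [_ _ sum1]]] [i [p [pi _ _]]]]]].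
have := pi true; set i1 := i true; set p1 := p true => pi1.
exists m, (fun a => p1 \oc inj a), (fun a => prj a \oc i1).
rewrite -{}pi1 -{1}(cmp1m i1) -sum1 cmp_suml cmp_sumr.
by apply: eq_bigr => a _; rewrite !cmpA.
Qed.

Lemma in_add_self (R : C) : additive_cat C -> in_add R R.
Proof.
move=> addC; have [Z Z0] := zero_object addC.
exists 1%N, R, Z; split.
  exists (fun _ => idm R), (fun _ => idm R); split; first by move=> i; rewrite cmp1m.
    by move=> i j; rewrite !ord1.
  by rewrite big_ord1 cmp1m.
exists (fun b : bool => if b return chom (if b then R else Z) R then idm R else 0).
exists (fun b : bool => if b return chom R (if b then R else Z) then idm R else 0).
split=> [[]|[] []|] //=; rewrite ?cmp1m ?cmpm0 ?cmp0m //.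

by rewrite big_bool /= cmp1m cmpm0 addr0.
Qed.

End LinearCategory.

(** * Triangulated categories *)

Section Functor.
Variables (k : fieldType) (C : linCat k) (G : endofunctor C).
Implicit Types X Y Z W : C.

Lemma fmap0 X Y : fmap G (0 : chom X Y) = 0.
Proof. by rewrite -(mklinE (fmap_lin G (X:=X) (Y:=Y))) linear0. Qed.
Lemma fmapD X Y (f g : chom X Y) : fmap G (f + g) = fmap G f + fmap G g.
Proof. by rewrite -!(mklinE (fmap_lin G (X:=X) (Y:=Y))) linearD. Qed.
Lemma fmapN X Y (f : chom X Y) : fmap G (- f) = - fmap G f.
Proof. by rewrite -!(mklinE (fmap_lin G (X:=X) (Y:=Y))) linearN. Qed.
Lemma fmapB X Y (f g : chom X Y) : fmap G (f - g) = fmap G f - fmap G g.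
Proof. by rewrite fmapD fmapN. Qed.
Lemma fmap_sum X Y (I : finType) (f : I -> chom X Y) :
  fmap G (\sum_i f i) = \sum_i fmap G (f i).
Proof.
rewrite -(mklinE (fmap_lin G (X:=X) (Y:=Y))) linear_sum.
by apply: eq_bigr => i _; exact: mklinE.
Qed.

Lemma fmap_zero X : is_zero X -> is_zero (G X).
Proof. by move=> X0; rewrite /is_zero -fmap1 X0 fmap0. Qed.

Lemma sum_through_fmap (R X Y : C) (f : chom X Y) :
  sum_through R f -> sum_through (G R) (fmap G f).
Proof.
case=> m [u [w ->]]; exists m, (fun a => fmap G (u a)), (fun a => fmap G (w a)).
by rewrite fmap_sum; apply: eq_bigr => a _; rewrite fmapM.
Qed.

End Functor.

Section Triangulated.
Variables (k : fieldType) (C : triCat k).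
Implicit Types X Y Z W : C.

Lemma iso_cancelr X Y Z (s : chom X Y) (f g : chom Y Z) :
  is_iso s -> f \oc s = g \oc s -> f = g.
Proof.
by case=> t [_ st] /(congr1 (fun h => h \oc t)); rewrite -!cmpA st !cmpm1.
Qed.

Lemma iso_cancell X Y Z (s : chom Y Z) (f g : chom X Y) :
  is_iso s -> s \oc f = s \oc g -> f = g.
Proof.
by case=> t [ts _] /(congr1 (fun h => t \oc h)); rewrite !cmpA ts !cmp1m.
Qed.

Lemma sh_faithful X Y (f g : chom X Y) : fmap sh f = fmap sh g -> f = g.
Proof.
move=> fg; apply: (iso_cancell (sh'K_iso Y)).
by rewrite !sh'K_nat fg.
Qed.

Lemma sh'_faithful X Y (f g : chom X Y) : fmap sh' f = fmap sh' g -> f = g.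
Proof.
move=> fg; apply: (iso_cancell (shK_iso Y)).
by rewrite !shK_nat fg.
Qed.

Lemma sh_full X Y (h : chom (sh X) (sh Y)) : exists f : chom X Y, h = fmap sh f.
Proof.
have [t [tY Yt]] := sh'K_iso Y.
exists (t \oc fmap sh' h \oc sh'K X); apply: sh'_faithful.
apply: (iso_cancelr (sh'K_iso X)).
by rewrite -sh'K_nat !cmpA Yt cmp1m.
Qed.

Lemma sh_eq0 X Y (f : chom X Y) : fmap sh f = 0 -> f = 0.
Proof. by rewrite -(fmap0 sh) => /sh_faithful. Qed.

Lemma zero_ob : exists Z : C, is_zero Z.
Proof. exact: zero_object (@tri_additive _ C). Qed.

Lemma dist_comp0 X Y Z (f : chom X Y) (g : chom Y Z) (h : chom Z (sh X)) :
  dist f g h -> g \oc f = 0.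
Proof.
move=> D; have [Z0 z0] := zero_ob.
have [c [<- _]] := dist_mor (dist_id X z0) D (erefl (f \oc idm X)).
by rewrite cmpm0.
Qed.

Lemma dist_comp0' X Y Z (f : chom X Y) (g : chom Y Z) (h : chom Z (sh X)) :
  dist f g h -> h \oc g = 0.
Proof. by move/dist_rot/dist_comp0. Qed.

Lemma dist_comp0'' X Y Z (f : chom X Y) (g : chom Y Z) (h : chom Z (sh X)) :
  dist f g h -> fmap sh f \oc h = 0.
Proof.
move=> /dist_rot/dist_comp0' /eqP; rewrite cmpNm oppr_eq0 => /eqP//.
Qed.

(** TR3, applied to the rotations of the given triangle and of W = W -> 0,
    produces the lift. *)
Lemma dist_lift X Y Z (f : chom X Y) (g : chom Y Z) (h : chom Z (sh X)) W
    (u : chom W Y) : dist f g h -> g \oc u = 0 -> exists v, u = f \oc v.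
Proof.
move=> D gu; have [Z0 z0] := zero_ob.
have D1 := (dist_rot _ _ _).1 (dist_id W z0).
have D2 := (dist_rot _ _ _).1 D.
have [|c [_ cE]] := dist_mor (a := u) (b := 0) D1 D2; first by rewrite gu cmp0m.
have [v vE] := sh_full c; exists v; apply: sh_faithful.
move: cE; rewrite fmap1 cmpmN cmpm1 cmpNm vE -fmapM.
exact: oppr_inj.
Qed.

(** The same with W = W in the last two places. *)
Lemma dist_extend X Y Z (f : chom X Y) (g : chom Y Z) (h : chom Z (sh X)) W
    (u : chom Y W) : dist f g h -> u \oc f = 0 -> exists v, u = v \oc g.
Proof.
move=> D uf; have [Z0 z0] := zero_ob.
have D1 : dist (0 : chom Z0 W) (idm W) (0 : chom W (sh Z0)).
  by apply/dist_rot; rewrite fmap0 oppr0; apply: dist_id; apply: fmap_zero.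
have [|c [cE _]] := dist_mor (a := 0) (b := u) D D1; first by rewrite uf cmp0m.
by exists c; rewrite cE cmp1m.
Qed.

(** Exactness of Hom(W, -) and Hom(-, W) at the other places of the long exact
    sequences, by rotation. *)
Lemma dist_lift' X Y Z (f : chom X Y) (g : chom Y Z) (h : chom Z (sh X)) W
    (u : chom W Z) : dist f g h -> h \oc u = 0 -> exists v, u = g \oc v.
Proof. by move/dist_rot; exact: dist_lift. Qed.

Lemma dist_lift'' X Y Z (f : chom X Y) (g : chom Y Z) (h : chom Z (sh X)) W
    (u : chom W (sh X)) : dist f g h -> fmap sh f \oc u = 0 -> exists v, u = h \oc v.
Proof.
move=> /dist_rot/dist_lift' D fu.
by apply: D; rewrite cmpNm fu oppr0.
Qed.

Lemma dist_extend' X Y Z (f : chom X Y) (g : chom Y Z) (h : chom Z (sh X)) W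
    (u : chom Z W) : dist f g h -> u \oc g = 0 -> exists v, u = v \oc h.
Proof. by move/dist_rot; exact: dist_extend. Qed.

Lemma dist_sh_lift X Y Z (f : chom X Y) (g : chom Y Z) (h : chom Z (sh X)) W
    (u : chom W (sh Y)) : dist f g h -> fmap sh g \oc u = 0 ->
  exists v, u = fmap sh f \oc v.
Proof.
move=> /dist_rot/dist_lift'' D gu; have [v ->] := D _ _ gu.
by exists (- v); rewrite cmpmN cmpNm.
Qed.

Lemma dist_extend'' X Y Z (f : chom X Y) (g : chom Y Z) (h : chom Z (sh X)) W
    (u : chom (sh X) W) : dist f g h -> u \oc h = 0 -> exists v, u = v \oc fmap sh f.
Proof.
move=> /dist_rot/dist_extend' D uh; have [v ->] := D _ _ uh.
by exists (- v); rewrite cmpmN cmpNm.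
Qed.

Lemma sum_through_sh (R X Y : C) (f : chom X Y) :
  sum_through (sh R) (fmap sh f) <-> sum_through R f.
Proof.
split; last exact: sum_through_fmap.
case=> m [u [w fE]].
have /choice[u' u'E] : forall a, exists u' : chom R Y, u a = fmap sh u'.
  by move=> a; apply: sh_full.
have /choice[w' w'E] : forall a, exists w' : chom X R, w a = fmap sh w'.
  by move=> a; apply: sh_full.
exists m, u', w'; apply: sh_faithful; rewrite fE fmap_sum.
by apply: eq_bigr => a _; rewrite u'E w'E fmapM.
Qed.

End Triangulated.

(** * Cluster-tilting approximations and the functor Hom(T, -) *)

Section KilledMorphisms.
Variables (k : finFieldType) (C : triCat k).

Definition killed (R X Y : C) (f : chom X Y) : Prop :=
  forall t : chom R X, f \oc t = 0.

Definition killedvs (R X Y : C) : {vspace chom X Y} := vspan (@killed R X Y).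

Lemma mem_killed (R X Y : C) (f : chom X Y) : f \in killedvs R X Y <-> killed R f.
Proof.
apply: mem_vspan => [t|a g h Kg Kh t]; first by rewrite cmp0m.
by rewrite cmpDm cmpZm Kg Kh scaler0 addr0.
Qed.

Lemma killed_post (R X Y Z : C) (g : chom Y Z) (f : chom X Y) :
  killed R f -> killed R (g \oc f).
Proof. by move=> Kf t; rewrite -cmpA Kf cmpm0. Qed.

Lemma killed_pre (R X Y Z : C) (g : chom Y Z) (f : chom X Y) :
  killed R g -> killed R (g \oc f).
Proof. by move=> Kf t; rewrite -cmpA Kf. Qed.

Lemma killedD (R X Y : C) (f g : chom X Y) :
  killed R f -> killed R g -> killed R (f + g).
Proof. by move=> Kf Kg t; rewrite cmpDm Kf Kg addr0. Qed.

Lemma killedN (R X Y : C) (f : chom X Y) : killed R f -> killed R (- f).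
Proof. by move=> Kf t; rewrite cmpNm Kf oppr0. Qed.

Lemma killed_sh (R X Y : C) (f : chom X Y) : killed R f <-> killed (sh R) (fmap sh f).
Proof.
split=> Kf t; last by apply: sh_eq0; rewrite fmapM Kf.
by have [s ->] := sh_full t; rewrite -fmapM Kf fmap0.
Qed.

Lemma dist_cocone (Y Z : C) (g : chom Y Z) :
  exists (X : C) (f : chom X Y) (h : chom Z (sh X)), dist f g h.
Proof.
have [W [p [q D]]] := dist_cone g.
have [s [sK Ks]] := shK_iso W.
have [f fE] := sh_full (q \oc s).
exists (sh' W), (- f), (shK W \oc p); apply/dist_rot.
apply: (dist_iso (is_iso_id _) (is_iso_id _) (shK_iso W) _ _ _ D).
- by rewrite cmp1m cmpm1.
- by rewrite cmpm1.
- by rewrite fmap1 cmp1m fmapN opprK -fE -cmpA sK cmpm1.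
Qed.

End KilledMorphisms.

Section ClusterTilting.
Variables (k : finFieldType) (C : triCat k) (T : C) (hT : cluster_tilting T).
Implicit Types X Y Z : C.

Lemma add_rigid X (t : chom T (sh X)) : in_add T X -> t = 0.
Proof. by case: hT => tT _ /tT. Qed.

Lemma in_add_T : in_add T T.
Proof. exact: in_add_self (@tri_additive _ C). Qed.

(** A basis of Hom(T, X) gives a map T^m -> X through which all maps T -> X
    factor. Its cocone has no maps from T to its suspension, because T is rigid,
    and so lies in add T. *)
Lemma approximation X : exists (T1 T0 : C) (mu : chom T1 T0) (pi : chom T0 X)
    (kappa : chom X (sh T1)),
  [/\ in_add T T1, in_add T T0 & dist mu pi kappa].
Proof.
pose b := vbasis {:chom T X}.
have [S [inj [prj [pi0 pi1 sum1]]]] :=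
  @tri_additive _ C _ (fun _ : 'I_(\dim {:chom T X}) => T).
pose pi : chom S X := \sum_(a < \dim {:chom T X}) b`_a \oc prj a.
have aS : in_add T S.
  case: hT => tT _; apply/tT => f; rewrite -(cmp1m f) -fmap1 -sum1 fmap_sum.
  rewrite cmp_suml big1 // => a _; rewrite fmapM -cmpA.
  by rewrite (add_rigid (fmap sh (prj a) \oc f) in_add_T) cmpm0.
have lift (t : chom T X) : exists t', t = pi \oc t'.
  exists (\sum_(a < \dim {:chom T X}) coord b a t *: inj a).
  rewrite {1}(coord_vbasis (memvf t)) cmp_sumr; apply: eq_bigr => a _.
  rewrite cmpmZ cmp_suml (bigD1 a) //= -cmpA pi0 cmpm1 big1 ?addr0 // => c ca.
  by rewrite -cmpA pi1 1?eq_sym // cmpm0.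
have [T1 [mu [kappa D]]] := dist_cocone pi.
exists T1, S, mu, pi, kappa; split=> //.
case: hT => tT _; apply/tT => f.
have [t ->] := dist_lift'' D (add_rigid (fmap sh mu \oc f) aS).
have [t' ->] := lift t; by rewrite cmpA (dist_comp0' D) cmp0m.
Qed.

(** A map that vanishes on T vanishes on an approximation T0 of X, hence factors
    through the cone Sigma T1 of T0 -> X. *)
Lemma killed_through X Y (f : chom X Y) : killed T f <-> sum_through (sh T) f.
Proof.
split=> [Kf|[m [u [w ->]]] t]; last first.
  rewrite cmp_suml big1 // => a _.
  by rewrite -cmpA (add_rigid (w a \oc t) in_add_T) cmpm0.
have [T1 [T0 [mu [pi [kappa [a1 a0 D]]]]]] := approximation X.
have [|g ->] := dist_extend' (u := f) D.
  have [m [u [w uw]]] := in_add_sum a0.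
  rewrite -(cmpm1 pi) uw cmp_sumr cmp_sumr big1 // => a _.
  by rewrite !cmpA -(cmpA f) Kf cmp0m.
rewrite -(cmpm1 g) -fmap1; apply: sum_through_comp.
exact/sum_through_fmap/in_add_sum.
Qed.

(** This is [killed_through], transported along X = Sigma Sigma^-1 X and
    Y = Sigma Sigma^-1 Y. *)
Lemma killed_sh_through X Y (f : chom X Y) :
  killed (sh T) f <-> sum_through (sh (sh T)) f.
Proof.
have [s [sK Ks]] := shK_iso X; have [t [tK Kt]] := shK_iso Y.
have [g gE] := sh_full (shK Y \oc f \oc s).
have fE : f = t \oc fmap sh g \oc shK X.
  by rewrite -gE !cmpA tK cmp1m -cmpA sK cmpm1.
split=> [Kf|Tf].
  rewrite fE; apply/sum_through_comp/sum_through_fmap/killed_through/killed_sh.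
  by rewrite -gE; apply/killed_pre/killed_post.
rewrite fE; apply/killed_pre/killed_post/(killed_sh T g).1/killed_through/sum_through_sh.
by rewrite -gE; apply: sum_through_comp.
Qed.

Lemma through_killed X Y (f : chom X Y) : through (sh T) f <-> killed T f.
Proof.
apply: iff_trans (iff_sym (killed_through f)).
exact: through_sum (@tri_additive _ C).
Qed.

Lemma through_killed_sh X Y (f : chom X Y) : through (sh (sh T)) f <-> killed (sh T) f.
Proof.
apply: iff_trans (iff_sym (killed_sh_through f)).
exact: through_sum (@tri_additive _ C).
Qed.

End ClusterTilting.

(** * Modules over the endomorphism ring *)

Section Modules.
Variables (k : finFieldType) (C : triCat k) (T : C).
Implicit Types X Y Z : rmod T.

Lemma mem_rhom X Y (f : 'Hom(X, Y)) :
  f \in rhom X Y <-> forall x b, f (ract x b) = ract (f x) b.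
Proof.
apply: mem_vspan => [x b|a g h Hg Hh x b].
  by rewrite !zero_lfunE -(mklinE (ract_linl b)) linear0.
rewrite !add_lfunE !scale_lfunE Hg Hh -!(mklinE (ract_linl b)).
by rewrite linearD linearZ.
Qed.

Lemma ract0m X b : ract (0 : X) b = 0.
Proof. by rewrite -(mklinE (ract_linl b)) linear0. Qed.
Lemma ractDm X (x y : X) b : ract (x + y) b = ract x b + ract y b.
Proof. by rewrite -!(mklinE (ract_linl b)) linearD. Qed.
Lemma ractNm X (x : X) b : ract (- x) b = - ract x b.
Proof. by rewrite -!(mklinE (ract_linl b)) linearN. Qed.
Lemma ractBm X (x y : X) b : ract (x - y) b = ract x b - ract y b.
Proof. by rewrite ractDm ractNm. Qed.
Lemma ractZm X a (x : X) b : ract (a *: x) b = a *: ract x b.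
Proof. by rewrite -!(mklinE (ract_linl b)) linearZ. Qed.
Lemma ract_suml X (I : finType) (x : I -> X) b :
  ract (\sum_i x i) b = \sum_i ract (x i) b.
Proof.
rewrite -!(mklinE (ract_linl b)) linear_sum.
by apply: eq_bigr => i _; exact: mklinE.
Qed.
Lemma rhom_comp X Y Z (g : 'Hom(Y, Z)) (f : 'Hom(X, Y)) :
  g \in rhom Y Z -> f \in rhom X Y -> (g \o f)%VF \in rhom X Z.
Proof.
move=> /mem_rhom Hg /mem_rhom Hf; apply/mem_rhom => x b.
by rewrite !comp_lfunE Hf Hg.
Qed.

Definition miso X Y : Prop :=
  exists (f : 'Hom(X, Y)) (g : 'Hom(Y, X)),
    [/\ f \in rhom X Y, g \in rhom Y X, cancel f g & cancel g f].

Lemma miso_sym X Y : miso X Y -> miso Y X.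
Proof. by case=> f [g [? ? ? ?]]; exists g, f. Qed.

Lemma miso_refl X : miso X X.
Proof.
by exists \1%VF, \1%VF; split=> [||x|x]; rewrite ?id_lfunE //;
  apply/mem_rhom => x b; rewrite !id_lfunE.
Qed.

Lemma miso_trans X Y Z : miso X Y -> miso Y Z -> miso X Z.
Proof.
case=> f [f' [Hf Hf' ff' f'f]] [g [g' [Hg Hg' gg' g'g]]].
exists (g \o f)%VF, (f' \o g')%VF; split; try exact: rhom_comp.
  by move=> x; rewrite !comp_lfunE gg' ff'.
by move=> x; rewrite !comp_lfunE f'f g'g.
Qed.

Lemma miso_bij X Y (f : 'Hom(X, Y)) : f \in rhom X Y -> injective f ->
  (forall y, exists x, y = f x) -> miso X Y.
Proof.
move=> Hf injf surf; exists f, (f^-1)%VF.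
have kf : lker f == 0%VS by apply/lker0P.
have fK : cancel f (f^-1)%VF by move=> x; rewrite lker0_lfunK.
have Kf : cancel (f^-1)%VF f by move=> y; have [x ->] := surf y; rewrite fK.
split=> //; apply/mem_rhom => y b; apply: injf.
by rewrite Kf (mem_rhom f).1 // Kf.
Qed.

End Modules.

Section HomDimension.
Variables (k : fieldType) (U V : vectType k).

Lemma dim_le_inj (L : 'Hom(U, V)) (A : {vspace U}) (B : {vspace V}) :
  injective L -> (forall x, x \in A -> L x \in B) -> (\dim A <= \dim B)%N.
Proof.
move=> injL LAB; rewrite -(limg_dim_eq (f := L) (U := A)); last first.
  by move/lker0P/eqP: injL => ->; rewrite capv0.
by apply: dimvS; apply/subvP => _ /memv_imgP[x xA ->]; apply: LAB.
Qed.

End HomDimension.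

Section Conjugation.
Variables (k : fieldType) (X X' Y Y' : vectType k).
Variables (f : 'Hom(X', X)) (g : 'Hom(Y, Y')).

Lemma conj_lin_subproof : linear (fun h : 'Hom(X, Y) => (g \o h \o f)%VF).
Proof.
move=> a h h'; apply/lfunP => x.
by rewrite !(comp_lfunE, add_lfunE, scale_lfunE) linearP.
Qed.

Definition conj_lin : 'Hom('Hom(X, Y), 'Hom(X', Y')) := mklin conj_lin_subproof.

Lemma conj_linE h x : conj_lin h x = g (h (f x)).
Proof. by rewrite mklinE !comp_lfunE. Qed.

Lemma conj_lin_inj : (forall y, exists x, y = f x) -> injective g -> injective conj_lin.
Proof.
move=> surf injg h h' /lfunP hh'; apply/lfunP => y; have [x ->] := surf y.
by apply: injg; rewrite -!conj_linE.
Qed.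

End Conjugation.

Section IsomorphismInvariance.
Variables (k : finFieldType) (C : triCat k) (T : C).
Implicit Types X Y Z : rmod T.

Lemma dim_rhom_iso X X' Y Y' : miso X X' -> miso Y Y' ->
  \dim (rhom X Y) = \dim (rhom X' Y').
Proof.
have le X1 X2 Y1 Y2 : miso X1 X2 -> miso Y1 Y2 ->
    (\dim (rhom X1 Y1) <= \dim (rhom X2 Y2))%N.
  case=> f [f' [Hf Hf' ff' f'f]] [g [g' [Hg Hg' gg' g'g]]].
  apply: (dim_le_inj (L := conj_lin f' g)).
    by apply: conj_lin_inj; [move=> y; exists (f y)|exact: can_inj gg'].
  move=> h Hh; apply/mem_rhom => x b; rewrite !conj_linE.
  by rewrite (mem_rhom f').1 // (mem_rhom h).1 // (mem_rhom g).1.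
by move=> iX iY; apply/eqP; rewrite eqn_leq !le //; apply: miso_sym.
Qed.

Lemma mem_cocycles X Y (D : 'Hom(chom T T, 'Hom(X, Y))) :
  D \in ext_cocycles X Y <->
  forall b c x, D (b \oc c) x = ract (D b x) c + D c (ract x b).
Proof.
apply: mem_vspan => [b c x|a D1 D2 H1 H2 b c x].
  by rewrite !zero_lfunE ract0m addr0.
rewrite !(add_lfunE, scale_lfunE) H1 H2.
by rewrite scalerDr ractDm ractZm addrACA.
Qed.

Lemma mem_coboundaries X Y (D : 'Hom(chom T T, 'Hom(X, Y))) :
  D \in ext_coboundaries X Y <->
  exists h : 'Hom(X, Y), forall b x, D b x = ract (h x) b - h (ract x b).
Proof.
apply: mem_vspan => [|a D1 D2 [h1 H1] [h2 H2]].
  by exists 0 => b x; rewrite !zero_lfunE ract0m subrr.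
exists (a *: h1 + h2) => b x.
rewrite !(add_lfunE, scale_lfunE) H1 H2 ractDm ractZm scalerBr opprD.
by rewrite addrACA.
Qed.

Lemma dim_ext1_iso X X' Y Y' : miso X X' -> miso Y Y' ->
  dim_ext1 X Y = dim_ext1 X' Y'.
Proof.
move=> iX iY; rewrite /dim_ext1; congr (_ - _)%N.
  have le X1 X2 Y1 Y2 : miso X1 X2 -> miso Y1 Y2 ->
      (\dim (ext_cocycles X1 Y1) <= \dim (ext_cocycles X2 Y2))%N.
    case=> f [f' [Hf Hf' ff' f'f]] [g [g' [Hg Hg' gg' g'g]]].
    apply: (dim_le_inj (L := conj_lin \1%VF (conj_lin f' g))).
      apply: conj_lin_inj; first by move=> y; exists y; rewrite id_lfunE.
      by apply: conj_lin_inj; [move=> y; exists (f y)|exact: can_inj gg'].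
    move=> D /mem_cocycles HD; apply/mem_cocycles => b c x.
    rewrite !conj_linE !id_lfunE HD linearD /= (mem_rhom f').1 //.
    by rewrite (mem_rhom g).1.
  by apply/eqP; rewrite eqn_leq !le //; apply: miso_sym.
have le X1 X2 Y1 Y2 : miso X1 X2 -> miso Y1 Y2 ->
    (\dim (ext_coboundaries X1 Y1) <= \dim (ext_coboundaries X2 Y2))%N.
  case=> f [f' [Hf Hf' ff' f'f]] [g [g' [Hg Hg' gg' g'g]]].
  apply: (dim_le_inj (L := conj_lin \1%VF (conj_lin f' g))).
    apply: conj_lin_inj; first by move=> y; exists y; rewrite id_lfunE.
    by apply: conj_lin_inj; [move=> y; exists (f y)|exact: can_inj gg'].
  move=> D /mem_coboundaries[h HD]; apply/mem_coboundaries; exists (conj_lin f' g h).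
  move=> b x; rewrite !conj_linE !id_lfunE HD linearB /= (mem_rhom f').1 //.
  by rewrite (mem_rhom g).1.
by apply/eqP; rewrite eqn_leq !le //; apply: miso_sym.
Qed.

Lemma euler_a_iso X X' Y Y' : miso X X' -> miso Y Y' ->
  euler_a X Y = euler_a X' Y'.
Proof.
move=> iX iY; rewrite /euler_a /euler.
rewrite (dim_rhom_iso iX iY) (dim_rhom_iso iY iX).
by rewrite (dim_ext1_iso iX iY) (dim_ext1_iso iY iX).
Qed.

End IsomorphismInvariance.

Section Fullness.
Variables (k : finFieldType) (C : triCat k) (T : C) (hT : cluster_tilting T).

Lemma Fmap_rhom (X Y : C) (f : chom X Y) : Fmap T f \in rhom (F T X) (F T Y).
Proof. by apply/mem_rhom => x b; rewrite !FmapE /= /F_act cmpA. Qed.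

(** Hom(T, T') is projective for T' in add T: writing id = sum u_a w_a through
    copies of T, a module map on it is free to take any values on the u_a that
    come from a map already known to exist. *)
Lemma proj_lift (P : C) (X Y : rmod T) (f : 'Hom(X, Y)) (h : 'Hom(F T P, Y)) :
  in_add T P -> f \in rhom X Y -> h \in rhom (F T P) Y ->
  (forall u, exists x, h u = f x) ->
  exists2 h' : 'Hom(F T P, X), h' \in rhom (F T P) X & forall u, h u = f (h' u).
Proof.
move=> /in_add_sum[m [u [w uw]]] /mem_rhom Hf /mem_rhom Hh fh.
have /choice[x xE] : forall a, exists y, h (u a) = f y by move=> a; apply: fh.
have lin : linear (fun v : F T P => \sum_a ract (x a) (w a \oc v)).
  move=> c v v'; rewrite scaler_sumr -big_split /=; apply: eq_bigr => a _.
  by rewrite cmpmD cmpmZ ract_linr.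
exists (mklin lin); last first.
  move=> v; rewrite mklinE linear_sum /= -{1}(cmp1m v) uw cmp_suml linear_sum.
  by apply: eq_bigr => a _; rewrite /= Hf -xE -Hh /= /F_act cmpA.
apply/mem_rhom => v b; rewrite !mklinE ract_suml.
by apply: eq_bigr => a _; rewrite -ractM /= /F_act cmpA.
Qed.

Lemma F_full_add (P Y : C) (g : 'Hom(F T P, F T Y)) :
  in_add T P -> g \in rhom (F T P) (F T Y) ->
  exists f : chom P Y, forall u, g u = f \oc u.
Proof.
move=> /in_add_sum[m [u [w uw]]] /mem_rhom Hg.
exists (\sum_a (g (u a) : chom T Y) \oc w a) => v.
rewrite cmp_suml -{1}(cmp1m v) uw cmp_suml linear_sum; apply: eq_bigr => a _.
by rewrite -!cmpA; apply: (Hg (u a) (w a \oc v)).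
Qed.

Lemma F_faithful_add (P Y : C) (f : chom P Y) : in_add T P -> killed T f -> f = 0.
Proof.
move=> /in_add_sum[m [u [w uw]]] Kf; rewrite -(cmpm1 f) uw cmp_sumr big1 // => a _.
by rewrite cmpA Kf cmp0m.
Qed.

Lemma approx_surj (X T1 T0 : C) (mu : chom T1 T0) (pi : chom T0 X)
    (kappa : chom X (sh T1)) : in_add T T1 -> dist mu pi kappa ->
  forall t : chom T X, exists u, t = pi \oc u.
Proof. by move=> a1 D t; apply: dist_lift' D _; apply: add_rigid. Qed.

(** On an approximation T0 of X a module map comes from a map of C. It vanishes on
    the relations T1, hence descends to X. *)
Lemma F_full (X Y : C) (g : 'Hom(F T X, F T Y)) : g \in rhom (F T X) (F T Y) ->
  exists f : chom X Y, forall x, g x = f \oc x.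
Proof.
move=> Hg; have [T1 [T0 [mu [pi [kappa [a1 a0 D]]]]]] := approximation hT X.
have [f0 f0E] := F_full_add a0 (rhom_comp Hg (Fmap_rhom pi)).
have [|f fE] := dist_extend (u := f0) D.
  apply: (F_faithful_add a1) => t.
  rewrite -cmpA -f0E comp_lfunE FmapE cmpA (dist_comp0 D) cmp0m.
  exact: linear0.
exists f => x; have [u ->] := approx_surj a1 D x.
by rewrite cmpA -fE -f0E comp_lfunE FmapE.
Qed.

Lemma FmapL_subproof (X Y : C) : linear (fun f : chom X Y => Fmap T f).
Proof.
move=> a f g; apply/lfunP => x.
by rewrite add_lfunE scale_lfunE !FmapE cmpDm cmpZm.
Qed.

(** By fullness of [F], and as its kernel is the ideal of maps killed by T. *)
Lemma dim_rhomF (X Y : C) :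
  (\dim (rhom (F T X) (F T Y)) + \dim (killedvs T X Y))%N = \dim {:chom X Y}.
Proof.
rewrite -(limg_ker_dim (mklin (@FmapL_subproof X Y)) fullv) addnC.
congr (_ + _)%N; congr (\dim _); apply/vspaceP => f.
  rewrite capfv memv_ker mklinE; apply/idP/idP => [/mem_killed Kf|/eqP Kf].
    by apply/eqP/lfunP => x; rewrite FmapE Kf lfunE.
  by apply/mem_killed => t; have := FmapE f t; rewrite Kf lfunE => <-.
apply/idP/idP => [/F_full[g gE]|/memv_imgP[g _ ->]].
  apply/memv_imgP; exists g; first exact: memvf.
  by apply/lfunP => x; rewrite mklinE FmapE.
by rewrite mklinE; apply: Fmap_rhom.
Qed.

Lemma dim_rhomF_add (P Y : C) : in_add T P ->
  \dim (rhom (F T P) (F T Y)) = \dim {:chom P Y}.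
Proof.
move=> aP; rewrite -(dim_rhomF P Y); suff -> : killedvs T P Y = 0%VS.
  by rewrite dimv0 addn0.
apply/vspaceP => f; rewrite memv0; apply/idP/idP => [/mem_killed|/eqP->].
  by move/(F_faithful_add aP) ->.
by rewrite mem0v.
Qed.

End Fullness.

Section SubquotientDimension.
Variables (k : fieldType) (U V : vectType k) (Phi : 'Hom(U, V)).

(** The isomorphism G / G0 = Z / B induced by Phi, in terms of dimensions. *)
Lemma dim_subquotient (G G0 : {vspace U}) (Z B : {vspace V}) :
    (G0 <= G)%VS -> (B <= Z)%VS ->
    (forall g, g \in G -> Phi g \in Z) ->
    (forall g, g \in G -> (Phi g \in B) = (g \in G0)) ->
    (forall z, z \in Z -> exists2 g, g \in G & z - Phi g \in B) ->
  (\dim Z + \dim G0 = \dim G + \dim B)%N.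
Proof.
move=> G0G BZ GZ GB surj.
have ZE : Z = (Phi @: G + B)%VS.
  apply/eqP; rewrite eqEsubv subv_add BZ andbT; apply/andP; split.
    apply/subvP => z /surj[g gG zB]; rewrite -(subrK (Phi g) z) addrC memv_add //.
    exact: memv_img.
  by apply/subvP => _ /memv_imgP[g gG ->]; apply: GZ.
have capE : (Phi @: G :&: B = Phi @: G0)%VS.
  apply/vspaceP => z; rewrite memv_cap; apply/andP/memv_imgP.
    by case=> /memv_imgP[g gG ->]; rewrite GB // => gG0; exists g.
  case=> g gG0 ->; have gG := subvP G0G _ gG0.
  by rewrite memv_img // GB.
have kerE : (G :&: lker Phi = G0 :&: lker Phi)%VS.
  apply/vspaceP => g; rewrite !memv_cap memv_ker; case: eqP => [p0|]; rewrite ?andbF //.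
  rewrite !andbT; apply/idP/idP => [gG|]; last exact: subvP.
  by rewrite -GB // p0 mem0v.
have d1 := dimv_sum_cap (Phi @: G) B; rewrite -ZE capE in d1.
have d2 := limg_ker_dim Phi G; have d3 := limg_ker_dim Phi G0.
rewrite kerE in d2; lia.
Qed.

End SubquotientDimension.

Section Extension.
Variables (k : finFieldType) (C : triCat k) (T : C).
Variables (X Y : rmod T) (D : 'Hom(chom T T, 'Hom(Y, X))).
Hypothesis HD : D \in ext_cocycles Y X.

Let E : vectType k := (Y * X)%type.

(** The extension of Y by X with cocycle D, on the direct sum. *)
Definition ext_act (z : E) (b : chom T T) : E := (ract z.1 b, ract z.2 b + D b z.1).

Fact ext_act_linl b : linear (ext_act^~ b).
Proof.
move=> a [y x] [y' x']; congr (_, _) => /=; first exact: ract_linl.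
by rewrite ract_linl linearP scalerDr addrACA.
Qed.
Fact ext_act_linr z : linear (ext_act z).
Proof.
move=> a b c; congr (_, _) => /=; first exact: ract_linr.
by rewrite ract_linr linearP add_lfunE scale_lfunE scalerDr addrACA.
Qed.
Fact ext_act1 z : ext_act z (idm T) = z.
Proof.
have D1 y : D (idm T) y = 0.
  have := (mem_cocycles D).1 HD (idm T) (idm T) y; rewrite cmp1m !ract1.
  by move/eqP; rewrite -subr_eq0 opprD addrA subrr sub0r oppr_eq0 => /eqP.
by case: z => y x; rewrite /ext_act /= D1 !ract1 addr0.
Qed.
Fact ext_actM z b c : ext_act z (b \oc c) = ext_act (ext_act z b) c.
Proof.
case: z => y x; congr (_, _) => /=; first exact: ractM.
by rewrite ractM ractDm ((mem_cocycles D).1 HD) addrA.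
Qed.

Definition ext_mod : rmod T := RMod ext_act_linl ext_act_linr ext_act1 ext_actM.

Lemma ext_fst_subproof : linear (fun z : ext_mod => z.1 : Y).
Proof. by []. Qed.

Definition ext_fst : 'Hom(ext_mod, Y) := mklin ext_fst_subproof.

Lemma ext_fst_rhom : ext_fst \in rhom ext_mod Y.
Proof. by apply/mem_rhom => z b; rewrite !mklinE. Qed.

End Extension.

Section Ext1.
Variables (k : finFieldType) (C : triCat k) (T : C) (hT : cluster_tilting T).
Variables (X Y T1 T0 : C).
Variables (mu : chom T1 T0) (pi : chom T0 Y) (kappa : chom Y (sh T1)).
Hypotheses (a1 : in_add T T1) (a0 : in_add T T0) (D : dist mu pi kappa).

Let s : 'Hom(chom T Y, chom T T0) := (lpost T pi)^-1%VF.
Let r : 'Hom(chom T T0, chom T T1) := (lpost T mu)^-1%VF.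

Let sK y : pi \oc s y = y.
Proof.
rewrite -lpostE /s limg_lfunVK //; have [u ->] := approx_surj hT a1 D y.
by rewrite -lpostE memv_img // memvf.
Qed.

Let rK u : pi \oc u = 0 -> mu \oc r u = u.
Proof.
move/(dist_lift D) => [v ->]; rewrite -(lpostE mu v) -[LHS]lpostE.
by rewrite /r limg_lfunVK // memv_img // memvf.
Qed.

Let Q (g : chom T1 X) : Prop := forall u : chom T T1, mu \oc u = 0 -> g \oc u = 0.

Let Q_r g (v : chom T T1) : Q g -> g \oc r (mu \oc v) = g \oc v.
Proof.
move=> Qg; apply/eqP; rewrite -subr_eq0 -cmpmB Qg // cmpmB rK ?subrr //.
by rewrite cmpA (dist_comp0 D) cmp0m.
Qed.

Let pi_s (y : F T Y) b : pi \oc (s y \oc b - s (y \oc b)) = 0.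
Proof. by rewrite cmpmB cmpA !sK subrr. Qed.

Let cochain_lin g b : linear (fun y : F T Y => g \oc r (s y \oc b - s (y \oc b)) : F T X).
Proof.
move=> a y y'.
have -> : s (a *: y + y') \oc b - s ((a *: y + y') \oc b) =
    a *: (s y \oc b - s (y \oc b)) + (s y' \oc b - s (y' \oc b)).
  by rewrite cmpDm cmpZm !linearP cmpDm cmpZm scalerDr addrACA.
by rewrite linearP cmpmD cmpmZ.
Qed.

Let cochain_lin1 g : linear (fun b => mklin (cochain_lin g b)).
Proof.
move=> a b c; apply/lfunP => y; rewrite add_lfunE scale_lfunE !mklinE.
have -> : s y \oc (a *: b + c) - s (y \oc (a *: b + c)) =
    a *: (s y \oc b - s (y \oc b)) + (s y \oc c - s (y \oc c)).
  by rewrite !cmpmD !cmpmZ linearP scalerBr opprD addrACA.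
by rewrite linearP cmpmD cmpmZ.
Qed.

Let cochain_lin2 : linear (fun g => mklin (cochain_lin1 g)).
Proof.
move=> a g g'; apply/lfunP => b; apply/lfunP => y.
by rewrite !(add_lfunE, scale_lfunE, mklinE) cmpDm cmpZm.
Qed.

(** The connecting map Hom(T1, X) -> Ext^1(FY, FX) on cochains: the
    defect of B-linearity of a section s : FY -> F T0 takes its values in the image
    of F T1. *)
Let cochain := mklin cochain_lin2.

Let cochainE g b y : cochain g b y = g \oc r (s y \oc b - s (y \oc b)).
Proof. by rewrite !mklinE. Qed.

Let G := vspan Q.
Let G0 : {vspace chom T1 X} := limg (lpre X mu).

Let mem_G g : g \in G <-> Q g.
Proof.
apply: mem_vspan => [u _|a h h' Qh Qh' u mu0]; first by rewrite cmp0m.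
by rewrite cmpDm cmpZm Qh // Qh' // scaler0 addr0.
Qed.

Let mem_G0 g : g \in G0 <-> exists t, g = t \oc mu.
Proof.
split=> [/memv_imgP[t _ ->]|[t ->]]; first by exists t; rewrite lpreE.
by rewrite -lpreE memv_img // memvf.
Qed.

Let G0G : (G0 <= G)%VS.
Proof.
by apply/subvP => g /mem_G0[t ->]; apply/mem_G => u mu0; rewrite -cmpA mu0 cmpm0.
Qed.

Let coboundary_cocycle : (ext_coboundaries (F T Y) (F T X) <= ext_cocycles (F T Y) (F T X))%VS.
Proof.
apply/subvP => d /mem_coboundaries[h hE]; apply/mem_cocycles => b c x.
by rewrite !hE !ractM ractBm addrA subrK.
Qed.

Let cochain_cocycle g : g \in G -> cochain g \in ext_cocycles (F T Y) (F T X).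
Proof.
move/mem_G => Qg; apply/mem_cocycles => b c y; rewrite !cochainE /= /F_act.
rewrite -cmpA -cmpmD -[LHS](Q_r _ Qg) -[RHS](Q_r _ Qg); congr (_ \oc r _).
rewrite cmpmD (cmpA mu) !rK ?pi_s //.
by rewrite cmpBm !cmpA addrA subrK.
Qed.

Let cochain_coboundary g : g \in G ->
  (cochain g \in ext_coboundaries (F T Y) (F T X)) = (g \in G0).
Proof.
move=> gG; have Qg := (mem_G g).1 gG; apply/idP/idP; last first.
  case/mem_G0 => t tE; apply/mem_coboundaries.
  exists (lpost T t \o s)%VF => b y; rewrite cochainE tE -cmpA rK ?pi_s //.
  by rewrite cmpmB cmpA !comp_lfunE !lpostE.
case/mem_coboundaries=> h hE; apply/mem_G0.
pose t : 'Hom(F T T0, F T X) :=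
  ((h \o lpost T pi) + (lpost T g \o (r \o (\1 - (s \o lpost T pi)))))%VF.
have tE u : t u = h (pi \oc u) + g \oc r (u - s (pi \oc u)).
  by rewrite !(add_lfunE, comp_lfunE, opp_lfunE, id_lfunE, lpostE).
have Ht : t \in rhom (F T T0) (F T X).
  apply/mem_rhom => u b; rewrite !tE ractDm /= /F_act.
  have -> : (h (pi \oc u) : chom T X) \oc b = h (pi \oc u \oc b) +
      g \oc r (s (pi \oc u) \oc b - s (pi \oc u \oc b)).
    by rewrite -cochainE hE addrC subrK.
  rewrite -addrA (cmpA pi); congr (_ + _); rewrite -(cmpA g) -cmpmD.
  rewrite -[LHS](Q_r _ Qg) -[RHS](Q_r _ Qg); congr (_ \oc r _).
  rewrite cmpmD (cmpA mu) !rK ?pi_s ?cmpmB ?sK ?(cmpA pi) ?subrr //.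
  by rewrite cmpBm [RHS]addrC addrA subrK.
have [t' t'E] := F_full_add a0 Ht; exists t'.
apply/eqP; rewrite -subr_eq0; apply/eqP/(F_faithful_add a1) => w.
rewrite cmpBm -cmpA -t'E tE cmpA (dist_comp0 D) cmp0m !linear0 ?addr0 add0r.
by rewrite Q_r // subrr.
Qed.

(** Since F T0 is projective, T0 -> Y lifts to the extension with cocycle d, and
    the restriction of the lift to the relations T1 gives back the class of d. *)
Let cochain_surj d : d \in ext_cocycles (F T Y) (F T X) ->
  exists2 g, g \in G & d - cochain g \in ext_coboundaries (F T Y) (F T X).
Proof.
move=> Hd.
have [|h Hh hE] := proj_lift a0 (ext_fst_rhom Hd) (Fmap_rhom T pi).
  by move=> u; exists ((pi \oc u, 0) : ext_mod Hd); rewrite FmapE mklinE.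
have h1 u : (h u).1 = pi \oc u by rewrite -FmapE hE mklinE.
pose t1 u : chom T X := (h u).2.
have t1M u b : t1 (u \oc b) = t1 u \oc b + d b (pi \oc u).
  by rewrite /t1 ((mem_rhom h).1 Hh u b) /= h1.
have t1lin : linear (fun w : F T T1 => t1 (mu \oc w) : F T X).
  by move=> a w w'; rewrite /t1 cmpmD cmpmZ linearP.
have [|g gE] := F_full_add (g := mklin t1lin) a1.
  apply/mem_rhom => w b; rewrite !mklinE /= /F_act cmpA t1M cmpA.
  by rewrite (dist_comp0 D) cmp0m linear0 addr0.
have gt w : g \oc w = t1 (mu \oc w) by rewrite -gE mklinE.
exists g.
  by apply/mem_G => u mu0; rewrite gt mu0 /t1 linear0.
have t1B u v : t1 (u - v) = t1 u - t1 v by rewrite /t1 linearB.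
have t2lin : linear (fun y : F T Y => - t1 (s y) : F T X).
  by move=> a y y'; rewrite /t1 !linearP.
apply/mem_coboundaries; exists (mklin t2lin) => b y.
rewrite add_lfunE opp_lfunE add_lfunE opp_lfunE cochainE gt rK ?pi_s // t1B t1M sK.
rewrite !mklinE /= /F_act cmpNm opprK.
by rewrite addrAC opprD addrCA subrr addr0 opprB addrC.
Qed.

Let connect_lin : linear (fun g : chom T1 X => fmap sh g \oc kappa).
Proof. by move=> a g g'; rewrite fmap_lin cmpDm cmpZm. Qed.

(** Both sides are Hom(T1, X), restricted to the maps that kill the kernel of
    F T1 -> F T0, modulo the maps that extend to T0. *)
Lemma dim_ext1_approx : dim_ext1 (F T Y) (F T X) =
  \dim (killedvs T Y (sh X) :&: killedvs (sh T) Y (sh X)).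
Proof.
have d1 := dim_subquotient G0G coboundary_cocycle cochain_cocycle
  cochain_coboundary cochain_surj.
have d2 : (\dim (killedvs T Y (sh X) :&: killedvs (sh T) Y (sh X)) + \dim G0
    = \dim G + \dim (0%VS : {vspace chom Y (sh X)}))%N.
  apply: (dim_subquotient (Phi := mklin connect_lin) G0G); first exact: sub0v.
  - move=> g /mem_G Qg; rewrite mklinE memv_cap; apply/andP; split; apply/mem_killed.
      move=> t; have [u ->] := approx_surj hT a1 D t.
      by rewrite -cmpA (cmpA kappa) (dist_comp0' D) cmp0m cmpm0.
    move=> t; rewrite -cmpA.
    have [u uE] := sh_full (kappa \oc t); rewrite uE -fmapM Qg ?fmap0 //.
    by apply: sh_eq0; rewrite fmapM -uE cmpA (dist_comp0'' D) cmp0m.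
  - move=> g gG; rewrite mklinE memv0; apply/eqP/idP => [g0|/mem_G0[t ->]].
      have [v vE] := dist_extend'' D g0; have [t tE] := sh_full v.
      by apply/mem_G0; exists t; apply: sh_faithful; rewrite vE tE fmapM.
    by rewrite fmapM -cmpA (dist_comp0'' D) cmpm0.
  - move=> e; rewrite memv_cap => /andP[/mem_killed eT /mem_killed eST].
    have [|g' gE] := dist_extend' (u := e) D.
      by apply: (F_faithful_add a0); apply: killed_pre.
    have [g gg'] := sh_full g'; exists g; last first.
      by rewrite mklinE -gg' -gE subrr mem0v.
    apply/mem_G => u mu0; apply: sh_eq0; rewrite fmapM -gg'.
    have [|t ->] := dist_lift'' (u := fmap sh u) D.
      by rewrite -fmapM mu0 fmap0.
    by rewrite cmpA -gE eST.
rewrite dimv0 addn0 in d2; rewrite /dim_ext1; lia.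
Qed.

End Ext1.

(** A map Y -> Sigma X that [F] kills, both before and after desuspension, has a
    triangle on which [F] is short exact, and all extensions of FY by FX arise in
    this way. *)
Lemma dim_ext1F (k : finFieldType) (C : triCat k) (T : C) (hT : cluster_tilting T)
    (X Y : C) : dim_ext1 (F T Y) (F T X) =
  \dim (killedvs T Y (sh X) :&: killedvs (sh T) Y (sh X)).
Proof.
have [T1 [T0 [mu [pi [kappa [a1 a0 D]]]]]] := approximation hT Y.
exact: dim_ext1_approx a1 a0 D.
Qed.

(** * Perfect pairings and the Calabi-Yau duality *)

Section PerfectPairing.
Variable k : finFieldType.

Definition perfect (U V : vectType k) (B : 'Hom(U, 'Hom(V, k^o))) : Prop :=
  injective B /\ forall l, exists u, B u = l.

Definition perp (U V : vectType k) (B : 'Hom(U, 'Hom(V, k^o))) (A : {vspace V}) :=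
  vspan (fun u : U => forall a, a \in A -> B u a = 0).

Lemma mem_perp (U V : vectType k) (B : 'Hom(U, 'Hom(V, k^o))) (A : {vspace V}) u :
  u \in perp B A <-> forall a, a \in A -> B u a = 0.
Proof.
apply: mem_vspan => [a _|c x y Hx Hy a aA]; first by rewrite linear0 zero_lfunE.
by rewrite linearP add_lfunE scale_lfunE Hx // Hy // scaler0 addr0.
Qed.

Lemma dim_dual (V : vectType k) : \dim {:'Hom(V, k^o)} = \dim {:V}.
Proof. by rewrite !dimvf /dim /= muln1. Qed.

Lemma perfect_dim (U V : vectType k) (B : 'Hom(U, 'Hom(V, k^o))) :
  perfect B -> \dim {:U} = \dim {:V}.
Proof.
case=> injB surB; rewrite -(dim_dual V) -(limg_dim_eq (f := B) (U := fullv)).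
  congr (\dim _); apply/vspaceP => l; rewrite memvf; have [u <-] := surB l.
  by rewrite memv_img ?memvf.
by move/lker0P/eqP: injB => ->; rewrite capv0.
Qed.

(** The orthogonal of A is the kernel of the restriction of functionals to A,
    which is onto as functionals on A extend. *)
Lemma dim_perp (U V : vectType k) (B : 'Hom(U, 'Hom(V, k^o))) (A : {vspace V}) :
  perfect B -> (\dim (perp B A) + \dim A)%N = \dim {:U}.
Proof.
case=> injB surB.
pose i : 'Hom(subvs_of A, V) := linfun vsval.
pose r : 'Hom(V, subvs_of A) := linfun (vsproj A).
have iE x : i x = vsval x by rewrite lfunE.
have lin : linear (fun u => (B u \o i)%VF).
  move=> a u v; apply/lfunP => x.
  by rewrite !(comp_lfunE, add_lfunE, scale_lfunE, linearP).
have kerE : lker (mklin lin) = perp B A.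
  apply/vspaceP => u; rewrite memv_ker mklinE; apply/eqP/idP => [/lfunP u0|].
    apply/mem_perp => a aA; have := u0 (vsproj A a).
    by rewrite comp_lfunE iE zero_lfunE vsprojK.
  move/mem_perp => u0; apply/lfunP => x.
  by rewrite comp_lfunE iE zero_lfunE u0 // subvsP.
have imE : limg (mklin lin) = fullv.
  apply/vspaceP => l; rewrite memvf; have [u uE] := surB (l \o r)%VF.
  have -> : l = mklin lin u.
    rewrite mklinE; apply/lfunP => x.
    by rewrite comp_lfunE uE comp_lfunE iE lfunE /= vsvalK.
  by rewrite memv_img ?memvf.
by rewrite -(limg_ker_dim (mklin lin) fullv) capfv kerE imE dim_dual dimvf.
Qed.

Definition opp_pairing_lin (U V : vectType k) (B : 'Hom(U, 'Hom(V, k^o))) v :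
  linear (fun u => B u v).
Proof. by move=> a x y; rewrite linearP add_lfunE scale_lfunE. Qed.

Lemma opp_pairing_lin2 (U V : vectType k) (B : 'Hom(U, 'Hom(V, k^o))) :
  linear (fun v => mklin (opp_pairing_lin B v)).
Proof.
move=> a x y; apply/lfunP => u.
by rewrite !(add_lfunE, scale_lfunE, mklinE) linearP.
Qed.

Definition opp_pairing (U V : vectType k) (B : 'Hom(U, 'Hom(V, k^o))) :=
  mklin (opp_pairing_lin2 B).

Lemma opp_pairingE (U V : vectType k) (B : 'Hom(U, 'Hom(V, k^o))) u v :
  opp_pairing B v u = B u v.
Proof. by rewrite !mklinE. Qed.

(** A vector orthogonal to everything spans a space whose orthogonal is
    everything, so it vanishes by [dim_perp]. *)
Lemma perfect_opp (U V : vectType k) (B : 'Hom(U, 'Hom(V, k^o))) :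
  perfect B -> perfect (opp_pairing B).
Proof.
move=> pB; have inj : injective (opp_pairing B).
  apply/lker0P; rewrite -subv0; apply/subvP => v; rewrite memv_ker => /eqP v0.
  have := dim_perp <[v]>%VS pB; have -> : perp B <[v]>%VS = fullv.
    apply/vspaceP => u; rewrite memvf; apply/mem_perp => _ /vlineP[c ->].
    by rewrite linearZ /= -opp_pairingE v0 zero_lfunE scaler0.
  by move/eqP; rewrite -{2}[\dim fullv]addn0 eqn_add2l dimv_eq0 => /eqP v00; rewrite -v00 memv_line.
split=> // l.
have : limg (opp_pairing B) = fullv.
  apply/eqP; rewrite eqEdim subvf limg_dim_eq.
    by rewrite dim_dual (perfect_dim pB) leqnn.
  by move/lker0P/eqP: inj => ->; rewrite capv0.
by move/vspaceP/(_ l); rewrite memvf => /memv_imgP[v _ ->]; exists v.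
Qed.

(** Double orthogonality, in the form in which it is used to show membership. *)
Lemma perp_perp (U V : vectType k) (B : 'Hom(U, 'Hom(V, k^o))) (A : {vspace U}) u :
  perfect B -> (forall v, (forall a, a \in A -> B a v = 0) -> B u v = 0) -> u \in A.
Proof.
move=> pB Hu; pose P := perp (opp_pairing B) A.
have memP v : v \in P <-> forall a, a \in A -> B a v = 0.
  split=> [/mem_perp vA a aA|vA]; first by rewrite -opp_pairingE vA.
  by apply/mem_perp => a aA; rewrite opp_pairingE vA.
have -> : A = perp B P; last by apply/mem_perp => v /memP /Hu.
apply/eqP; rewrite eqEdim; apply/andP; split.
  by apply/subvP => a aA; apply/mem_perp => v /memP /(_ a aA).
have := dim_perp A (perfect_opp pB); rewrite -/P -(perfect_dim pB).
have := dim_perp P pB; lia.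
Qed.

Lemma dim_orthogonal (U V : vectType k) (B : 'Hom(U, 'Hom(V, k^o)))
    (A : {vspace U}) (A' : {vspace V}) :
  perfect B -> (forall u, u \in A <-> forall a, a \in A' -> B u a = 0) ->
  (\dim A + \dim A')%N = \dim {:U}.
Proof.
move=> pB AE; rewrite -(dim_perp A' pB); congr (\dim _ + _)%N.
by apply/vspaceP => u; apply/idP/idP => [/AE|] Hu; [apply/mem_perp|apply/AE/mem_perp].
Qed.

Lemma perfect_nondeg (U V : vectType k) (B : 'Hom(U, 'Hom(V, k^o))) u :
  perfect B -> (forall v, B u v = 0) -> u = 0.
Proof.
case=> injB _ u0; apply: injB; apply/lfunP => v.
by rewrite u0 linear0 zero_lfunE.
Qed.

End PerfectPairing.

Section CalabiYau.
Variables (k : finFieldType) (C : triCat k).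

Lemma serre_pairing : two_CY C ->
  exists S : forall X Y : C, 'Hom(chom X Y, 'Hom(chom Y (sh (sh X)), k^o)),
    [/\ forall X Y, perfect (S X Y),
        forall X Y Y' (g : chom Y Y') (f : chom X Y) (h : chom Y' (sh (sh X))),
          S X Y' (g \oc f) h = S X Y f (h \oc g) &
        forall X X' Y (a : chom X' X) (f : chom X Y) (h : chom Y (sh (sh X'))),
          S X' Y (f \oc a) h = S X Y f (fmap sh (fmap sh a) \oc h)].
Proof.
case=> phi [lin bij nat1 nat2]; exists (fun X Y => mklin (lin X Y)); split.
- move=> X Y; have [psi psiK phiK] := bij X Y; split.
    by move=> f g; rewrite !mklinE; apply: can_inj psiK _ _.
  by move=> l; exists (psi l); rewrite mklinE phiK.
- by move=> *; rewrite !mklinE nat1.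
- by move=> *; rewrite !mklinE nat2.
Qed.

(** This is the Serre pairing of Hom(X, Sigma Y) with Hom(Sigma Y, Sigma^2 X), the
    latter space being identified with Hom(Y, Sigma X). *)
Lemma cy_pairing : two_CY C ->
  exists B : forall X Y : C, 'Hom(chom X (sh Y), 'Hom(chom Y (sh X), k^o)),
    [/\ forall X Y, perfect (B X Y),
        forall X Y Y' (g : chom Y Y') (e : chom X (sh Y)) (h : chom Y' (sh X)),
          B X Y' (fmap sh g \oc e) h = B X Y e (h \oc g) &
        forall X X' Y (a : chom X' X) (e : chom X (sh Y)) (h : chom Y (sh X')),
          B X' Y (e \oc a) h = B X Y e (fmap sh a \oc h)].
Proof.
case/serre_pairing=> S [pS nat1 nat2].
pose shl (X Y : C) : 'Hom(chom X Y, chom (sh X) (sh Y)) := mklin (@fmap_lin _ _ (@sh k C) X Y).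
have shlE X Y (f : chom X Y) : shl X Y f = fmap sh f by rewrite mklinE.
have lin X Y : linear (fun e : chom X (sh Y) => (S X (sh Y) e \o shl Y (sh X))%VF).
  move=> a e e'; apply/lfunP => h.
  by rewrite !(comp_lfunE, add_lfunE, scale_lfunE, linearP).
have E X Y e h : mklin (lin X Y) e h = S X (sh Y) e (fmap sh h).
  by rewrite mklinE comp_lfunE shlE.
exists (fun X Y => mklin (lin X Y)); split.
- move=> X Y; split.
    move=> e e' /lfunP ee'; apply: (pS X (sh Y)).1; apply/lfunP => h.
    by have [h' ->] := sh_full h; rewrite -!E.
  move=> l; have injsh : injective (shl Y (sh X)).
    by move=> h h'; rewrite !shlE; apply: sh_faithful.
  have [e eE] := (pS X (sh Y)).2 (l \o (shl Y (sh X))^-1)%VF.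
  exists e; apply/lfunP => h; rewrite E eE comp_lfunE -shlE.
  by rewrite lker0_lfunK //; apply/lker0P.
- by move=> *; rewrite !E nat1 fmapM.
- by move=> *; rewrite !E nat2 fmapM.
Qed.

End CalabiYau.

Section Duality.
Variables (k : finFieldType) (C : triCat k) (hCY : two_CY C).
Variables (T : C) (hT : cluster_tilting T).
Implicit Types X Y : C.

Lemma dim_serre X Y : \dim {:chom X Y} = \dim {:chom Y (sh (sh X))}.
Proof. by have [S [pS _ _]] := serre_pairing hCY; exact: perfect_dim (pS X Y). Qed.

(** The maps killed by Sigma T are the orthogonal, for the Serre pairing, of the
    maps X -> Y killed by T, because the latter factor through Sigma T. *)
Lemma dim_killed_serre X Y :
  (\dim (killedvs (sh T) Y (sh (sh X))) + \dim (killedvs T X Y))%N = \dim {:chom X Y}.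
Proof.
have [S [pS nat1 nat2]] := serre_pairing hCY.
rewrite dim_serre; apply: (dim_orthogonal (perfect_opp (pS X Y))) => u.
split=> [/mem_killed Ku f /mem_killed/(killed_through hT)[m [s [r ->]]]|Hu].
  rewrite opp_pairingE linear_sum sum_lfunE big1 // => a _.
  by rewrite nat1 Ku linear0.
apply/mem_killed => t; apply: (perfect_nondeg (perfect_opp (pS X (sh T)))) => r.
rewrite opp_pairingE -nat1 -(opp_pairingE (S X Y)); apply: Hu; apply/mem_killed.
by apply/killed_pre/(killed_through hT); rewrite -(cmpm1 t); apply: sum_through_post;
  exists 1%N, (fun _ => idm _), (fun _ => idm _); rewrite big_ord1 cmp1m.
Qed.

End Duality.

Lemma vspan_eq (k : finFieldType) (V : vectType k) (P : V -> Prop) (W : {vspace V}) :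
  (forall x, P x <-> x \in W) -> vspan P = W.
Proof.
move=> PW; have memP x : x \in vspan P <-> P x.
  apply: mem_vspan => [|c y z /PW Wy /PW Wz]; apply/PW; first exact: mem0v.
  by rewrite memvD ?memvZ.
by apply/vspaceP => x; apply/idP/idP => [/memP/PW|/PW/memP].
Qed.

Section Gluing.
Variables (k : finFieldType) (C : triCat k) (hCY : two_CY C).
Variables (T : C) (hT : cluster_tilting T).

Definition Finj (X Y : C) (f : chom X Y) : Prop :=
  forall t : chom T X, f \oc t = 0 -> t = 0.

(** Every map X' -> Sigma^2 T extends along i : X' -> X when F i is injective,
    since Hom(X, Sigma^2 T) -> Hom(X', Sigma^2 T) is dual to F i. *)
Lemma extend_Finj (X X' Z : C) (i : chom X' X) (c : chom X' Z) :
  Finj i -> killed (sh T) c -> exists2 c', killed (sh T) c' & c = c' \oc i.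
Proof.
move=> injF /(killed_sh_through hT)[m [u [w ->]]].
have [S [pS nat1 _]] := serre_pairing hCY.
have ext a : exists w' : chom X (sh (sh T)), w a = w' \oc i.
  suff : w a \in limg (lpre (sh (sh T)) i).
    by case/memv_imgP=> w' _ ->; exists w'; rewrite lpreE.
  apply: (perp_perp (perfect_opp (pS T X'))) => t Ht.
  suff -> : t = 0 by rewrite linear0.
  apply: injF; apply: (perfect_nondeg (pS T X)) => h.
  rewrite nat1 -lpreE; have := Ht (lpre _ i h); rewrite opp_pairingE; apply.
  by rewrite memv_img ?memvf.
have /choice[w' wE] := ext.
exists (\sum_a u a \oc w' a).
  by apply/(killed_sh_through hT); exists m, u, w'.
by rewrite cmp_suml; apply: eq_bigr => a _; rewrite -cmpA -wE.
Qed.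

(** For lifts i and j of submodules M0 of FM and N0 of FN, these are the maps on
    whose triangles N -> L -> M there is a submodule of FL over (M0, N0), see
    [gluing_submodule] and [submodule_gluing]. The first condition says that
    the connecting map from F Sigma^-1 M to FN takes its values in N0, the second
    that the induced extension of M0 comes from an extension by N0. *)
Definition gluing (M N M' N' : C) (i : chom M' M) (j : chom N' N) :
    {vspace chom M (sh N)} :=
  vspan (fun e : chom M (sh N) =>
    (exists a c, killed (sh T) c /\ e = fmap sh j \oc a + c) /\
    (exists s, killed T s /\ e \oc i = fmap sh j \oc s)).

Lemma mem_gluing (M N M' N' : C) (i : chom M' M) (j : chom N' N) e :
  e \in gluing i j <->
    (exists a c, killed (sh T) c /\ e = fmap sh j \oc a + c) /\
    (exists s, killed T s /\ e \oc i = fmap sh j \oc s).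
Proof.
apply: mem_vspan => [|x e1 e2 [[a1 [c1 [K1 E1]]] [s1 [L1 G1]]] [[a2 [c2 [K2 E2]]] [s2 [L2 G2]]]].
  split; first by exists 0, 0; rewrite cmpm0 addr0; split=> // t; rewrite cmp0m.
  by exists 0; rewrite cmpm0 cmp0m; split=> // t; rewrite cmp0m.
split.
  exists (x *: a1 + a2), (x *: c1 + c2); split.
    by move=> t; rewrite cmpDm cmpZm K1 K2 scaler0 addr0.
  by rewrite E1 E2 cmpmD cmpmZ scalerDr addrACA.
exists (x *: s1 + s2); split.
  by move=> t; rewrite cmpDm cmpZm L1 L2 scaler0 addr0.
by rewrite cmpDm cmpZm G1 G2 cmpmD cmpmZ.
Qed.

Section LiftPair.
Variables (M N M' N' : C) (i : chom M' M) (j : chom N' N).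
Hypotheses (injFi : Finj i) (injFj : Finj j).

Lemma Finj_killed (W : C) (a : chom W (sh N')) :
  killed (sh T) (fmap sh j \oc a) -> killed (sh T) a.
Proof.
move=> K t; have [s sE] := sh_full (a \oc t); rewrite sE (_ : s = 0) ?fmap0 //.
by apply: injFj; apply: sh_eq0; rewrite fmapM -sE cmpA K.
Qed.

(** The data in the two conditions of [gluing] can be made compatible: their
    discrepancy on M' is killed by Sigma T, hence extends to M. *)
Lemma gluing_extend e : e \in gluing i j -> exists a c,
  [/\ killed (sh T) c, killed T (a \oc i), c \oc i = 0 & e = fmap sh j \oc a + c].
Proof.
case/mem_gluing => [[a [c [Kc eE]]] [s [Ks es]]].
have ciE : c \oc i = fmap sh j \oc (s - a \oc i).
  by rewrite cmpmB -es eE cmpDm cmpA addrAC subrr add0r.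
have [|b Kb bE] := extend_Finj (c := s - a \oc i) injFi.
  by apply: Finj_killed; rewrite -ciE; apply: killed_pre.
exists (a + b), (c - fmap sh j \oc b); split.
- by apply/killedD/killedN/killed_post.
- by rewrite cmpDm -bE addrC subrK.
- by rewrite cmpBm ciE -cmpA -bE subrr.
- by rewrite cmpmD addrACA subrr addr0 eE.
Qed.

(** For the suspensions of a and b, seen as maps from M, the equations of the
    kernel of alpha are those of [gluing_extend]. *)
Lemma shift_p_ker_gluing : shift_p_ker T i j = gluing i j.
Proof.
pose P (e : chom M (sh N)) :=
  exists2 ab, ker_alpha T i j ab & e = fmap sh ab.2 \oc shK M.
have PE e : P e <-> e \in gluing i j.
  have transp (X Y : C) (a : chom (sh' X) Y) (R : C) :
      killed R (fmap sh a \oc shK X) <-> killed R (fmap sh a).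
    split=> K; last exact: killed_pre.
    move=> t; have [s [_ Ks]] := shK_iso X.
    by rewrite -(cmp1m t) -Ks -cmpA cmpA K.
  have nat (Y : C) (a : chom (sh' M) Y) :
      fmap sh (a \oc fmap sh' i) \oc shK M' = fmap sh a \oc shK M \oc i.
    by rewrite fmapM -!cmpA -shK_nat.
  split.
    case=> -[a b] [/= K1 K2 K3 ->]; apply/mem_gluing; split.
      exists (fmap sh a \oc shK M), (- (fmap sh (j \oc a - b) \oc shK M)); split.
        by apply/killedN/transp/(killed_sh T _).1/(through_killed hT).
      by rewrite fmapB fmapM cmpBm opprB cmpA addrC subrK.
    exists (fmap sh (a \oc fmap sh' i) \oc shK M'); split.
      apply/transp/(killed_through hT)/sum_through_fmap.
      exact/(through_sum T _ (@tri_additive _ C)).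
    move/eqP: K2; rewrite subr_eq0 => /eqP K2.
    by rewrite -nat -K2 -cmpA fmapM !cmpA.
  case/gluing_extend => a [c [Kc Ka ci eE]].
  have [t [tK Kt]] := shK_iso M.
  have full (Y : C) (f : chom M (sh Y)) : exists f', f = fmap sh f' \oc shK M.
    by have [f' fE] := sh_full (f \oc t); exists f'; rewrite -fE -cmpA tK cmpm1.
  have [a' aE] := full _ a; have [b' bE] := full _ e.
  exists (a', b') => //; split => /=.
  - apply/(through_sum T _ (@tri_additive _ C))/sum_through_sh/(killed_through hT)/transp.
    by rewrite nat -aE.
  - apply: sh_faithful; apply: (iso_cancelr (shK_iso M')).
    rewrite fmap0 cmp0m -cmpA fmapB cmpBm fmapM -cmpA !nat -aE -bE eE.
    by rewrite cmpDm ci addr0 cmpA subrr.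
  - apply/(through_killed hT)/(killed_sh T _).2/transp.
    rewrite fmapB cmpBm fmapM -cmpA -aE -bE eE opprD addNKr.
    exact: killedN.
exact: vspan_eq.
Qed.

End LiftPair.

Lemma im_alpha'_gluing (M N M' N' : C) (i : chom M' M) (j : chom N' N) :
  im_alpha'_cap T i j = gluing j i.
Proof.
pose P (h : chom N (sh M)) := exists a b c,
  [/\ through (sh T) a, through (sh (sh T)) c & alpha' i j a b c = (0, h)].
have PE h : P h <-> h \in gluing j i.
  split.
    case=> a [b [c [/(through_killed hT) Ka /(through_killed_sh hT) Kc]]].
    rewrite /alpha' => -[E <-]; apply/mem_gluing; split.
      exists (- b), (- c); split; first exact: killedN.
      by rewrite cmpmN addrC.
    exists a; split=> //; move/eqP: E; rewrite -addrA addr_eq0 => /eqP ->.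
    by rewrite cmpBm cmpNm opprD.
  case/mem_gluing => [[b [c [Kc hE]]] [a [Ka aE]]].
  exists a, (- b), (- c); split.
  - exact/(through_killed hT).
  - exact/(through_killed_sh hT)/killedN.
  - congr (_, _); last by rewrite opprK cmpmN opprK addrC -hE.
    by rewrite -aE hE cmpmN !cmpDm !cmpNm addrK subrr.
exact: vspan_eq.
Qed.

(** A map e killed by R factors through Sigma R, and its pairing with h then
    depends only on the composites of h with maps from R. This is applied to
    R = T and to R = Sigma T. *)
Lemma killed_orthogonal (R X Y : C)
    (B : forall X Y : C, 'Hom(chom X (sh Y), 'Hom(chom Y (sh X), k^o))) :
    (forall (X Y : C) (f : chom X Y), killed R f <-> sum_through (sh R) f) ->
    (forall X Y, perfect (B X Y)) ->
    (forall X Y Y' (g : chom Y Y') (e : chom X (sh Y)) (h : chom Y' (sh X)),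
        B X Y' (fmap sh g \oc e) h = B X Y e (h \oc g)) ->
    (forall X X' Y (a : chom X' X) (e : chom X (sh Y)) (h : chom Y (sh X')),
        B X' Y (e \oc a) h = B X Y e (fmap sh a \oc h)) ->
  (forall e h, killed R e -> killed R h -> B X Y e h = 0) /\
  (forall h, (forall e, killed R e -> B X Y e h = 0) -> killed R h).
Proof.
move=> KR pB nat1 nat2; split=> [e h /KR[m [s [r ->]]] Kh|h Hh t].
  rewrite linear_sum sum_lfunE big1 // => a _.
  by have [s' ->] := sh_full (s a); rewrite nat1 Kh linear0.
apply: (perfect_nondeg (perfect_opp (pB X R))) => r.
rewrite opp_pairingE -nat1; apply/Hh/KR; rewrite -(cmpm1 (fmap sh t)).
by apply: sum_through_comp; exists 1%N, (fun _ => idm _), (fun _ => idm _);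
  rewrite big_ord1 cmp1m.
Qed.

(** [gluing j i] is the orthogonal of [gluing i j]. That they are orthogonal
    follows from [gluing_extend] on both sides. Conversely, [gluing j i] contains
    the h killed by Sigma T with h j = 0 and the Sigma i b such that b j is killed
    by T; orthogonality to the former gives the first condition in [gluing i j],
    and orthogonality to the latter the second. *)
Lemma dim_gluing (M N M' N' : C) (i : chom M' M) (j : chom N' N) :
  Finj i -> Finj j ->
  (\dim (gluing i j) + \dim (gluing j i))%N = \dim {:chom M (sh N)}.
Proof.
move=> injFi injFj; have [B [pB nat1 nat2]] := cy_pairing hCY.
have orthT X Y :=
  @killed_orthogonal T X Y B (fun _ _ f => killed_through hT f) pB nat1 nat2.
have orthST X Y :=
  @killed_orthogonal (sh T) X Y B (fun _ _ f => killed_sh_through hT f) pB nat1 nat2.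
apply: (dim_orthogonal (pB M N)) => e; split.
  case/(gluing_extend injFi injFj) => a [c [Kc Ka ci ->]] h.
  case/(gluing_extend injFj injFi) => a' [c' [Kc' Ka' ci' ->]].
  rewrite [B M N _]linearD add_lfunE /= nat1 [_ \oc j]cmpDm ci' addr0 -cmpA.
  rewrite -nat2 ((orthT _ _).1 _ _ Ka) // add0r linearD /=.
  by rewrite -nat2 ci linear0 zero_lfunE add0r ((orthST _ _).1 _ _ Kc).
move=> He; apply/mem_gluing; split.
  pose U := (limg (lpost M (fmap sh j)) + killedvs (sh T) M (sh N))%VS.
  suff /memv_addP[_ /memv_imgP[a _ ->] [c /mem_killed Kc ->]] : e \in U.
    by exists a, c; rewrite lpostE.
  apply: (perp_perp (pB M N)) => h Hh; apply: He; apply/mem_gluing.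
  have hj : h \oc j = 0.
    apply: (perfect_nondeg (perfect_opp (pB M N'))) => a.
    rewrite opp_pairingE -nat1 -lpostE; apply: Hh.
    by apply: (subvP (addvSl _ _)); rewrite memv_img ?memvf.
  split; last by exists 0; rewrite hj cmpm0; split=> // t; rewrite cmp0m.
  exists 0, h; rewrite cmpm0 add0r; split=> //; apply: (orthST M N).2 => c /mem_killed Kc.
  exact/Hh/(subvP (addvSr _ _)).
pose V := (lpost M' (fmap sh j) @: killedvs T M' (sh N'))%VS.
suff /memv_imgP[s /mem_killed Ks ->] : e \oc i \in V by exists s; rewrite lpostE.
apply: (perp_perp (pB M' N)) => b Hb; rewrite nat2; apply: He; apply/mem_gluing.
have Kbj : killed T (b \oc j).
  apply: (orthT M' N').2 => s /mem_killed Ks.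
  by rewrite -nat1 -lpostE Hb // memv_img.
split; last by exists (b \oc j); rewrite cmpA.
by exists b, 0; rewrite addr0; split=> // t; rewrite cmp0m.
Qed.

End Gluing.

(** * The coindex *)

Section Coindex.
Variables (k : finFieldType) (C : triCat k) (hCY : two_CY C).
Variables (T : C) (hT : cluster_tilting T).
Implicit Types X Y Z : C.

(** The pairing of the coindex of X with the class of FY, see
    [coind_hom_triangle]. This form makes sense without choosing a
    triangle. *)
Definition coind_hom (Y X : C) : int :=
  (\dim (rhom (F T Y) (F T X)))%:Z - (\dim (killedvs (sh T) Y (sh X)))%:Z.

Lemma lker_limg_dim (U V : vectType k) (f : 'Hom(U, V)) :
  (\dim (lker f) + \dim (limg f))%N = \dim {:U}.
Proof. by rewrite -(limg_ker_dim f fullv) capfv. Qed.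

Lemma mem_limg_lpost (W X Y : C) (g : chom X Y) (u : chom W Y) :
  u \in limg (lpost W g) <-> exists v, u = g \oc v.
Proof.
split=> [/memv_imgP[v _ ->]|[v ->]]; first by exists v; rewrite lpostE.
by rewrite -lpostE memv_img ?memvf.
Qed.

Lemma mem_lker_lpost (W X Y : C) (g : chom X Y) (u : chom W X) :
  u \in lker (lpost W g) <-> g \oc u = 0.
Proof. by rewrite memv_ker lpostE; split=> [/eqP|->]. Qed.

Lemma vspace_iff (V : vectType k) (A B : {vspace V}) :
  (forall x, x \in A <-> x \in B) -> A = B.
Proof. by move=> AB; apply/vspaceP => x; apply/idP/idP => /AB. Qed.

Lemma rigid_sh X (t : chom (sh T) (sh (sh X))) : in_add T X -> t = 0.
Proof. by move=> aX; have [s ->] := sh_full t; rewrite (add_rigid hT s aX) fmap0. Qed.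

(** In the long exact sequence of Hom(Y, -) on the triangle, the maps Y -> X from
    Sigma T4 are those killed by T, and the maps Y -> Sigma X from Sigma^2 T4
    are those killed by Sigma T. Duality turns Hom(Y, Sigma^2 T3) into the dual
    of Hom(T3, Y). *)
Lemma coind_hom_triangle (X T3 T4 : C) (f : chom (sh T4) X)
    (g : chom X (sh (sh T3))) (h : chom (sh (sh T3)) (sh (sh T4))) Y :
  in_add T T3 -> in_add T T4 -> dist f g h ->
  (\dim {:chom T3 Y})%:Z - (\dim {:chom T4 Y})%:Z = coind_hom Y X.
Proof.
move=> a3 a4 D.
have E1 : lker (lpost Y g) = killedvs T Y X.
  apply: vspace_iff => u; split=> [/mem_lker_lpost gu|/mem_killed/(killed_through hT)].
    have [v ->] := dist_lift D gu; apply/mem_killed => t.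
    by rewrite -cmpA (add_rigid hT (v \oc t) a4) cmpm0.
  case=> m [s [r ->]]; apply/mem_lker_lpost; rewrite cmp_sumr big1 // => a _.
  by rewrite cmpA (rigid_sh (g \oc s a) a3) cmp0m.
have E2 : lker (lpost Y h) = limg (lpost Y g).
  apply: vspace_iff => u; split=> [/mem_lker_lpost/(dist_lift' D)|].
    by case=> v ->; apply/mem_limg_lpost; exists v.
  case/mem_limg_lpost=> v ->; apply/mem_lker_lpost.
  by rewrite cmpA (dist_comp0' D) cmp0m.
have E3 : lker (lpost Y (fmap sh f)) = limg (lpost Y h).
  apply: vspace_iff => u; split=> [/mem_lker_lpost/(dist_lift'' D)|].
    by case=> v ->; apply/mem_limg_lpost; exists v.
  case/mem_limg_lpost=> v ->; apply/mem_lker_lpost.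
  by rewrite cmpA (dist_comp0'' D) cmp0m.
have E4 : limg (lpost Y (fmap sh f)) = killedvs (sh T) Y (sh X).
  apply: vspace_iff => u; split=> [/mem_limg_lpost[v ->]|].
    by apply/mem_killed => t; rewrite -cmpA (rigid_sh (v \oc t) a4) cmpm0.
  case/mem_killed/(killed_sh_through hT) => m [s [r ->]]; apply/mem_limg_lpost.
  apply: dist_sh_lift D _; rewrite cmp_sumr big1 // => a _.
  have [s' ->] := sh_full (s a).
  by rewrite cmpA -fmapM (rigid_sh (g \oc s') a3) fmap0 cmp0m.
have d1 := lker_limg_dim (lpost Y g); have d2 := lker_limg_dim (lpost Y h).
have d3 := lker_limg_dim (lpost Y (fmap sh f)).
rewrite E1 in d1; rewrite E2 in d2; rewrite E3 E4 in d3.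
have d4 := dim_rhomF hT Y X.
rewrite /coind_hom (dim_serre hCY T3) (dim_serre hCY T4); lia.
Qed.

(** On a triangle with F i injective the long exact sequence of Hom(Y, -)
    breaks up into a six-term exact sequence from Hom_B(FY, FN) to the maps
    Y -> Sigma M killed by Sigma T. *)
Lemma coind_hom_add (N L M : C) (i : chom N L) (p : chom L M) (e : chom M (sh N)) Y :
  dist i p e -> Finj T i -> coind_hom Y L = coind_hom Y N + coind_hom Y M.
Proof.
move=> D injF.
have Ke : killed (sh T) e.
  move=> t; have [s sE] := sh_full (e \oc t); rewrite sE (_ : s = 0) ?fmap0 //.
  by apply: injF; apply: sh_eq0; rewrite fmapM -sE cmpA (dist_comp0'' D) cmp0m.
have Ki u : killed T (i \oc u) -> killed T u.
  by move=> Ku t; apply: injF; rewrite cmpA Ku.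
(* ranks of Hom(Y, L) -> Hom(Y, M) -> Hom(Y, Sigma N) *)
have d1 := lker_limg_dim (lpost Y e).
have E1 : lker (lpost Y e) = limg (lpost Y p).
  apply: vspace_iff => u; split=> [/mem_lker_lpost/(dist_lift' D)|].
    by case=> v ->; apply/mem_limg_lpost; exists v.
  case/mem_limg_lpost=> v ->; apply/mem_lker_lpost.
  by rewrite cmpA (dist_comp0' D) cmp0m.
have E2 : (killedvs (sh T) Y (sh N) :&: lker (lpost Y (fmap sh i)))%VS = limg (lpost Y e).
  apply: vspace_iff => u; rewrite memv_cap; split.
    case/andP=> _ /mem_lker_lpost/(dist_lift'' D)[v ->].
    by apply/mem_limg_lpost; exists v.
  case/mem_limg_lpost=> v ->; apply/andP; split.
    exact/mem_killed/killed_pre.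
  by apply/mem_lker_lpost; rewrite cmpA (dist_comp0'' D) cmp0m.
have d2 := limg_ker_dim (lpost Y (fmap sh i)) (killedvs (sh T) Y (sh N)).
have E3 : (lpost Y (fmap sh i) @: killedvs (sh T) Y (sh N) =
    killedvs (sh T) Y (sh L) :&: lker (lpost Y (fmap sh p)))%VS.
  apply: vspace_iff => u; rewrite memv_cap; split.
    case/memv_imgP=> v /mem_killed Kv ->; rewrite lpostE; apply/andP; split.
      exact/mem_killed/killed_post.
    apply/mem_lker_lpost; rewrite cmpA -fmapM (dist_comp0 D) fmap0 cmp0m //.
  case/andP=> /mem_killed Ku /mem_lker_lpost/(dist_sh_lift D)[v uv].
  apply/memv_imgP; exists v; last by rewrite lpostE.
  by apply/mem_killed/(Finj_killed injF); rewrite -uv.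
have d3 := limg_ker_dim (lpost Y (fmap sh p)) (killedvs (sh T) Y (sh L)).
have E4 : (lpost Y (fmap sh p) @: killedvs (sh T) Y (sh L) = killedvs (sh T) Y (sh M))%VS.
  apply: vspace_iff => u; split.
    by case/memv_imgP=> v /mem_killed Kv ->; rewrite lpostE; exact/mem_killed/killed_post.
  case/mem_killed/(killed_sh_through hT) => m [s [r ->]].
  have /choice[s' sE] : forall a, exists s' : chom (sh (sh T)) (sh L), s a = fmap sh p \oc s'.
    move=> a; have [x xE] := sh_full (s a).
    have [|y yE] := dist_lift' (u := x) D; first exact: Ke.
    by rewrite xE yE; exists (fmap sh y); rewrite fmapM.
  apply/memv_imgP; exists (\sum_a s' a \oc r a).
    by apply/mem_killed/(killed_sh_through hT); exists m, s', r.
  by rewrite lpostE cmp_sumr; apply: eq_bigr => a _; rewrite sE cmpA.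
(* the part of Hom(Y, L) that becomes trivial in Hom_B(FY, FM) *)
pose P := (limg (lpost Y i) + killedvs T Y L)%VS.
have d4 := lker_limg_dim (lpost Y p).
have d5 := limg_ker_dim (lpost Y p) P.
have E5 : (P :&: lker (lpost Y p) = lker (lpost Y p))%VS.
  apply/capv_idPr/subvP => u /mem_lker_lpost/(dist_lift D)[v ->].
  by apply: (subvP (addvSl _ _)); apply/mem_limg_lpost; exists v.
have E6 : (lpost Y p @: P = killedvs T Y M)%VS.
  apply: vspace_iff => u; split.
    case/memv_imgP=> _ /memv_addP[_ /mem_limg_lpost[v ->] [w /mem_killed Kw ->]] ->.
    rewrite lpostE cmpmD cmpA (dist_comp0 D) cmp0m add0r.
    exact/mem_killed/killed_post.
  case/mem_killed/(killed_through hT) => m [s [r ->]].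
  have /choice[s' sE] : forall a, exists s' : chom (sh T) L, s a = p \oc s'.
    by move=> a; apply: dist_lift' D _; apply: Ke.
  apply/memv_imgP; exists (\sum_a s' a \oc r a).
    apply: (subvP (addvSr _ _)).
    by apply/mem_killed/(killed_through hT); exists m, s', r.
  by rewrite lpostE cmp_sumr; apply: eq_bigr => a _; rewrite sE cmpA.
have d6 := dimv_sum_cap (limg (lpost Y i)) (killedvs T Y L).
have E7 : (limg (lpost Y i) :&: killedvs T Y L = lpost Y i @: killedvs T Y N)%VS.
  apply: vspace_iff => u; rewrite memv_cap; split.
    case/andP=> /mem_limg_lpost[v ->] /mem_killed/Ki Kv.
    by rewrite -lpostE memv_img //; apply/mem_killed.
  case/memv_imgP=> v /mem_killed Kv ->; rewrite memv_img ?memvf //= lpostE.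
  exact/mem_killed/killed_post.
have d7 := limg_ker_dim (lpost Y i) (killedvs T Y N).
have E8 : (killedvs T Y N :&: lker (lpost Y i) = lker (lpost Y i))%VS.
  apply/capv_idPr/subvP => u /mem_lker_lpost iu; apply/mem_killed/Ki.
  by rewrite iu => t; rewrite cmp0m.
have d8 := lker_limg_dim (lpost Y i).
rewrite E1 in d1; rewrite E2 E3 in d2; rewrite E4 in d3; rewrite E5 E6 in d5.
rewrite E7 -/P in d6; rewrite E8 in d7.
have hN := dim_rhomF hT Y N; have hL := dim_rhomF hT Y L; have hM := dim_rhomF hT Y M.
rewrite /coind_hom; lia.
Qed.

Lemma coind_hom_zero Y Z : is_zero Z -> coind_hom Y Z = 0.
Proof.
move=> Z0; have hom0 X : is_zero X -> \dim {:chom Y X} = 0%N.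
  move=> X0; apply/eqP; rewrite dimv_eq0; apply/eqP/vspaceP => u.
  by rewrite (zero_to u X0) !mem0v.
have d1 := dim_rhomF hT Y Z; rewrite hom0 // in d1.
have := dimvS (subvf (killedvs (sh T) Y (sh Z))); rewrite hom0; last exact: fmap_zero.
rewrite /coind_hom; lia.
Qed.

Lemma coind_hom_iso X X' Y (s : chom X X') : is_iso s -> coind_hom Y X' = coind_hom Y X.
Proof.
move=> sI; have [Z Z0] := zero_ob C.
have D : dist s (0 : chom X' Z) (0 : chom Z (sh X)).
  apply: (dist_iso (is_iso_id X) sI (is_iso_id Z)) (dist_id X Z0); first by [].
    by rewrite !cmp0m cmpm0.
  by rewrite cmpm0 cmp0m.
rewrite (coind_hom_add Y D) ?(coind_hom_zero Y Z0) ?addr0 // => t st.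
by apply: (iso_cancell sI); rewrite st cmpm0.
Qed.

(** The suspension of an approximation of Sigma^-1 X is a coindex triangle of X. *)
Lemma coind_hom_formula X : exists T3 T4 : C, [/\ in_add T T3, in_add T T4 &
  forall Y, coind_hom Y X = (\dim {:chom T3 Y})%:Z - (\dim {:chom T4 Y})%:Z].
Proof.
have [T1 [T0 [mu [pi [kappa [a1 a0 D]]]]]] := approximation hT (sh' X).
exists T1, T0; split=> // Y.
have D' := (dist_rot _ _ _).1 ((dist_rot _ _ _).1 ((dist_rot _ _ _).1 ((dist_rot _ _ _).1 D))).
by rewrite -(coind_hom_iso _ (shK_iso X)) (coind_hom_triangle Y a1 a0 D').
Qed.

End Coindex.

Section Defect.
Variables (k : finFieldType) (C : triCat k) (hCY : two_CY C).
Variables (T : C) (hT : cluster_tilting T).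
Implicit Types X Y Z : C.

(** The index of X is minus the coindex of Sigma X, so this says that coindex
    minus index is the antisymmetrized Euler form. The Ext^1 terms come from
    the two ideals in Hom(Y, Sigma X): the orthogonal of their sum is the
    intersection of the corresponding ideals in Hom(X, Sigma Y). *)
Lemma coind_hom_suspension Y X :
  coind_hom T Y X + coind_hom T Y (sh X) = euler_a (F T Y) (F T X).
Proof.
have [B [pB nat1 nat2]] := cy_pairing hCY.
pose A := killedvs T Y (sh X); pose D := killedvs (sh T) Y (sh X).
pose A' := killedvs T X (sh Y); pose D' := killedvs (sh T) X (sh Y).
have d1 : (\dim (A' :&: D') + \dim (A + D))%N = \dim {:chom X (sh Y)}.
  apply: (dim_orthogonal (perfect_opp (pB Y X))) => h.
  have [o1 o2] := @killed_orthogonal _ _ T Y X B (fun _ _ f => killed_through hT f) pB nat1 nat2.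
  have [o3 o4] := @killed_orthogonal _ _ (sh T) Y X B
    (fun _ _ f => killed_sh_through hT f) pB nat1 nat2.
  rewrite memv_cap; split.
    case/andP=> /mem_killed Ah /mem_killed Dh _ /memv_addP[a /mem_killed Ka [d /mem_killed Kd ->]].
    by rewrite linearD /= !opp_pairingE o1 // o3 // addr0.
  move=> Hh; apply/andP; split; apply/mem_killed; [apply: o2|apply: o4] => e /mem_killed Ke.
    by rewrite -(opp_pairingE (B Y X)) Hh // (subvP (addvSl _ _)).
  by rewrite -(opp_pairingE (B Y X)) Hh // (subvP (addvSr _ _)).
have d2 := perfect_dim (pB Y X).
have d3 := dimv_sum_cap A D.
have d4 := dim_killed_serre hCY hT X Y.
have d5 := dim_rhomF hT X Y; have d6 := dim_rhomF hT Y (sh X).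
rewrite /coind_hom /euler_a /euler !(dim_ext1F hT) -/A -/D -/A' -/D'.
rewrite -/A in d6; lia.
Qed.

Lemma F_factor (X Y Z : C) (f : chom X Y) (b : chom Z Y) :
  Finj T b -> (forall x : chom T X, exists z, f \oc x = b \oc z) ->
  exists a : chom X Z, killed T (f - b \oc a).
Proof.
move=> injb fb.
have kb : lker (Fmap T b) == 0%VS.
  rewrite -subv0; apply/subvP => z; rewrite memv_ker FmapE => /eqP/injb ->.
  exact: mem0v.
pose g := ((Fmap T b)^-1 \o Fmap T f)%VF.
have gE (x : chom T X) : b \oc g x = f \oc x.
  rewrite comp_lfunE FmapE -FmapE; have [z ->] := fb x.
  by rewrite -(FmapE b z) lker0_lfunK.
have [|a aE] := F_full hT (g := g).
  apply/mem_rhom => x c; apply/eqP; rewrite -subr_eq0; apply/eqP/injb.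
  by rewrite cmpmB /= /F_act cmpA !gE cmpA subrr.
by exists a => t; rewrite cmpBm -cmpA -aE gE subrr.
Qed.

Definition Fexact (X Y Z : C) (f : chom X Y) (g : chom Y Z) : Prop :=
  [/\ Finj T f, forall t : chom T Y, g \oc t = 0 <-> exists s, t = f \oc s &
      forall t : chom T Z, exists s, t = g \oc s].

Lemma hom_add_Fexact (P X Y Z : C) (f : chom X Y) (g : chom Y Z) :
  in_add T P -> Fexact f g ->
  \dim {:chom P Y} = (\dim {:chom P X} + \dim {:chom P Z})%N.
Proof.
move=> /in_add_sum[m [u [w uw]]] [injf gf surg].
have E1 : lker (lpost P f) = 0%VS.
  apply/eqP; rewrite -subv0; apply/subvP => x /mem_lker_lpost fx.
  rewrite memv0 -(cmpm1 x) uw cmp_sumr big1 // => a _.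
  by rewrite cmpA (injf (x \oc u a)) ?cmp0m // cmpA fx cmp0m.
have E2 : lker (lpost P g) = limg (lpost P f).
  apply: vspace_iff => y; split=> [/mem_lker_lpost gy|/mem_limg_lpost[x ->]].
    have /choice[s sE] : forall a, exists s, y \oc u a = f \oc s.
      by move=> a; apply/gf; rewrite cmpA gy cmp0m.
    apply/mem_limg_lpost; exists (\sum_a s a \oc w a).
    rewrite -{1}(cmpm1 y) uw !cmp_sumr; apply: eq_bigr => a _.
    by rewrite !cmpA sE.
  apply/mem_lker_lpost; rewrite -(cmpm1 x) uw !cmp_sumr big1 // => a _.
  rewrite (cmpA x) (cmpA f) (cmpA g) (_ : g \oc (f \oc _) = 0) ?cmp0m //.
  by apply/gf; exists (x \oc u a).
have E3 : limg (lpost P g) = fullv.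
  apply: vspace_iff => z; rewrite memvf; split=> // _.
  have /choice[s sE] : forall a, exists s, z \oc u a = g \oc s by move=> a; apply: surg.
  apply/mem_limg_lpost; exists (\sum_a s a \oc w a).
  rewrite -{1}(cmpm1 z) uw !cmp_sumr; apply: eq_bigr => a _.
  by rewrite !cmpA sE.
have d1 := lker_limg_dim (lpost P f); have d2 := lker_limg_dim (lpost P g).
rewrite E1 dimv0 in d1; rewrite E2 E3 in d2; lia.
Qed.

(** The coindex and index of X are computed by functors Hom(T', -) with T' in
    add T, which are exact on modules; so the antisymmetrized Euler form is
    additive, although neither Hom nor Ext^1 is exact. *)
Lemma euler_a_addl (X Y1 Y2 Y3 : C) (f : chom Y1 Y2) (g : chom Y2 Y3) :
  Fexact f g ->
  euler_a (F T Y2) (F T X) = euler_a (F T Y1) (F T X) + euler_a (F T Y3) (F T X).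
Proof.
move=> fg; rewrite -!coind_hom_suspension.
have [P [P' [aP aP' cP]]] := coind_hom_formula hCY hT X.
have [Q [Q' [aQ aQ' cQ]]] := coind_hom_formula hCY hT (sh X).
rewrite !cP !cQ (hom_add_Fexact aP fg) (hom_add_Fexact aP' fg).
rewrite (hom_add_Fexact aQ fg) (hom_add_Fexact aQ' fg); lia.
Qed.

Lemma euler_aC (X Y : rmod T) : euler_a X Y = - euler_a Y X.
Proof. by rewrite /euler_a [RHS]opprB. Qed.

Lemma euler_a_addr (X Y1 Y2 Y3 : C) (f : chom Y1 Y2) (g : chom Y2 Y3) :
  Fexact f g ->
  euler_a (F T X) (F T Y2) = euler_a (F T X) (F T Y1) + euler_a (F T X) (F T Y3).
Proof.
by move=> fg; rewrite !(euler_aC (F T X)) (euler_a_addl X fg) opprD.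
Qed.

Variable lft : forall (M : C) (M0 : subm (F T M)), lifting M0.

Lemma lft_inj (M : C) (M0 : subm (F T M)) : Finj T (lmor (lft M0)).
Proof.
move=> t t0; apply: (lmor_inj (l := lft M0)); by rewrite linear0 FmapE t0.
Qed.

Lemma lft_img (M : C) (M0 : subm (F T M)) (x : chom T M) :
  x \in val M0 <-> exists t, x = lmor (lft M0) \oc t.
Proof.
rewrite -(lmor_img (lft M0)); split=> [/memv_imgP[t _ ->]|[t ->]].
  by exists t; rewrite FmapE.
by rewrite -FmapE memv_img ?memvf.
Qed.

Lemma Fimg_subm (X Y : C) (f : chom X Y) : is_subm (X := F T Y) (limg (lpost T f)).
Proof.
move=> _ b /mem_limg_lpost[t ->]; apply/mem_limg_lpost.
by exists (t \oc b); rewrite /= /F_act cmpA.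
Qed.

(** The lift of the image gives a factorization only modulo the kernel of F. It is
    made exact by adding to K copies of Sigma T, which F does not see. *)
Lemma image_factorization (M N : C) (b : chom M N) :
  exists (K : C) (a : chom M K) (j : chom K N),
    [/\ b = j \oc a, Finj T j & forall t : chom T K, exists s, t = a \oc s].
Proof.
pose K0 := mksubm (@Fimg_subm _ _ b).
pose b0 := lmor (lft K0); have injb0 : Finj T b0 := @lft_inj _ K0.
have [|a0 /(killed_through hT)[m [u [w d]]]] := F_factor injb0 (f := b).
  by move=> x; apply/(lft_img K0)/mem_limg_lpost; exists x.
pose X_ (o : option 'I_m) := if o is Some _ then sh T else lob (lft K0).
have [K [inj [prj [pi0 pi1 sum1]]]] := @tri_additive _ C _ X_.
have ext W (x y : chom W K) : (forall o, prj o \oc x = prj o \oc y) -> x = y.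
  move=> xy; rewrite -(cmp1m x) -(cmp1m y) -sum1 !cmp_suml.
  by apply: eq_bigr => o _; rewrite -!cmpA xy.
pose p0 : chom K (lob (lft K0)) := prj None; pose q0 : chom (lob (lft K0)) K := inj None.
pose p1 c : chom K (sh T) := prj (Some c); pose q1 c : chom (sh T) K := inj (Some c).
have p0q0 : p0 \oc q0 = idm _ := pi0 None.
have p1q1 c : p1 c \oc q1 c = idm _ := pi0 (Some c).
have p0q1 c : p0 \oc q1 c = 0 by exact: (pi1 (Some c) None).
have p1q0 c : p1 c \oc q0 = 0 by exact: (pi1 None (Some c)).
have p1q1' c c' : c' != c -> p1 c \oc q1 c' = 0.
  by move=> cc'; apply: (pi1 (Some c') (Some c)).
pose a := q0 \oc a0 + \sum_c q1 c \oc w c.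
pose j := b0 \oc p0 + \sum_c u c \oc p1 c.
have p0a : p0 \oc a = a0.
  rewrite cmpmD cmpA p0q0 cmp1m cmp_sumr big1 ?addr0 // => c _.
  by rewrite cmpA p0q1 cmp0m.
have p1a c : p1 c \oc a = w c.
  rewrite cmpmD cmpA p1q0 cmp0m add0r cmp_sumr (bigD1 c) //= cmpA p1q1 cmp1m.
  by rewrite big1 ?addr0 // => c' cc'; rewrite cmpA p1q1' // cmp0m.
have TT (t : chom T (sh T)) : t = 0 := add_rigid hT t (in_add_T T).
have p1T c (t : chom T K) : p1 c \oc t = 0 by exact: TT.
have jT (t : chom T K) : j \oc t = b0 \oc (p0 \oc t).
  rewrite cmpDm cmp_suml big1 ?addr0 ?cmpA // => c _.
  by rewrite -cmpA p1T cmpm0.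
exists K, a, j; split.
- rewrite cmpDm -cmpA p0a cmp_suml (eq_bigr (fun c => u c \oc w c)).
    by rewrite -d addrC subrK.
  by move=> c _; rewrite -cmpA p1a.
- move=> t; rewrite jT => /injb0 p0t; apply: ext => -[c|]; rewrite cmpm0.
    exact: p1T.
  exact: p0t.
- move=> t; have /(lft_img K0)/mem_limg_lpost[s sE] : exists z, b0 \oc (p0 \oc t) = b0 \oc z.
    by exists (p0 \oc t).
  exists s; apply: ext => -[c|].
    by rewrite [LHS]p1T cmpA [prj _ \oc a]p1a [RHS]TT.
  rewrite cmpA [prj _ \oc a]p0a; apply/eqP; rewrite -subr_eq0; apply/eqP/injb0.
  rewrite cmpmB sE -[b](subrK (b0 \oc a0)) cmpDm -(cmpA b0) d.
  rewrite addrK cmp_suml big1 // => c _.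
  by rewrite -cmpA (TT (w c \oc s)) cmpm0.
Qed.

(** Palu's formula: the coindex is additive on a triangle up to the Euler form
    of the kernel of FN -> FL. The octahedron on Sigma^-1 M -> K -> N relates
    the triangle to three others on which the coindex is additive. *)
Lemma coind_hom_defect (N L M : C) (i : chom N L) (p : chom L M) (e : chom M (sh N)) :
  dist i p e -> exists (K : C) (j : chom K N),
    [/\ Finj T j, forall t : chom T N, i \oc t = 0 <-> exists s, t = j \oc s &
      forall Y, coind_hom T Y N + coind_hom T Y M - coind_hom T Y L
                = euler_a (F T Y) (F T K)].
Proof.
move=> D; pose s := shK M; have [t [ts st]] := shK_iso M.
have [b0 b0E] := sh_full (e \oc t).
have [K [a [j [ja injj sura]]]] := image_factorization (- b0).
have Db : dist (j \oc a) i (s \oc p).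
  rewrite -ja; apply/dist_rot; rewrite fmapN opprK -b0E.
  apply: (dist_iso (is_iso_id _) (is_iso_id _) (shK_iso M)) D.
  - by rewrite cmp1m cmpm1.
  - by rewrite cmpm1.
  - by rewrite fmap1 cmp1m -cmpA ts cmpm1.
have [Q [f' [f'' Da]]] := dist_cone a.
have [R [g' [g'' Dj]]] := dist_cone j.
have [u [w [Duw uf hu wh gw]]] := dist_oct Da Dj Db.
have f'T (x : chom T K) : f' \oc x = 0.
  by have [y ->] := sura x; rewrite cmpA (dist_comp0 Da) cmp0m.
exists K, j; split=> //.
- move=> x; split=> [/(dist_lift Db)[y ->]|[y ->]].
    by exists (a \oc y); rewrite cmpA.
  have [z ->] := sura y.
  by rewrite !cmpA -(cmpA i) (dist_comp0 Db) cmp0m.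
have inju : Finj T u.
  move=> x ux; have [|y yE] := dist_lift'' (u := fmap sh x) Duw.
    by rewrite -fmapM ux fmap0.
  have [z zE] := sh_full (g'' \oc y).
  by apply: sh_eq0; rewrite yE -cmpA zE -fmapM f'T fmap0.
have injf'' : Finj T f''.
  by move=> x /(dist_lift' Da)[y ->].
have Dr := (dist_rot _ _ _).1 ((dist_rot _ _ _).1 Da).
move=> Y; rewrite -coind_hom_suspension.
rewrite (coind_hom_add hT Y Dj injj) (coind_hom_add hT Y Duw inju).
rewrite -(coind_hom_iso hT Y (shK_iso M)) (coind_hom_add hT Y Dr injf''); ring.
Qed.

End Defect.

(** * Simple modules and dimension vectors *)

Section Quotients.
Variables (k : finFieldType) (C : triCat k) (T : C) (hT : cluster_tilting T).
Variable lft : forall (M : C) (M0 : subm (F T M)), lifting M0.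
Implicit Types X Y Z : C.

(** Quotients of FX lift to objects because submodules do: the quotient by U is
    the image of FX in F(cone), which is a submodule. *)
Lemma quotient_object X (U : subm (F T X)) : exists (Z : C) (g : chom X Z),
  (forall x : chom T X, g \oc x = 0 <-> x \in val U) /\
  (forall z : chom T Z, exists x, z = g \oc x).
Proof.
have [Q [c [h D]]] := dist_cone (lmor (lft U)).
pose V := mksubm (@Fimg_subm _ _ T _ _ c).
have injV : Finj T (lmor (lft V)) := @lft_inj _ _ _ lft _ V.
have [|g gE] := F_factor hT injV (f := c).
  by move=> x; apply/(lft_img lft V)/mem_limg_lpost; exists x.
have lg (x : chom T X) : lmor (lft V) \oc (g \oc x) = c \oc x.
  by apply/eqP; rewrite eq_sym -subr_eq0 cmpA -cmpBm gE.
exists (lob (lft V)), g; split=> [x|z].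
  apply: iff_trans (iff_sym (lft_img lft U x)); split=> [gx|[t ->]].
    by apply: dist_lift D _; rewrite -lg gx cmpm0.
  by apply: injV; rewrite lg cmpA (dist_comp0 D) cmp0m.
have /(lft_img lft V)/mem_limg_lpost[x xE] : exists y, lmor (lft V) \oc z = lmor (lft V) \oc y.
  by exists z.
exists x; apply/eqP; rewrite -subr_eq0; apply/eqP/injV.
by rewrite cmpmB lg xE subrr.
Qed.

Lemma sub_quotient_Fexact X Z (U : subm (F T X)) (g : chom X Z) :
  (forall x : chom T X, g \oc x = 0 <-> x \in val U) ->
  (forall z : chom T Z, exists x, z = g \oc x) -> Fexact T (lmor (lft U)) g.
Proof.
move=> kg sg; split=> //; first exact: lft_inj.
by move=> t; apply: iff_trans (kg t) (lft_img lft U t).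
Qed.

Lemma F_cofactor X Y Z (p : chom X Z) (y : chom X Y) :
  (forall z : chom T Z, exists x, z = p \oc x) ->
  (forall x : chom T X, p \oc x = 0 -> y \oc x = 0) ->
  exists g : chom Z Y, killed T (y - g \oc p).
Proof.
move=> sp py; pose h := (Fmap T y \o (Fmap T p)^-1)%VF.
have hE (x : chom T X) : h (p \oc x : chom T Z) = y \oc x.
  apply/eqP; rewrite -subr_eq0 comp_lfunE FmapE -cmpmB py //.
  rewrite cmpmB; apply/eqP; rewrite subr_eq0 -!(FmapE p); apply/eqP.
  by rewrite limg_lfunVK // memv_img ?memvf.
have [|g gE] := F_full hT (g := h).
  apply/mem_rhom => z b; have [x ->] := sp z.
  by rewrite /= /F_act -!cmpA !hE cmpA -hE.
by exists g => t; rewrite cmpBm -cmpA -gE hE subrr.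
Qed.

Lemma quo_mod_iso (X Y : rmod T) (U : subm X) (f : 'Hom(X, Y)) :
  f \in rhom X Y -> (forall x, f x = 0 <-> x \in val U) ->
  (forall y, exists x, y = f x) -> miso (quo_mod U) Y.
Proof.
move=> /mem_rhom Hf kf sf.
have fq x : f (quo_proj U x) = f x.
  apply/eqP; rewrite eq_sym -subr_eq0 -linearB; apply/eqP/kf; exact: quo_projB.
pose h : 'Hom(quo_mod U, Y) := (f \o linfun vsval)%VF.
have hE x : h x = f (vsval x) by rewrite comp_lfunE lfunE.
apply: (miso_bij (f := h)).
- by apply/mem_rhom => x b; rewrite !hE quo_actE fq Hf.
- apply/lker0P; rewrite -subv0; apply/subvP => x; rewrite memv_ker hE => /eqP/kf xU.
  rewrite memv0 -val_eqE /= -memv0 -(capv_compl (val U)) memv_cap xU; exact: subvsP.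
- move=> y; have [x ->] := sf y.
  by exists (vsproj _ (quo_proj U x)); rewrite hE vsprojK ?fq // quo_proj_in.
Qed.

End Quotients.

Section LocalObjects.
Variables (k : finFieldType) (C : triCat k) (hKS : krull_schmidt C).

Lemma iso_local_end (X Y : C) (f : chom X Y) (g : chom Y X) :
  g \oc f = idm X -> f \oc g = idm Y -> local_end X -> local_end Y.
Proof.
move=> gf fg [X0 loc]; split=> [Y0|h].
  by apply: X0; rewrite /is_zero -gf -(cmp1m f) Y0 cmp0m cmpm0.
have conj (u : chom X X) : is_iso u -> is_iso (f \oc u \oc g).
  move=> uI; apply: is_iso_comp; last by exists f.
  by apply: is_iso_comp => //; exists g.
have back (u : chom Y Y) : f \oc (g \oc u \oc f) \oc g = u.
  by rewrite !cmpA fg cmp1m -cmpA fg cmpm1.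
have [/conj|/conj] := loc (g \oc h \oc f); first by rewrite back; left.
by rewrite cmpmB cmpBm back cmpm1 fg; right.
Qed.

(** In a decomposition into objects with local endomorphism ring, the sum of all
    summands but the first has to vanish. *)
Lemma indecomposable_local (X : C) : indecomposable X -> local_end X.
Proof.
case=> X0 ind; have [m [X_ [[inj [prj [pi0 pi1 sum1]]] loc]]] := hKS X.
case: m X_ inj prj pi0 pi1 sum1 loc => [|m] X_ inj prj pi0 pi1 sum1 loc.
  by case: X0; rewrite /is_zero -sum1 big_ord0.
have lift0 (a : 'I_m) : lift ord0 a != ord0 by rewrite eq_sym neq_lift.
have liftI (a b : 'I_m) : a != b -> lift ord0 a != lift ord0 b.
  by rewrite (inj_eq lift_inj).
have [W [inj' [prj' [pi0' pi1' sum1']]]] :=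
  @tri_additive _ C _ (fun a : 'I_m => X_ (lift ord0 a)).
pose i1 (a : 'I_m) : chom (X_ (lift ord0 a)) X := inj (lift ord0 a).
pose p1 (a : 'I_m) : chom X (X_ (lift ord0 a)) := prj (lift ord0 a).
have p1i1 a : p1 a \oc i1 a = idm _ := pi0 (lift ord0 a).
have p1i1' a b : a != b -> p1 b \oc i1 a = 0 by move=> ab; exact: pi1 (liftI _ _ ab).
have p0i1 a : prj ord0 \oc i1 a = 0 := pi1 _ _ (lift0 a).
have p1i0 a : p1 a \oc inj ord0 = 0 by apply: pi1; rewrite eq_sym.
pose q : chom W X := \sum_(a < m) i1 a \oc prj' a.
pose p : chom X W := \sum_(a < m) inj' a \oc p1 a.
have qp : q \oc p = \sum_(a < m) i1 a \oc p1 a.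
  rewrite cmp_suml; apply: eq_bigr => a _.
  rewrite cmp_sumr (bigD1 a) //= cmpA -(cmpA (i1 a)) pi0' cmpm1.
  rewrite big1 ?addr0 // => b ba.
  by rewrite cmpA -(cmpA (i1 a)) (pi1' _ _ ba) cmpm0 cmp0m.
have pq : p \oc q = idm W.
  rewrite -sum1' cmp_suml; apply: eq_bigr => a _.
  rewrite cmp_sumr (bigD1 a) //= cmpA -(cmpA (inj' a)) p1i1 cmpm1.
  rewrite big1 ?addr0 // => b ba.
  by rewrite cmpA -(cmpA (inj' a)) (p1i1' _ _ ba) cmpm0 cmp0m.
have p0q : prj ord0 \oc q = 0.
  by rewrite cmp_sumr big1 // => a _; rewrite cmpA p0i1 cmp0m.
have p0p : p \oc inj ord0 = 0.
  by rewrite cmp_suml big1 // => a _; rewrite -cmpA p1i0 cmpm0.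
have dec : is_dirsum2 (X_ ord0) W X.
  exists (fun b : bool => if b return chom (if b then X_ ord0 else W) X then inj ord0 else q).
  exists (fun b : bool => if b return chom X (if b then X_ ord0 else W) then prj ord0 else p).
  split=> [[]|[] []|] //=.
  by rewrite big_bool /= qp -sum1 big_ord_recl.
have [Z0|W0] := ind _ _ dec; first by case: (loc ord0).
apply: (iso_local_end (f := inj ord0) (g := prj ord0)) => //.
by rewrite -sum1 big_ord_recl -qp (zero_from q W0) cmp0m addr0.
Qed.

End LocalObjects.

Section Maximal.
Variables (k : finFieldType) (C : triCat k) (T : C).

Lemma is_subm0 (X : rmod T) : is_subm (X := X) 0%VS.
Proof. by move=> x b; rewrite !memv0 => /eqP->; rewrite ract0m. Qed.

Lemma maximal_exists (X : rmod T) : (0%VS : {vspace X}) <> fullv ->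
  exists U : {vspace X}, maximal_subm U.
Proof.
move=> X0; pose P (U : {vspace X}) := `[< is_subm U /\ U <> fullv >].
have P0 : P 0%VS by apply/asboolP; split=> //; exact: is_subm0.
case: (arg_maxnP (fun U : {vspace X} => \dim U) P0) => U /asboolP[sU Uf] Umax.
exists U; split=> // V sV UV; case: (pselect (V = fullv)) => [|Vf]; first by right.
left; apply/eqP; rewrite eq_sym eqEdim UV; apply: Umax; exact/asboolP.
Qed.

Variables (P : C) (i : chom P T) (p : chom T P).
Hypotheses (pi1 : p \oc i = idm P) (locP : local_end P).

Lemma subm_full (U : {vspace F T P}) (u : chom T P) :
  is_subm U -> u \in U -> is_iso (u \oc i) -> U = fullv.
Proof.
move=> sU uU [g [_ ug]]; apply/eqP; rewrite eqEsubv subvf /=; apply/subvP => x _.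
by have := sU u (i \oc g \oc x) uU; rewrite /= /F_act !cmpA ug cmp1m.
Qed.

(** Otherwise U + V is everything and contains p, so id = u i + v i with u in U and
    v in V; by locality one of the terms is invertible. *)
Lemma maximal_unique (U V : {vspace F T P}) : maximal_subm U -> maximal_subm V -> U = V.
Proof.
case=> sU Uf maxU [sV Vf maxV].
have sUV : is_subm (U + V)%VS.
  move=> _ b /memv_addP[u uU [v vV ->]]; rewrite ractDm memv_add //.
    exact: sU.
  exact: sV.
have [UV|UVf] := maxU _ sUV (addvSl U V).
  have VU : (V <= U)%VS by rewrite -UV addvSr.
  by case: (maxV U sU VU).
have /memv_addP[u uU [v vV puv]] : (p : F T P) \in (U + V)%VS by rewrite UVf memvf.
have [uI|] := locP.2 (u \oc i); first by case: Uf; apply: subm_full uI.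
have -> : idm P - u \oc i = v \oc i by rewrite -pi1 puv cmpDm addrC addKr.
by move=> vI; case: Vf; apply: subm_full vI.
Qed.

Lemma rad_maximal (U : {vspace F T P}) : maximal_subm U -> rad_space (F T P) = U.
Proof.
move=> maxU; rewrite /rad_space; apply/eqP; rewrite eqEsubv; apply/andP; split.
  by apply: (bigcapv_inf U) => //; apply/asboolP.
by apply/subv_bigcapP => V /asboolP maxV; rewrite (maximal_unique maxU maxV).
Qed.

End Maximal.

Section Simples.
Variables (k : finFieldType) (C : triCat k).
Variables (hKS : krull_schmidt C) (hCY : two_CY C).
Variables (n : nat) (T_ : 'I_n -> C) (T : C) (hsum : is_dirsum T_ T).
Variables (hind : forall i, indecomposable (T_ i)).
Variables (hniso : forall i j, i != j -> ~ isomorphic (T_ i) (T_ j)).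
Variables (hT : cluster_tilting T).
Variable lft : forall (M : C) (M0 : subm (F T M)), lifting M0.
Implicit Types X Y Z : C.

Lemma summand_in_add j : in_add T (T_ j).
Proof.
have [inj [prj [pi0 _ _]]] := hsum; case: hT => tT _; apply/tT => f.
rewrite -(cmp1m f) -fmap1 -(pi0 j) fmapM -cmpA.
by rewrite (add_rigid hT (fmap sh (inj j) \oc f) (in_add_T T)) cmpm0.
Qed.

Lemma summand_local j : local_end (T_ j).
Proof. exact: indecomposable_local hKS _ (hind j). Qed.

Lemma summand_rad j (U : {vspace F T (T_ j)}) :
  maximal_subm U -> rad_space (F T (T_ j)) = U.
Proof.
have [inj [prj [pi0 _ _]]] := hsum; move=> maxU.
exact: (rad_maximal (pi0 j) (summand_local j) maxU).
Qed.

Lemma summand_rad_maximal j : maximal_subm (rad_space (F T (T_ j))).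
Proof.
have [inj [prj [pi0 _ _]]] := hsum.
have [|U maxU] := @maximal_exists _ _ _ (F T (T_ j)); last by rewrite (summand_rad maxU).
move=> F0; have := memvf (prj j : F T (T_ j)); rewrite -F0 memv0 => /eqP p0.
by have [T0 _] := summand_local j; apply: T0; rewrite /is_zero -(pi0 j) p0 cmp0m.
Qed.

Definition simple_module (X : rmod T) : Prop :=
  (0%VS : {vspace X}) <> fullv /\
  forall V : {vspace X}, is_subm V -> V = 0%VS \/ V = fullv.

Lemma is_subm_preim (X Y : C) (g : chom X Y) (V : {vspace F T Y}) :
  is_subm V -> is_subm (lpost T g @^-1: V : {vspace F T X})%VS.
Proof.
by move=> sV x b; rewrite -!memv_preim !lpostE => /sV-/(_ b); rewrite /= /F_act cmpA.
Qed.

Lemma quotient_simple X Z (g : chom X Z) (U : {vspace F T X}) :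
  maximal_subm U -> (forall x : chom T X, g \oc x = 0 <-> x \in U) ->
  (forall z : chom T Z, exists x, z = g \oc x) -> simple_module (F T Z).
Proof.
case=> sU Uf maxU kg sg; split.
  move=> Z0; apply: Uf; apply: vspace_iff => x; rewrite memvf; split=> // _.
  by apply/kg/eqP; rewrite -memv0 Z0 memvf.
move=> V sV; have sW := @is_subm_preim _ _ g _ sV.
have UW : (U <= lpost T g @^-1: V)%VS.
  by apply/subvP => x /kg gx; rewrite -memv_preim lpostE gx mem0v.
have [WU|Wf] := maxU _ sW UW; [left|right].
  apply: vspace_iff => z; have [x ->] := sg z; rewrite memv0; split.
    by move=> gxV; apply/eqP/kg; rewrite -WU -memv_preim lpostE.
  by move/eqP ->; exact: mem0v.
apply: vspace_iff => z; have [x ->] := sg z; rewrite memvf; split=> // _.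
by rewrite -lpostE memv_preim Wf memvf.
Qed.

(** The kernel of a nonzero map from F T_j to a simple module is a maximal
    submodule, and there is only one. *)
Lemma to_simple j X (y : chom (T_ j) X) : simple_module (F T X) -> y <> 0 ->
  (forall x : chom T X, exists t, x = y \oc t) /\
  (forall t : chom T (T_ j), y \oc t = 0 <-> t \in rad_space (F T (T_ j))).
Proof.
case=> X0 simX y0.
have ker0 : lker (lpost T y) <> fullv.
  move=> kf; apply: y0; apply: F_faithful_add (summand_in_add j) _ => t.
  by apply/mem_lker_lpost; rewrite kf memvf.
have sker : is_subm (X := F T (T_ j)) (lker (lpost T y)).
  move=> t b /mem_lker_lpost yt; apply/mem_lker_lpost.
  by rewrite /= /F_act cmpA yt cmp0m.
have sur (t : chom T X) : exists u, t = y \oc u.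
  have [im0|imf] := simX _ (@Fimg_subm _ _ T _ _ y).
    case: ker0; apply: vspace_iff => u; rewrite memvf; split=> // _.
    apply/mem_lker_lpost/eqP; rewrite -memv0 -im0; apply/mem_limg_lpost; by exists u.
  by apply/mem_limg_lpost; rewrite imf memvf.
split=> // t; rewrite (@summand_rad j (lker (lpost T y))).
  exact: iff_sym (mem_lker_lpost _ _).
split=> // V sV kV; pose W : {vspace F T X} := (lpost T y @: V)%VS.
have sW : is_subm W.
  move=> _ b /memv_imgP[v vV ->]; apply/memv_imgP; exists (ract (v : F T (T_ j)) b).
    exact: sV.
  by rewrite !lpostE /= /F_act cmpA.
have [W0|Wf] := simX _ sW; [left|right].
  apply/eqP; rewrite eqEsubv kV andbT; apply/subvP => v vV.
  apply/mem_lker_lpost/eqP; rewrite -memv0 -W0 -lpostE; exact: memv_img.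
apply: vspace_iff => u; rewrite memvf; split=> // _.
have : y \oc u \in W by rewrite Wf memvf.
case/memv_imgP=> v vV; rewrite lpostE => uv.
rewrite -(subrK v u) memvD // (subvP kV) //; apply/mem_lker_lpost.
by rewrite cmpmB uv subrr.
Qed.

Lemma simple_cover j : exists (S : C) (p : chom (T_ j) S),
  [/\ forall x : chom T S, exists t, x = p \oc t,
      forall t : chom T (T_ j), p \oc t = 0 <-> t \in rad_space (F T (T_ j)),
      miso (simple T T_ j) (F T S) & simple_module (F T S)].
Proof.
have [S [p [kp sp]]] := quotient_object hT lft (mksubm (@rad_subm _ _ _ (F T (T_ j)))).
exists S, p; split=> //; last exact: quotient_simple (summand_rad_maximal j) kp sp.
apply: quo_mod_iso (Fmap_rhom T p) _ _ => [x|x]; first by rewrite FmapE; apply: kp.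
by have [t ->] := sp x; exists t; rewrite FmapE.
Qed.

Definition simple_obj j : C := sval (cid (simple_cover j)).

Definition top_map j : chom (T_ j) (simple_obj j) :=
  sval (cid (svalP (cid (simple_cover j)))).

Lemma top_mapP j :
  [/\ forall x : chom T (simple_obj j), exists t, x = top_map j \oc t,
      forall t : chom T (T_ j), top_map j \oc t = 0 <-> t \in rad_space (F T (T_ j)),
      miso (simple T T_ j) (F T (simple_obj j)) & simple_module (F T (simple_obj j))].
Proof. exact: (svalP (cid (svalP (cid (simple_cover j))))). Qed.

Lemma simple_iso j : miso (simple T T_ j) (F T (simple_obj j)).
Proof. by case: (top_mapP j). Qed.

Lemma simple_obj_simple j : simple_module (F T (simple_obj j)).
Proof. by case: (top_mapP j). Qed.

Lemma top_map_neq0 j : top_map j <> 0.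
Proof.
have [sp _ _ [S0 _]] := top_mapP j => p0; apply: S0; apply: vspace_iff => x.
by rewrite memvf memv0; split=> // _; have [t ->] := sp x; rewrite p0 cmp0m.
Qed.

Lemma top_factor j X (y : chom (T_ j) X) : simple_module (F T X) -> y <> 0 ->
  exists g : chom (simple_obj j) X, y = g \oc top_map j.
Proof.
move=> simX y0; have [sp kp _ _] := top_mapP j; have [_ ky] := to_simple simX y0.
have [|g yg] := F_cofactor hT (y := y) sp; first by move=> x /kp/ky.
exists g; apply/eqP; rewrite -subr_eq0; apply/eqP.
exact: F_faithful_add (summand_in_add j) yg.
Qed.

(** Every map F T_j -> S_j factors through the top S_j of F T_j. *)
Lemma simple_hom_dim j :
  \dim {:chom (T_ j) (simple_obj j)} = \dim (rhom (simple T T_ j) (simple T T_ j)).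
Proof.
rewrite (dim_rhom_iso (simple_iso j) (simple_iso j)).
have d1 := dim_rhomF hT (simple_obj j) (simple_obj j).
have E1 : limg (lpre (simple_obj j) (top_map j)) = fullv.
  apply: vspace_iff => y; rewrite memvf; split=> // _.
  case: (eqVneq y 0) => [->|/eqP y0]; first exact: mem0v.
  have [g ->] := top_factor (simple_obj_simple j) y0.
  by rewrite -lpreE memv_img ?memvf.
have E2 : lker (lpre (simple_obj j) (top_map j)) = killedvs T (simple_obj j) (simple_obj j).
  apply: vspace_iff => g; rewrite memv_ker lpreE; split=> [/eqP gp|/mem_killed Kg].
    apply/mem_killed => x; have [sp _ _ _] := top_mapP j.
    by have [t ->] := sp x; rewrite cmpA gp cmp0m.
  apply/eqP/(F_faithful_add (summand_in_add j)); exact: killed_pre.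
have := lker_limg_dim (lpre (simple_obj j) (top_map j)); rewrite E1 E2; lia.
Qed.

(** A nonzero map would make T_l and T_j two projective covers of the same simple
    module: the lifts of each cover through the other are mutually inverse up to
    automorphisms, by locality. *)
Lemma simple_hom0 l j : l != j -> \dim {:chom (T_ l) (simple_obj j)} = 0%N.
Proof.
move=> lj; apply/eqP; rewrite dimv_eq0; apply/eqP/vspace_iff => y.
rewrite memvf memv0; split=> // _; case: (eqVneq y 0) => // /eqP y0; exfalso.
have [sp _ _ simS] := top_mapP j; have [sy _] := to_simple simS y0.
have lift (P : C) (x : chom P (simple_obj j)) (Q : C) (q : chom Q (simple_obj j)) :
    in_add T P -> (forall t : chom T (simple_obj j), exists u, t = q \oc u) ->
    exists g, x = q \oc g.
  move=> /in_add_sum[m [u [w uw]]] sq.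
  have /choice[s sE] : forall a, exists s, x \oc u a = q \oc s by move=> a; apply: sq.
  exists (\sum_a s a \oc w a); rewrite -{1}(cmpm1 x) uw !cmp_sumr.
  by apply: eq_bigr => a _; rewrite !cmpA sE.
have [g gE] := lift _ y _ _ (summand_in_add l) sp.
have [h hE] := lift _ (top_map j) _ _ (summand_in_add j) sy.
have isoP i (x : chom (T_ i) (simple_obj j)) (u : chom (T_ i) (T_ i)) :
    x <> 0 -> x \oc u = x -> is_iso u.
  move=> x0 xu; case: ((summand_local i).2 u) => // [[v [_ uv]]].
  by case: x0; rewrite -(cmpm1 x) -uv cmpA cmpmB cmpm1 xu subrr cmp0m.
have [v [_ vR]] : is_iso (g \oc h).
  by apply: isoP (@top_map_neq0 j) _; rewrite cmpA -gE -hE.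
have [w [wL _]] : is_iso (h \oc g) by apply: isoP y0 _; rewrite cmpA -hE -gE.
apply: (hniso lj); exists g, (h \oc v); split; last by rewrite cmpA.
have -> : h \oc v = w \oc h.
  by rewrite -(cmp1m (h \oc v)) -wL -!cmpA (cmpA g) vR cmpm1.
by rewrite -cmpA.
Qed.

Lemma simple_module_cover X : simple_module (F T X) ->
  exists j, miso (F T (simple_obj j)) (F T X).
Proof.
move=> simX; have [inj [prj [pi0 _ sum1]]] := hsum.
have [[j [y y0]]|none] := pselect (exists j (y : chom (T_ j) X), y <> 0); last first.
  case: simX => X0 _; case: X0; apply: vspace_iff => x; rewrite memvf memv0; split=> // _.
  rewrite -(cmpm1 x) -sum1 cmp_sumr big1 // => j _; rewrite cmpA.
  case: (eqVneq (x \oc inj j) 0) => [->|/eqP xj]; first by rewrite cmp0m.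
  by case: none; exists j, (x \oc inj j).
exists j; apply: miso_trans (miso_sym (simple_iso j)) _.
have [sy ky] := to_simple simX y0.
apply: quo_mod_iso (Fmap_rhom T y) _ _ => [x|x]; first by rewrite FmapE; apply: ky.
by have [t ->] := sy x; exists t; rewrite FmapE.
Qed.

Lemma F_zero X : \dim {:chom T X} = 0%N -> forall j, \dim {:chom (T_ j) X} = 0%N.
Proof.
have [inj [prj [pi0 _ _]]] := hsum; move=> d0 j.
apply/eqP; rewrite dimv_eq0; apply/eqP/vspace_iff => y; rewrite memvf memv0; split=> // _.
move/eqP: d0; rewrite dimv_eq0 => /eqP/vspaceP d0.
have := d0 (y \oc prj j); rewrite memvf memv0 => /esym/eqP yp.
by rewrite -(cmpm1 y) -(pi0 j) cmpA yp cmp0m.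
Qed.

Lemma dim_hom_iso j X X' : miso (F T X) (F T X') ->
  \dim {:chom (T_ j) X} = \dim {:chom (T_ j) X'}.
Proof.
move=> iX; rewrite -!(dim_rhomF_add hT _ (summand_in_add j)).
by apply: dim_rhom_iso => //; exact: miso_refl.
Qed.

(** By induction along a composition series: the multiplicities of the simples
    in FX are read off from the Hom(T_j, X), and the antisymmetrized Euler form
    only sees these multiplicities. *)
Lemma devissage X : exists m : 'I_n -> nat,
  (forall j, \dim {:chom (T_ j) X} =
             (m j * \dim (rhom (simple T T_ j) (simple T T_ j)))%N) /\
  (forall Y, euler_a (F T Y) (F T X) =
             \sum_j (m j)%:Z * euler_a (F T Y) (F T (simple_obj j))).
Proof.
have [d] := ubnP (\dim {:chom T X}); elim: d X => // d IH X.
rewrite ltnS => Xd; case: (posnP (\dim {:chom T X})) => [d0|dpos].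
  exists (fun _ => 0%N); split=> [j|Y]; first by rewrite F_zero.
  rewrite big1; last by move=> j _; rewrite mul0r.
  have ex : Fexact T (0 : chom X X) (0 : chom X X).
    have all0 (t : chom T X) : t = 0.
      move/eqP: d0; rewrite dimv_eq0 => /eqP/vspaceP/(_ t).
      by rewrite memvf memv0 => /esym/eqP.
    split=> [t _|t|t]; first exact: all0.
      by rewrite cmp0m; split=> // _; exists 0; rewrite cmpm0; apply: all0.
    by exists 0; rewrite cmpm0; apply: all0.
  by have /eqP := euler_a_addr hCY hT Y ex; rewrite -subr_eq0 opprD addNKr oppr_eq0 => /eqP.
have [|U maxU] := @maximal_exists _ _ _ (F T X).
  by move=> F0; move: dpos; rewrite -F0 dimv0.
have [sU Uf _] := maxU; pose U' := mksubm sU.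
have [Z [g [kg sg]]] := quotient_object hT lft U'.
have ex := sub_quotient_Fexact lft kg sg.
have simZ := quotient_simple maxU kg sg.
have [j0 isoZ] := simple_module_cover simZ.
have addj j := hom_add_Fexact (summand_in_add j) ex.
have dT := hom_add_Fexact (in_add_T T) ex.
have Zpos : (0 < \dim {:chom T Z})%N.
  rewrite lt0n; apply/negP; rewrite dimv_eq0 => /eqP Z0.
  by case: simZ => + _; rewrite Z0.
have [|m [mdim mE]] := IH (lob (lft U')); first by lia.
exists (fun j => m j + (j == j0))%N; split=> [j|Y].
  rewrite addj mdim -(dim_hom_iso j isoZ) mulnDl; congr addn.
  case: eqVneq => [->|jj]; first by rewrite mul1n simple_hom_dim.
  by rewrite mul0n simple_hom0.
rewrite (euler_a_addr hCY hT Y ex) mE -(euler_a_iso (miso_refl _) isoZ).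
pose E j := euler_a (F T Y) (F T (simple_obj j)).
transitivity (\sum_j ((m j)%:Z * E j + (if j == j0 then E j else 0))).
  by rewrite big_split -big_mkcond big_pred1_eq.
apply: eq_bigr => j _; rewrite PoszD mulrDl.
by case: (j == j0); rewrite ?mul1r ?mul0r.
Qed.

Lemma simple_end_pos j : (0 < \dim (rhom (simple T T_ j) (simple T T_ j)))%N.
Proof.
rewrite -simple_hom_dim lt0n; apply/negP; rewrite dimv_eq0 => /eqP/vspaceP/(_ (top_map j)).
by rewrite memvf memv0 => /esym/eqP/top_map_neq0.
Qed.

(** The multiplicity of the simple in [devissage] is an integer, so the division in
    [dvec] is exact. *)
Lemma dvecE X j : (dvec T_ (F T X) j * \dim (rhom (simple T T_ j) (simple T T_ j)))%N
  = \dim {:chom (T_ j) X}.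
Proof.
have [m [mdim _]] := devissage X.
rewrite ffunE (dim_rhomF_add hT _ (summand_in_add j)) mdim mulnK //.
exact: simple_end_pos.
Qed.

Lemma euler_a_dvecE i X :
  euler_a_dvec T T_ i (dvec T_ (F T X)) = euler_a (simple T T_ i) (F T X).
Proof.
have [m [mdim mE]] := devissage X.
rewrite (euler_a_iso (simple_iso i) (miso_refl _)) mE /euler_a_dvec.
apply: eq_bigr => j _; rewrite -(euler_a_iso (simple_iso i) (simple_iso j)).
congr (Posz _ * _); apply/eqP; rewrite -(eqn_pmul2r (simple_end_pos j)).
by rewrite dvecE mdim.
Qed.

Lemma dvec_iso (X Y : rmod T) : miso X Y -> dvec T_ X = dvec T_ Y.
Proof.
move=> XY; apply/ffunP => j; rewrite !ffunE; congr (_ %/ _)%N.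
by apply: dim_rhom_iso => //; exact: miso_refl.
Qed.

Lemma coindE X c i : is_coind T T_ X c -> c 0 i = coind_hom T (simple_obj i) X.
Proof.
case=> T3 [T4 [f [g [h [a3 a4 D ->]]]]]; rewrite !mxE.
rewrite -(coind_hom_triangle hCY hT _ a3 a4 D) -!(dim_rhomF_add hT) //.
by rewrite !(dim_rhom_iso (miso_refl _) (simple_iso i)).
Qed.

End Simples.

(** * Submodules of the middle term of a triangle *)

Section Exponents.
Variables (k : finFieldType) (C : triCat k).
Variables (T : C) (hT : cluster_tilting T).
Implicit Types X Y Z P : C.

Lemma hom_lift P X Y (f : chom X Y) (U : {vspace F T X}) (y : chom P Y) :
  in_add T P -> is_subm U ->
  (forall t : chom T P, exists2 x, x \in U & y \oc t = f \oc x) ->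
  exists2 x : chom P X, y = f \oc x & forall t : chom T P, x \oc t \in U.
Proof.
move=> /in_add_sum[m [u [w uw]]] sU Hy.
have /choice[x Hx] : forall a, exists x : chom T X, x \in U /\ y \oc u a = f \oc x.
  by move=> a; have [x xU xE] := Hy (u a); exists x.
exists (\sum_a x a \oc w a).
  rewrite -{1}(cmpm1 y) uw !cmp_sumr; apply: eq_bigr => a _.
  by rewrite !cmpA (Hx a).2.
move=> t; rewrite cmp_suml; apply: memv_suml => a _; rewrite -cmpA.
exact: (sU _ (w a \oc t) (Hx a).1).
Qed.

(** The image of Hom(P, U') in Hom(P, X), for U' a lift of the submodule U; this
    description makes the maps between submodules visible as maps of C. *)
Definition hom_in P X (U : {vspace F T X}) : {vspace chom P X} :=
  vspan (fun y : chom P X => forall t : chom T P, (y \oc t : F T X) \in U).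

Lemma mem_hom_in P X (U : {vspace F T X}) (y : chom P X) :
  y \in hom_in P U <-> forall t : chom T P, (y \oc t : F T X) \in U.
Proof.
apply: mem_vspan => [t|a x z Hx Hz t]; first by rewrite cmp0m mem0v.
by rewrite cmpDm cmpZm memvD ?memvZ ?Hx ?Hz.
Qed.

Variable lft : forall (M : C) (M0 : subm (F T M)), lifting M0.

Lemma sub_mod_iso X (U : subm (F T X)) : miso (sub_mod U) (F T (lob (lft U))).
Proof.
apply: miso_sym.
pose f : 'Hom(F T (lob (lft U)), sub_mod U) :=
  (linfun (vsproj (val U)) \o Fmap T (lmor (lft U)))%VF.
have fE x : vsval (f x) = lmor (lft U) \oc x.
  rewrite comp_lfunE lfunE FmapE /= vsprojK //; apply/(lft_img lft U).
  by exists x.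
apply: (miso_bij (f := f)).
- apply/mem_rhom => x b; apply: val_inj; rewrite /= fE.
  by rewrite [RHS](sub_actE (f x : subvs_of _) b) fE /= /F_act cmpA.
- by move=> x y /(congr1 vsval); rewrite !fE -!(FmapE (lmor _)) => /lmor_inj.
- move=> z; have /(lft_img lft U)[t tE] := subvsP z.
  by exists t; apply: val_inj; rewrite /= fE -tE.
Qed.

Lemma dim_hom_in P X (U : subm (F T X)) : in_add T P ->
  \dim (hom_in P (val U)) = \dim {:chom P (lob (lft U))}.
Proof.
move=> aP; rewrite -(lker_limg_dim (lpost P (lmor (lft U)))).
have -> : lker (lpost P (lmor (lft U))) = 0%VS.
  apply: vspace_iff => x; rewrite memv0; split=> [/mem_lker_lpost x0|/eqP->].
    apply/eqP/(F_faithful_add aP) => t; apply: (@lft_inj _ _ _ lft _ U).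
    by rewrite cmpA x0 cmp0m.
  exact: mem0v.
rewrite dimv0 add0n; congr (\dim _); apply: vspace_iff => y.
split=> [/mem_hom_in yU|/mem_limg_lpost[x ->]].
  have [||x -> _] := hom_lift (f := lmor (lft U)) (U := fullv) (y := y) aP.
  - by move=> x b _; rewrite memvf.
  - move=> t; have /(lft_img lft U)[x xE] := yU t.
    by exists x; first exact: memvf.
  by apply/mem_limg_lpost; exists x.
by apply/mem_hom_in => t; apply/(lft_img lft U); exists (x \oc t); rewrite cmpA.
Qed.

Section Triangle.
Variables (e : mor C) (E : tri e).
Let i := tin E.
Let p := tpr E.
Let D : dist i p (arr e) := tdist E.

Lemma psiP (L0 : subm (F T (mt E))) (M0 : subm (F T (qt e))) (N0 : subm (F T (st e))) :
  psi L0 = (M0, N0) <->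
    (forall x : chom T (qt e), x \in val M0 <-> exists2 l, l \in val L0 & x = p \oc l) /\
    (forall x : chom T (st e), x \in val N0 <-> (i \oc x : F T (mt E)) \in val L0).
Proof.
have m1 (x : chom T (qt e)) :
    x \in val (psi L0).1 <-> exists2 l, l \in val L0 & x = p \oc l.
  by split=> [/memv_imgP|] [l lL ->];
    [exists l; rewrite ?FmapE|apply/memv_imgP; exists l; rewrite ?FmapE].
have m2 (x : chom T (st e)) :
    x \in val (psi L0).2 <-> (i \oc x : F T (mt E)) \in val L0.
  by rewrite /= -memv_preim FmapE.
split=> [psiE|[h1 h2]].
  by rewrite psiE in m1 m2.
rewrite [psi L0]surjective_pairing; congr (_, _); apply: val_inj; apply: vspace_iff => x.
  by apply: iff_trans (m1 x) (iff_sym (h1 x)).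
by apply: iff_trans (m2 x) (iff_sym (h2 x)).
Qed.

Variables (L0 : subm (F T (mt E))) (M0 : subm (F T (qt e))) (N0 : subm (F T (st e))).
Hypothesis psiL : psi L0 = (M0, N0).

(** Hom(P, -) for P in add T is exact on 0 -> FK -> N0 -> L0 -> M0 -> 0. *)
Lemma dim_hom_in_psi P K (j : chom K (st e)) : in_add T P -> Finj T j ->
  (forall t : chom T (st e), i \oc t = 0 <-> exists s, t = j \oc s) ->
  (\dim (hom_in P (val L0)) + \dim {:chom P K} =
   \dim (hom_in P (val M0)) + \dim (hom_in P (val N0)))%N.
Proof.
move=> aP injj kj; have [hM hN] := (psiP L0 M0 N0).1 psiL.
have d1 := limg_ker_dim (lpost P p) (hom_in P (val L0)).
have d2 := limg_ker_dim (lpost P i) (hom_in P (val N0)).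
have d3 := lker_limg_dim (lpost P j).
have full_subm X : is_subm (X := F T X) fullv by move=> x b _; rewrite memvf.
have E1 : (lpost P p @: hom_in P (val L0) = hom_in P (val M0))%VS.
  apply: vspace_iff => y; split=> [/memv_imgP[x /mem_hom_in xL ->]|/mem_hom_in yM].
    by rewrite lpostE; apply/mem_hom_in => t; apply/hM; exists (x \oc t); rewrite ?cmpA.
  have [|x -> xL] := hom_lift (f := p) (y := y) aP (submP (U := L0)).
    by move=> t; apply/hM.
  by rewrite -lpostE memv_img //; apply/mem_hom_in.
have E2 : (hom_in P (val L0) :&: lker (lpost P p) = lpost P i @: hom_in P (val N0))%VS.
  apply: vspace_iff => y; rewrite memv_cap; split.
    case/andP=> /mem_hom_in yL /mem_lker_lpost/(dist_lift D)[x xE].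
    rewrite xE -lpostE memv_img //; apply/mem_hom_in => t; apply/hN.
    by rewrite cmpA -xE.
  case/memv_imgP=> x /mem_hom_in xN ->; rewrite lpostE; apply/andP; split.
    by apply/mem_hom_in => t; rewrite -cmpA; apply/hN.
  by apply/mem_lker_lpost; rewrite cmpA (dist_comp0 D) cmp0m.
have E3 : (hom_in P (val N0) :&: lker (lpost P i) = limg (lpost P j))%VS.
  apply: vspace_iff => y; rewrite memv_cap; split.
    case/andP=> _ /mem_lker_lpost iy; apply/mem_limg_lpost.
    have [|x -> _] := hom_lift (f := j) (U := fullv) (y := y) aP (full_subm K).
      move=> t; have [|s ->] := (kj (y \oc t)).1; first by rewrite cmpA iy cmp0m.
      by exists s; rewrite ?memvf.
    by exists x.
  case/mem_limg_lpost=> x ->; have ij (t : chom T P) : i \oc (j \oc x \oc t) = 0.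
    by apply/kj; exists (x \oc t); rewrite cmpA.
  apply/andP; split.
    by apply/mem_hom_in => t; apply/hN; rewrite ij mem0v.
  apply/mem_lker_lpost/(F_faithful_add aP) => t; by rewrite -cmpA ij.
have E4 : lker (lpost P j) = 0%VS.
  apply: vspace_iff => x; rewrite memv0; split=> [/mem_lker_lpost x0|/eqP->].
    by apply/eqP/(F_faithful_add aP) => t; apply: injj; rewrite cmpA x0 cmp0m.
  exact: mem0v.
rewrite E1 E2 in d1; rewrite E3 in d2; rewrite E4 dimv0 in d3; lia.
Qed.

End Triangle.
End Exponents.

Section ExponentAddition.
Variables (k : finFieldType) (C : triCat k).
Variables (hKS : krull_schmidt C) (hCY : two_CY C).
Variables (n : nat) (T_ : 'I_n -> C) (T : C) (hsum : is_dirsum T_ T).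
Variables (hind : forall i, indecomposable (T_ i)).
Variables (hniso : forall i j, i != j -> ~ isomorphic (T_ i) (T_ j)).
Variables (hT : cluster_tilting T).
Variable lft : forall (M : C) (M0 : subm (F T M)), lifting M0.
Variables (coind : C -> 'rV[int]_n) (hcoind : forall X, is_coind T T_ X (coind X)).

(** The kernel FK of FN -> FL makes the dimension vector of a submodule over
    (M0, N0) drop by that of FK, and by [coind_hom_defect] the coindex changes
    by the Euler form with FK: the two effects cancel. *)
Lemma pvec_psi (e : mor C) (E : tri e) (L0 : subm (F T (mt E)))
    (M0 : subm (F T (qt e))) (N0 : subm (F T (st e))) : psi L0 = (M0, N0) ->
  pvec T T_ coind (mt E) (dvec T_ (sub_mod L0)) =
  pvec T T_ coind (qt e) (dvec T_ (sub_mod M0)) +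
  pvec T T_ coind (st e) (dvec T_ (sub_mod N0)).
Proof.
move=> psiL; have [K [j [injj kj def]]] := coind_hom_defect hCY hT lft (tdist E).
have dimE (X : C) (U : subm (F T X)) (a : 'I_n) :
    (dvec T_ (sub_mod U) a * \dim (rhom (simple T T_ a) (simple T T_ a)))%N =
    \dim (hom_in (T_ a) (val U)).
  rewrite (dim_hom_in lft U (summand_in_add hsum hT a)).
  rewrite -(dvecE hKS hCY hsum hind hniso hT lft).
  by rewrite (dvec_iso T_ (sub_mod_iso lft U)).
have dE (l : 'I_n) : (dvec T_ (sub_mod L0) l + dvec T_ (F T K) l =
             dvec T_ (sub_mod M0) l + dvec T_ (sub_mod N0) l)%N.
  apply/eqP; rewrite -(eqn_pmul2r (simple_end_pos hKS hsum hind hT lft l)); apply/eqP.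
  rewrite !mulnDl !dimE (dvecE hKS hCY hsum hind hniso hT lft).
  exact: (@dim_hom_in_psi _ _ _ _ _ _ _ _ psiL _ _ _ (summand_in_add hsum hT l) injj kj).
apply/rowP => r; rewrite !mxE.
have defr := def (simple_obj hKS hsum hind hT lft r).
rewrite -!(coindE hKS hCY hsum hind hT lft r (hcoind _)) in defr.
rewrite -(euler_a_iso (simple_iso hKS hsum hind hT lft r) (miso_refl _)) in defr.
rewrite -(euler_a_dvecE hKS hCY hsum hind hniso hT lft) in defr.
have EE : euler_a_dvec T T_ r (dvec T_ (sub_mod L0)) + euler_a_dvec T T_ r (dvec T_ (F T K))
    = euler_a_dvec T T_ r (dvec T_ (sub_mod M0)) + euler_a_dvec T T_ r (dvec T_ (sub_mod N0)).
  rewrite -!big_split /=; apply: eq_bigr => l _.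
  by rewrite -!mulrDl -!PoszD dE.
lia.
Qed.

End ExponentAddition.

Lemma quo_proj_eq (k : finFieldType) (C : triCat k) (T : C) (X : rmod T)
    (U : subm X) (x y : X) : x - y \in val U -> quo_proj U x = quo_proj U y.
Proof. by move=> xy; apply/eqP; rewrite -subr_eq0 -linearB /= quo_proj0. Qed.

Lemma quo_proj_ract (k : finFieldType) (C : triCat k) (T : C) (X : rmod T)
    (U : subm X) (z : X) b :
  quo_proj U (ract (quo_proj U z) b) = quo_proj U (ract z b).
Proof.
apply/esym/quo_proj_eq; rewrite -ractBm; exact: submP b (quo_projB U z).
Qed.

Section Fibers.
Variables (k : finFieldType) (C : triCat k) (hCY : two_CY C).
Variables (T : C) (hT : cluster_tilting T).
Variable lft : forall (M : C) (M0 : subm (F T M)), lifting M0.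

Lemma dist_of_third (X Z : C) (s : chom Z (sh X)) :
  exists (Y : C) (f : chom X Y) (g : chom Y Z), dist f g s.
Proof.
have [Y [g [h D]]] := dist_cocone s; have [f fE] := sh_full h.
by exists Y, (- f), g; apply/dist_rot; rewrite fmapN opprK -fE.
Qed.

Section OneTriangle.
Variables (e : mor C) (E : tri e).
Variables (M0 : subm (F T (qt e))) (N0 : subm (F T (st e))).
Let i := tin E.
Let p := tpr E.
Let D : dist i p (arr e) := tdist E.
Let iM := lmor (lft M0).
Let iN := lmor (lft N0).

(** The middle term of the triangle on the induced map M' -> Sigma N' maps to L,
    and the image of F of this map is the submodule. It lies over the whole of M0
    because the induced map is killed by T, and it meets FN in N0 because the
    kernel of FN -> FL is contained in N0. *)
Lemma gluing_submodule : arr e \in gluing T iM iN -> exists L0, psi (E := E) L0 = (M0, N0).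
Proof.
case/mem_gluing=> [[a [c [Kc eE]]] [s [Ks es]]].
have [Q [f [g Ds]]] := dist_of_third s.
have Dr1 := (dist_rot _ _ _).1 ((dist_rot _ _ _).1 Ds).
have Dr2 := (dist_rot _ _ _).1 ((dist_rot _ _ _).1 D).
have [|h' [h1 h2]] := dist_mor (a := iM) (b := fmap sh iN) Dr1 Dr2; first by rewrite es.
have [h hE] := sh_full h'.
have hf : h \oc f = i \oc iN.
  apply: sh_faithful; apply: oppr_inj.
  by rewrite !fmapM -hE -cmpmN h1 cmpNm.
have ph : p \oc h = iM \oc g.
  apply: sh_faithful; apply: oppr_inj.
  by rewrite !fmapM -hE -cmpNm -h2 cmpmN.
have gsur (x : chom T (lob (lft M0))) : exists y, x = g \oc y.
  by apply: dist_lift' Ds _; apply: Ks.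
exists (mksubm (@Fimg_subm _ _ T _ _ h)); apply/psiP; split=> x.
  apply: iff_trans (lft_img lft M0 x) _; split=> [[t ->]|].
    have [y ->] := gsur t; exists (h \oc y); first by apply/mem_limg_lpost; exists y.
    by rewrite !cmpA ph.
  by case=> l /mem_limg_lpost[y ->] ->; exists (g \oc y); rewrite !cmpA ph.
apply: iff_trans (lft_img lft N0 x) _; split=> [[t ->]|/mem_limg_lpost[y iy]].
  by apply/mem_limg_lpost; exists (f \oc t); rewrite !cmpA hf.
have gy : g \oc y = 0.
  apply: (@lft_inj _ _ _ lft _ M0); rewrite cmpA -ph -cmpA -iy cmpA.
  by rewrite (dist_comp0 D) cmp0m.
have [z zE] := dist_lift Ds gy.
have [|w wE] := dist_lift'' (u := fmap sh (x - iN \oc z)) D.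
  by rewrite -fmapM cmpmB iy zE !cmpA hf subrr fmap0.
have [v vE] := sh_full (a \oc w).
have xE : x - iN \oc z = iN \oc v.
  by apply: sh_faithful; rewrite wE eE cmpDm Kc addr0 -cmpA vE fmapM.
by exists (v + z); rewrite cmpmD -xE subrK.
Qed.

(** An approximation T1 -> T0 of the lift of M0 maps to the triangle, through L0 on
    T0 and through N0 on T1. The resulting map from the lift of M0 to M may differ
    from the inclusion, but only by a map through Sigma T1, and the connecting map
    sends this difference into N0 as well. *)
Lemma submodule_gluing L0 : psi (E := E) L0 = (M0, N0) -> arr e \in gluing T iM iN.
Proof.
move=> /psiP[hM hN]; have injM : Finj T iM := @lft_inj _ _ _ lft _ M0.
have injN : Finj T iN := @lft_inj _ _ _ lft _ N0.
have kerN (x : chom T (st e)) : i \oc x = 0 -> exists z, x = iN \oc z.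
  by move=> ix; apply/(lft_img lft N0)/hN; rewrite -/i ix mem0v.
have fromM (y : chom (sh T) (qt e)) : exists z, arr e \oc y = fmap sh (iN \oc z).
  have [x xE] := sh_full (arr e \oc y); rewrite xE.
  have [|z ->] := kerN x; last by exists z.
  by apply: sh_eq0; rewrite fmapM -xE cmpA (dist_comp0'' D) cmp0m.
apply/mem_gluing; split.
  have [t [ts st]] := shK_iso (qt e); have [b bE] := sh_full (arr e \oc t).
  have [|a0 Ka] := F_factor hT injN (f := b).
    move=> x; have [z zE] := fromM (t \oc fmap sh x); exists z.
    by apply: sh_faithful; rewrite fmapM -bE -cmpA zE.
  exists (fmap sh a0 \oc shK (qt e)), (fmap sh (b - iN \oc a0) \oc shK (qt e)); split.
    exact/killed_pre/(killed_sh T _).1.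
  by rewrite fmapB cmpBm fmapM cmpA addrC subrK -bE -cmpA ts cmpm1.
have [T1 [T0 [mu [pi [kappa [a1 a0 Da]]]]]] := approximation hT (lob (lft M0)).
(* lift the generators of M0 to L0 *)
have [t|y yE yL] := hom_lift (f := p) (y := iM \oc pi) a0 (submP (U := L0)).
  by apply/hM/(lft_img lft M0); exists (pi \oc t); rewrite cmpA.
(* their relations then land in the part of L0 that comes from N0 *)
have [z zE] : exists z, y \oc mu = i \oc z.
  by apply: dist_lift D _; rewrite cmpA -yE -cmpA (dist_comp0 Da) cmpm0.
have fullT X : is_subm (X := F T X) fullv by move=> x b _; rewrite memvf.
have [t|c1 c1E _] := hom_lift (f := iN) (U := fullv) (y := z) a1 (fullT _).
  have /hN/(lft_img lft N0)[v ->] : (i \oc (z \oc t) : F T (mt E)) \in val L0.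
    by rewrite cmpA -zE -cmpA; apply: yL.
  by exists v; rewrite ?memvf.
have [|m [m1 m2]] := dist_mor (a := iN \oc c1) (b := y) Da D.
  by rewrite zE c1E.
have [|g gE] := dist_extend' (u := m - iM) Da.
  by rewrite cmpBm m1 -/p -yE subrr.
have [h hE] := sh_full (arr e \oc g).
have [t|c2 c2E _] := hom_lift (f := iN) (U := fullv) (y := h) a1 (fullT _).
  have [v vE] := fromM (g \oc fmap sh t); exists v; first by rewrite memvf.
  by apply: sh_faithful; rewrite fmapM -hE -cmpA vE.
exists (fmap sh (c1 - c2) \oc kappa); split.
  by move=> t; rewrite -cmpA (add_rigid hT (kappa \oc t) a1) cmpm0.
have -> : iM = m - g \oc kappa by rewrite -gE opprB addrC subrK.
rewrite cmpmB -m2 cmpA hE c2E -cmpBm -fmapB -cmpmB fmapM; exact/esym/cmpA.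
Qed.

End OneTriangle.

(** Submodules of FL over the same (M0, N0) as L1 are the translates of L1 by
    the module maps M0 -> FN / N0. *)
Section Torsor.
Variables (e : mor C) (E : tri e).
Variables (M0 : subm (F T (qt e))) (N0 : subm (F T (st e))) (L1 : subm (F T (mt E))).
Hypothesis psiL1 : psi L1 = (M0, N0).
Let i := tin E.
Let p := tpr E.
Let D : dist i p (arr e) := tdist E.

Let hM := ((psiP L1 M0 N0).1 psiL1).1.
Let hN := ((psiP L1 M0 N0).1 psiL1).2.

Definition translate_pred (h : 'Hom(sub_mod M0, quo_mod N0)) (x : chom T (mt E)) : Prop :=
  exists (l : chom T (mt E)) (z : chom T (st e)),
    [/\ (l : F T (mt E)) \in val L1, x = l + i \oc z &
        quo_proj N0 (z : F T (st e)) = vsval (h (vsproj (val M0) (p \oc l)))].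

Definition translate h : {vspace F T (mt E)} := vspan (translate_pred h).

Lemma mem_translate h x : x \in translate h <-> translate_pred h x.
Proof.
apply: mem_vspan => [|a x1 x2 [l1 [z1 [L1l -> q1]]] [l2 [z2 [L2l -> q2]]]].
  exists 0, 0; split; first exact: mem0v.
    by rewrite cmpm0 addr0.
  by rewrite cmpm0 !linear0.
exists (a *: l1 + l2), (a *: z1 + z2); split; first by rewrite memvD ?memvZ.
  by rewrite cmpmD cmpmZ scalerDr addrACA.
by rewrite linearP /= q1 q2 cmpmD cmpmZ !linearP.
Qed.

Lemma proj_in_M0 (l : chom T (mt E)) : (l : F T (mt E)) \in val L1 ->
  (p \oc l : F T (qt e)) \in val M0.
Proof. by move=> lL; apply/hM; exists l. Qed.

Lemma translate_subm h : h \in rhom (sub_mod M0) (quo_mod N0) -> is_subm (translate h).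
Proof.
move=> /mem_rhom Hh x b /mem_translate[l [z [lL -> q]]]; apply/mem_translate.
exists (l \oc b), (z \oc b); split; first exact: (submP b lL).
  by rewrite /= /F_act cmpDm cmpA.
have := congr1 vsval (Hh (vsproj (val M0) (p \oc l)) b).
rewrite [X in _ = X -> _](quo_actE (h _ : subvs_of _) b) -q quo_proj_ract => <-.
congr (vsval (h _)); apply: val_inj.
rewrite [LHS](sub_actE (vsproj (val M0) (p \oc l)) b) [RHS]vsprojK ?vsprojK ?proj_in_M0 //=.
  by rewrite /F_act cmpA.
exact: (submP b lL).
Qed.

Lemma translate_psi h (Hh : h \in rhom (sub_mod M0) (quo_mod N0)) :
  psi (E := E) (mksubm (translate_subm Hh)) = (M0, N0).
Proof.
apply/psiP; split=> x.
  split=> [/hM[l lL ->]|[y /mem_translate[l [z [lL -> _]]] ->]].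
    pose z := vsval (h (vsproj (val M0) (p \oc l))) : chom T (st e).
    exists (l + i \oc z).
      apply/mem_translate; exists l, z; split=> //; apply: quo_proj_id; exact: subvsP.
    by rewrite cmpmD cmpA (dist_comp0 D) cmp0m addr0.
  by apply/hM; exists l => //; rewrite cmpmD cmpA (dist_comp0 D) cmp0m addr0.
split=> [xN|/mem_translate[l [z [lL xE q]]]].
  apply/mem_translate; exists (i \oc x), 0; split; first exact/hN.
    by rewrite cmpm0 addr0.
  by rewrite cmpA (dist_comp0 D) cmp0m !linear0.
have lE : l = i \oc (x - z) by rewrite cmpmB -/i xE addrK.
have pl : p \oc l = 0 by rewrite lE cmpA (dist_comp0 D) cmp0m.
rewrite -(subrK z x) memvD //; first by apply/hN; rewrite -lE.
rewrite pl !linear0 in q; have := quo_projB N0 z; rewrite q subr0; exact.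
Qed.

Lemma translate_inj h h' : translate h = translate h' -> h = h'.
Proof.
move=> hh; apply/lfunP => m; have /hM[l lL ml] := subvsP m.
pose z := vsval (h m) : chom T (st e).
have : l + i \oc z \in translate h.
  apply/mem_translate; exists l, z; split=> //; rewrite -ml vsvalK.
  by apply: quo_proj_id; exact: subvsP.
rewrite hh => /mem_translate[l' [z' [lL' lE q']]].
have pl : p \oc l' = vsval m.
  have := congr1 (cmp p) lE; rewrite !cmpmD !cmpA (dist_comp0 D) !cmp0m !addr0.
  by rewrite -ml => <-.
rewrite pl vsvalK in q'; apply: val_inj; rewrite /= -q'.
have -> : vsval (h m) = quo_proj N0 z by rewrite quo_proj_id //; exact: subvsP.
apply: (@quo_proj_eq _ _ _ (F T (st e)) N0 z z'); apply/hN.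
rewrite cmpmB -/i (_ : _ - _ = l' - l) ?memvB //.
have -> : i \oc z = l' + i \oc z' - l by rewrite -lE addrAC subrr add0r.
by rewrite addrAC addrK.
Qed.

(** The map h sends p l, for l in L1, to the class of z for any z such that l + i z
    lies in L2. *)
Lemma translate_surj L2 : psi (E := E) L2 = (M0, N0) ->
  exists2 h, h \in rhom (sub_mod M0) (quo_mod N0) & val L2 = translate h.
Proof.
move=> /psiP[hM2 hN2].
pose R (m : sub_mod M0) (w : quo_mod N0) :=
  exists (l l2 : chom T (mt E)) (z : chom T (st e)),
    [/\ (l : F T (mt E)) \in val L1, (l2 : F T (mt E)) \in val L2,
        vsval m = p \oc l, l2 = l + i \oc z & vsval w = quo_proj N0 (z : F T (st e))].
have Rtot m : exists w, R m w.
  have /hM[l lL ml] := subvsP m; have /hM2[l2 lL2 ml2] := subvsP m.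
  have [|z zE] := dist_lift (u := l2 - l) D.
    by rewrite cmpmB -/p -ml -ml2 subrr.
  exists (vsproj _ (quo_proj N0 (z : F T (st e)))), l, l2, z; split=> //.
    by rewrite -zE addrC subrK.
  by rewrite vsprojK // quo_proj_in.
have Rfun m w w' : R m w -> R m w' -> w = w'.
  case=> l [l2 [z [lL lL2 ml l2E wE]]] [l' [l2' [z' [lL' lL2' ml' l2E' wE']]]].
  apply: val_inj; rewrite /= wE wE'; apply: (@quo_proj_eq _ _ _ (F T (st e)) N0 z z').
  have [|d dE] := dist_lift (u := l - l') D.
    by rewrite cmpmB -/p -ml -ml' subrr.
  have dN : (d : F T (st e)) \in val N0 by apply/hN; rewrite -dE memvB.
  have sN : (z - z' + d : F T (st e)) \in val N0.
    apply/hN2; rewrite cmpmD cmpmB -/i -dE.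
    have -> : i \oc z - i \oc z' + (l - l') = l2 - l2'.
      by rewrite l2E l2E' opprD [RHS]addrACA addrC.
    exact: memvB.
  by rewrite -(addrK d (z - z')) memvB.
have Rlin a m m' w w' : R m w -> R m' w' -> R (a *: m + m') (a *: w + w').
  case=> l [l2 [z [lL lL2 ml l2E wE]]] [l' [l2' [z' [lL' lL2' ml' l2E' wE']]]].
  exists (a *: l + l'), (a *: l2 + l2'), (a *: z + z'); split.
  - by rewrite memvD ?memvZ.
  - by rewrite memvD ?memvZ.
  - by rewrite linearP /= ml ml' cmpmD cmpmZ.
  - by rewrite l2E l2E' cmpmD cmpmZ scalerDr addrACA.
  - by rewrite !linearP /= wE wE'.
have /choice[f fR] := Rtot.
have flin : linear f by move=> a m m'; apply: Rfun (fR _) _; apply: Rlin.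
exists (mklin flin).
  apply/mem_rhom => m b; rewrite !mklinE; apply: Rfun (fR _) _.
  have [l [l2 [z [lL lL2 ml l2E wE]]]] := fR m.
  exists (l \oc b), (l2 \oc b), (z \oc b); split.
  - exact: (submP b lL).
  - exact: (submP b lL2).
  - by rewrite [LHS](sub_actE (m : subvs_of _) b) ml /= /F_act cmpA.
  - by rewrite l2E cmpDm cmpA.
  - by rewrite [LHS](quo_actE (f m : subvs_of _) b) wE quo_proj_ract.
apply: vspace_iff => x; split=> [xL|/mem_translate[l [z [lL -> q]]]].
  have /hM[l lL pl] : (p \oc x : F T (qt e)) \in val M0 by apply/hM2; exists x.
  have [|z zE] := dist_lift (u := x - l) D.
    by rewrite cmpmB -/p pl subrr.
  have xE : x = l + i \oc z by rewrite -zE addrC subrK.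
  apply/mem_translate; exists l, z; split=> //; rewrite mklinE.
  have RR : R (vsproj (val M0) (p \oc l)) (vsproj _ (quo_proj N0 (z : F T (st e)))).
    exists l, x, z; split=> //; first by rewrite vsprojK // proj_in_M0.
    by rewrite vsprojK // quo_proj_in.
  by rewrite (Rfun _ _ _ (fR _) RR) vsprojK // quo_proj_in.
have [l' [l2 [z' [lL' lL2 ml l2E wE]]]] := fR (vsproj (val M0) (p \oc l)).
rewrite mklinE wE in q; rewrite vsprojK ?proj_in_M0 // in ml.
have [|d dE] := dist_lift (u := l - l') D.
  by rewrite cmpmB -/p ml subrr.
have zz : (z - z' : F T (st e)) \in val N0.
  have := quo_projB N0 (z - z'); rewrite linearB /= q subrr subr0; exact.
have dN : (d : F T (st e)) \in val N0 by apply/hN; rewrite -dE memvB.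
have -> : l + i \oc z = l2 + i \oc (d + (z - z')).
  rewrite cmpmD cmpmB -dE l2E [RHS]addrACA; congr (_ + _); exact/esym/subrKC.
by rewrite memvD //; apply/hN2; rewrite memvD.
Qed.

Lemma card_psi_fiber :
  #|[set L0 : subm (F T (mt E)) | psi L0 == (M0, N0)]| = (#|k| ^ lhom M0 N0)%N.
Proof.
pose H := finvect_type 'Hom(sub_mod M0, quo_mod N0).
pose V : {vspace H} := rhom (sub_mod M0) (quo_mod N0).
have <- : #|V| = (#|k| ^ lhom M0 N0)%N by rewrite card_vspace.
pose tr (h : H) : subm (F T (mt E)) :=
  if pselect (h \in rhom (sub_mod M0) (quo_mod N0)) is left Hh
  then mksubm (translate_subm Hh) else L1.
have trE h : h \in V -> val (tr h) = translate h /\ psi (tr h) = (M0, N0).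
  move=> hV; rewrite /tr; case: pselect => [Hh|] //.
  by split=> //; exact: translate_psi.
rewrite -(card_in_imset (f := tr)); last first.
  move=> h h' hV hV' trh; apply: translate_inj.
  by rewrite -(trE h hV).1 -(trE h' hV').1 trh.
congr #|pred_of_set _|; apply/setP => L0; rewrite inE.
apply/eqP/imsetP => [/translate_surj[h hV L0E]|[h hV ->]]; last by case: (trE h hV).
by exists h => //; apply: val_inj; rewrite L0E (trE h hV).1.
Qed.

End Torsor.
End Fibers.

(** * Counting lines and assembling the formula *)

Section CountLines.
Variable k : finFieldType.

Definition nlines (V : vectType k) (W : {vspace V}) : nat :=
  #|[set l in lines V | (l <= W)%VS]|.

(** Each line contains q - 1 nonzero vectors. *)
Lemma nlinesE (V : vectType k) (W : {vspace V}) :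
  (nlines W * (#|k| - 1) = #|k| ^ \dim W - 1)%N.
Proof.
(* V is destructed so that its finite copy carries the same vector space
   structure by conversion. *)
case: V W => S cV; set V := Vector.Pack cV => W.
pose H := finvect_type V.
have nz (U : {vspace H}) :
    (\sum_(x : H | (x \in U) && (x != 0%R)) 1 = #|k| ^ \dim U - 1)%N.
  rewrite sum1dep_card -(card_vspace U) -(cardsE (mem U)) (cardsD1 (0 : H) [set x in U]).
  rewrite in_set mem0v add1n subn1 /=.
  by apply: eq_card => x; rewrite in_set in_setD1 in_set andbC.
have := nz W; rewrite (partition_big (fun x : H => <[x : V]>%VS)
  (fun l => (l \in lines V) && (l <= W)%VS)) /=; last first.
  move=> x /andP[xW x0]; rewrite in_set dim_vline -memvE xW andbT.
  by rewrite x0.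
move=> <-; rewrite /nlines -sum1_card big_distrl /=.
rewrite (eq_bigl (fun l => (l \in lines V) && (l <= W)%VS)); last by move=> l; rewrite in_set.
apply: eq_bigr => l; rewrite in_set => /andP[/eqP dl lW]; rewrite mul1n.
have := nz l; rewrite dl expn1 => <-; apply: eq_bigl => x.
apply/andP/andP => [[xl x0]|[/andP[xW x0] /eqP xl]].
  rewrite (subvP lW) //= x0; split=> //; rewrite eqEdim -memvE xl dl.
  by rewrite dim_vline x0.
by rewrite -xl memv_line x0.
Qed.

End CountLines.

(** With q the order of the field and [m] = (q^m - 1) / (q - 1), this is
    [w + w'] = [w] q^w' + [w'] = [w] + [w'] q^w. *)
Lemma nlines_add (k : finFieldType) (U V : vectType k) (W : {vspace U}) (W' : {vspace V}) :
  (\dim W + \dim W')%N = \dim {:U} ->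
  #|lines U| = (nlines W * #|k| ^ \dim W' + nlines W')%N /\
  #|lines U| = (nlines W + nlines W' * #|k| ^ \dim W)%N.
Proof.
move=> dW; have q1 : (1 < #|k|)%N := finNzRing_gt1 k.
have -> : #|lines U| = nlines (fullv : {vspace U}).
  by apply: eq_card => l; rewrite in_set subvf andbT.
have p1 := expn_gt0 #|k| (\dim W); have p2 := expn_gt0 #|k| (\dim W').
rewrite (ltnW q1) /= in p1 p2.
by split; apply/eqP; rewrite -(eqn_pmul2r (m := #|k| - 1)) ?subn_gt0 //; apply/eqP;
  rewrite mulnDl 1?mulnAC !nlinesE -dW expnD; nia.
Qed.

Section QuantumPowers.
Variables (K : fieldType) (v : K).

Lemma qpow_half (x : rat) (m : int) : 2%:R * x = m%:~R -> qpow v x = v ^ m.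
Proof. by move=> xm; rewrite /qpow xm numq_int. Qed.

Lemma qpow_coef (q c l x : nat) (m : int) (G : rat) :
  v != 0 -> v ^+ 2 = q%:R -> 2%:R * G = (2 * x%:Z + m - 2 * l%:Z)%:~R ->
  (c * q ^ l)%:R * qpow v G = (c * q ^ x)%:R * v ^ m.
Proof.
move=> v0 vq /qpow_half ->.
have qv y : (q ^ y)%:R = v ^ (2 * y%:Z) by rewrite natrX -vq -exprM exprnP PoszM.
rewrite !natrM !qv -!mulrA -!expfzDr //; congr (_ * v ^ _); ring.
Qed.

End QuantumPowers.

Section WeightedCharacters.
Variables (k : finFieldType) (C : triCat k) (n : nat) (T_ : 'I_n -> C) (T : C).
Variables (coind : C -> 'rV[int]_n).
Variables (K : fieldType) (v : K) (A : algType K) (Xb : 'rV[int]_n -> A).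

Lemma wqcfE (e : mor C) (E : tri e) (f : ZMG T) :
  wqcf T_ coind v Xb E f =
  \sum_(L0 : subm (F T (mt E)))
    qpow v (f e (psi L0).1 (psi L0).2) *: Xb (pvec T T_ coind (mt E) (dvec T_ (sub_mod L0))).
Proof.
pose dv (L0 : subm (F T (mt E))) := dvec T_ (sub_mod L0).
pose t L0 := qpow v (f e (psi L0).1 (psi L0).2) *: Xb (pvec T T_ coind (mt E) (dv L0)).
rewrite /wqcf; set s := undup _.
transitivity (\sum_(d <- s) \sum_(L0 | dv L0 == d) t L0).
  apply: eq_bigr => d _; rewrite pair_big /=.
  rewrite (partition_big (fun L0 => psi L0) predT) //=.
  apply: eq_bigr => -[M0 N0] _ /=; rewrite -scalerA -sumr_const scaler_suml.
  apply: eq_big => [L0|L0]; first by rewrite inE.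
  by rewrite inE => /andP[/eqP <- /eqP psiE]; rewrite scale1r /t psiE.
rewrite (exchange_big_dep predT) //=; apply: eq_bigr => L0 _.
rewrite (eq_bigl (pred1 (dv L0))) => [|d]; last by rewrite eq_sym.
by rewrite -big_filter filter_pred1_uniq ?undup_uniq ?big_seq1 // mem_undup map_f ?mem_enum.
Qed.

End WeightedCharacters.

Section Assembly.
Variables (k : finFieldType) (C : triCat k).
Variables (hKS : krull_schmidt C) (hCY : two_CY C).
Variables (n : nat) (T_ : 'I_n -> C) (T : C) (hsum : is_dirsum T_ T).
Variables (hind : forall i, indecomposable (T_ i)).
Variables (hniso : forall i j, i != j -> ~ isomorphic (T_ i) (T_ j)).
Variables (hT : cluster_tilting T).
Variables (K : fieldType) (v : K) (A : algType K) (Xb : 'rV[int]_n -> A).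
Variables (coind : C -> 'rV[int]_n) (hcoind : forall X, is_coind T T_ X (coind X)).
Variable lft : forall (M : C) (M0 : subm (F T M)), lifting M0.
Variable cone : forall e : mor C, tri e.
Variable rep : forall X Y : C, {vspace chom X (sh Y)} -> chom X (sh Y).
Variable hrep : forall (X Y : C) (l : {vspace chom X (sh Y)}),
  l \in lines (chom X (sh Y)) -> <[@rep X Y l]>%VS = l.

Let p (M : C) (M0 : subm (F T M)) := pvec T T_ coind M (dvec T_ (sub_mod M0)).

(** Summing over all lines, the monomial of (M0, N0) is collected once for each
    line in the gluing space and each of the q^l submodules above it. *)
Lemma sum_lines_wqcf (M N : C) (H : {vspace chom M (sh N)} -> ZMG T)
    (G : subm (F T M) -> subm (F T N) -> rat) :
  (forall l M0 N0, H l (Mor (@rep M N l)) M0 N0 = G M0 N0) ->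
  \sum_(l in lines (chom M (sh N)))
     wqcf T_ coind v Xb (cone (Mor (@rep M N l))) (H l) =
  \sum_(M0 : subm (F T M)) \sum_(N0 : subm (F T N))
     ((nlines (gluing T (lmor (lft M0)) (lmor (lft N0))) * #|k| ^ lhom M0 N0)%:R
      * qpow v (G M0 N0)) *: Xb (p M0 + p N0).
Proof.
move=> HG.
pose W (M0 : subm (F T M)) (N0 : subm (F T N)) := gluing T (lmor (lft M0)) (lmor (lft N0)).
transitivity (\sum_(l in lines (chom M (sh N))) \sum_(M0 : subm (F T M))
    \sum_(N0 : subm (F T N)) (if (l <= W M0 N0)%VS then
      ((#|k| ^ lhom M0 N0)%:R * qpow v (G M0 N0)) *: Xb (p M0 + p N0) else 0)).
  apply: eq_bigr => l lin; set e := Mor (@rep M N l).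
  rewrite wqcfE pair_big (partition_big (fun L0 => psi L0) predT) //=.
  apply: eq_bigr => -[M0 N0] _ /=.
  rewrite (eq_bigr (fun _ => qpow v (G M0 N0) *: Xb (p M0 + p N0))); last first.
    move=> L0 /eqP psiE; have [-> ->] := psiE; rewrite HG.
    by rewrite (pvec_psi (M0 := M0 : subm (F T (qt e))) (N0 := N0 : subm (F T (st e)))
      hKS hCY hsum hind hniso hT lft hcoind psiE).
  rewrite sumr_const -scaler_nat scalerA.
  have lW : (l <= W M0 N0)%VS = (@rep M N l \in W M0 N0) by rewrite -{1}(hrep lin) memvE.
  rewrite lW; case: ifP => [eW|eW].
    have [L1 psiL1] := gluing_submodule (cone e) eW.
    by rewrite -(card_psi_fiber psiL1); congr (_%:R * _ *: _); rewrite cardsE.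
  rewrite eq_card0 ?mul0r ?scale0r // => L0; apply/negP; rewrite unfold_in.
  case/andP=> /eqP p1 /eqP p2.
  have psiE : psi L0 = (M0 : subm (F T (qt e)), N0 : subm (F T (st e))).
    by rewrite [psi L0]surjective_pairing p1 p2.
  by have := submodule_gluing hT lft psiE; rewrite [_ \in _]eW.
rewrite exchange_big /=; apply: eq_bigr => M0 _.
rewrite exchange_big /=; apply: eq_bigr => N0 _.
transitivity (\sum_(l in [set l in lines (chom M (sh N)) | (l <= W M0 N0)%VS])
    ((#|k| ^ lhom M0 N0)%:R * qpow v (G M0 N0)) *: Xb (p M0 + p N0)).
  by rewrite -big_mkcondr; apply: eq_bigl => l; rewrite [RHS]in_set.
by rewrite sumr_const -scaler_nat scalerA natrM mulrA.
Qed.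

End Assembly.

Section Evaluation.
Variables (k : finFieldType) (C : triCat k) (T : C).

Lemma starE (e : mor C) (f g : ZMG T) M0 N0 : star e f g e M0 N0 = f e M0 N0 + g e M0 N0.
Proof. exact: concentratedE. Qed.

Lemma TTE (e1 e2 : mor C) (E1 : tri e1) (E2 : tri e2) (f1 f2 : ZMG T)
    (e : chom (mt E1) (sh (mt E2))) M0 N0 :
  TT E1 f1 E2 f2 e (Mor e) M0 N0 =
    f1 e1 (psi (E := E1) M0).1 (psi (E := E1) M0).2 +
    f2 e2 (psi (E := E2) N0).1 (psi (E := E2) N0).2.
Proof. exact: (concentratedE (e := Mor e)). Qed.

End Evaluation.

Theorem theorem1p2
  (k : finFieldType) (C : triCat k)
  (hKS : krull_schmidt C) (hCY : two_CY C)
  (n : nat) (T_ : 'I_n -> C) (T : C)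
  (hsum : is_dirsum T_ T)
  (hind : forall i, indecomposable (T_ i))
  (hniso : forall i j, i != j -> ~ isomorphic (T_ i) (T_ j))
  (hT : cluster_tilting T)
  (lam : 'rV[int]_n -> 'rV[int]_n -> int) (hlam : skew_bilinear lam)
  (K : fieldType) (v : K) (hv : v ^+ 2 = #|k|%:R) (hv0 : v != 0)
  (A : algType K) (Xb : 'rV[int]_n -> A)
  (hA : skew_polynomial_algebra lam v Xb)
  (* arbitrary choices: lifts of submodules, triangles on morphisms and
     representatives of lines *)
  (coind : C -> 'rV[int]_n) (hcoind : forall X, is_coind T T_ X (coind X))
  (lft : forall (M : C) (M0 : subm (F T M)), lifting M0)
  (cone : forall e : mor C, tri e)
  (rep : forall X Y : C, {vspace chom X (sh Y)} -> chom X (sh Y))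
  (hrep : forall (X Y : C) (l : {vspace chom X (sh Y)}),
     l \in lines (chom X (sh Y)) -> <[rep X Y l]>%VS = l)
  (e1 e2 : mor C) (E1 : tri e1) (E2 : tri e2)
  (f g : ZMG T) (hf : ZMG_at e1 f) (hg : ZMG_at e2 g)
  (hMN : exists e : chom (mt E1) (sh (mt E2)), e <> 0) :
  let M := mt E1 in
  let N := mt E2 in
  let fspec := f_spec T T_ lam coind in
  let gskew := g_skew T T_ lam coind in
  let gext_p := g_ext_plus lft in
  let gext_m := g_ext_minus lft in
  let X_ (e : mor C) (E : tri e) (h : ZMG T) : A :=
    wqcf T_ coind v Xb E h in
  let MN l := Mor (rep M N l) in
  let NM l := Mor (rep N M l) in
  let Tfg l := TT E1 f E2 g (rep M N l) in
  let Tgf l := TT E2 g E1 f (rep N M l) in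
  let lhs := #|lines (chom M (sh N))|%:R *: (X_ e1 E1 f * X_ e2 E2 g) in
  let rhs1 :=
    \sum_(l in lines (chom M (sh N)))
       X_ (MN l) (cone (MN l))
          (star (MN l) (star (MN l) gext_p fspec) (Tfg l))
    + \sum_(l in lines (chom N (sh M)))
       X_ (NM l) (cone (NM l))
          (star (NM l) (star (NM l) gskew fspec) (Tgf l)) in
  let rhs2 :=
    \sum_(l in lines (chom M (sh N)))
       X_ (MN l) (cone (MN l)) (star (MN l) fspec (Tfg l))
    + \sum_(l in lines (chom N (sh M)))
       X_ (NM l) (cone (NM l))
          (star (NM l) (star (NM l) (star (NM l) gext_m gskew) fspec)
             (Tgf l)) in
  lhs = rhs1 /\ rhs1 = rhs2.
Proof.
move=> M N fspec gskew gext_p gext_m X_ MN NM Tfg Tgf lhs rhs1 rhs2.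
have [_ _ lamC] := hlam; have [_ XbM _ _] := hA.
pose p (L : C) (L0 : subm (F T L)) := pvec T T_ coind L (dvec T_ (sub_mod L0)).
pose lm (M0 : subm (F T M)) (N0 : subm (F T N)) := lam (p M M0) (p N N0).
pose f1 (M0 : subm (F T M)) := f e1 (psi (E := E1) M0).1 (psi (E := E1) M0).2.
pose g1 (N0 : subm (F T N)) := g e2 (psi (E := E2) N0).1 (psi (E := E2) N0).2.
have /choice[mf mfE] : forall M0, exists m : int, 2%:R * f1 M0 = m%:~R.
  by move=> M0; apply/intrP/hf.1.
have /choice[mg mgE] : forall N0, exists m : int, 2%:R * g1 N0 = m%:~R.
  by move=> N0; apply/intrP/hg.1.
pose W (M0 : subm (F T M)) (N0 : subm (F T N)) := gluing T (lmor (lft M M0)) (lmor (lft N N0)).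
pose W' (M0 : subm (F T M)) (N0 : subm (F T N)) := gluing T (lmor (lft N N0)) (lmor (lft M M0)).
pose t (c : subm (F T M) -> subm (F T N) -> nat) : A :=
  \sum_(M0 : subm (F T M)) \sum_(N0 : subm (F T N))
    ((c M0 N0)%:R * v ^ (lm M0 N0 + mf M0 + mg N0)) *: Xb (p M M0 + p N N0).
have lhsE : lhs = t (fun _ _ => #|lines (chom M (sh N))|).
  rewrite /lhs /X_ !wqcfE mulr_suml scaler_sumr; apply: eq_bigr => M0 _.
  rewrite mulr_sumr scaler_sumr; apply: eq_bigr => N0 _.
  rewrite -scalerAl -scalerAr XbM !scalerA (qpow_half _ (mfE M0)) (qpow_half _ (mgE N0)).
  by rewrite -/(lm M0 N0) -!mulrA -!expfzDr // addrA; congr (_ * v ^ _ *: _); ring.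
have sumMN (H : {vspace chom M (sh N)} -> ZMG T)
    (G : subm (F T M) -> subm (F T N) -> rat) (x : subm (F T M) -> subm (F T N) -> nat) :
    (forall l M0 N0, H l (MN l) M0 N0 = G M0 N0) ->
    (forall M0 N0, 2%:R * G M0 N0 = (2 * (x M0 N0)%:Z +
      (lm M0 N0 + mf M0 + mg N0) - 2 * (lhom M0 N0)%:Z)%:~R) ->
    \sum_(l in lines (chom M (sh N))) X_ (MN l) (cone (MN l)) (H l) =
    t (fun M0 N0 => nlines (W M0 N0) * #|k| ^ x M0 N0)%N.
  move=> HG G2.
  rewrite (sum_lines_wqcf hKS hCY hsum hind hniso hT v Xb hcoind lft cone hrep HG).
  apply: eq_bigr => M0 _; apply: eq_bigr => N0 _; congr (_ *: _).
  exact: qpow_coef.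
have sumNM (H : {vspace chom N (sh M)} -> ZMG T)
    (G : subm (F T N) -> subm (F T M) -> rat) (x : subm (F T M) -> subm (F T N) -> nat) :
    (forall l N0 M0, H l (NM l) N0 M0 = G N0 M0) ->
    (forall M0 N0, 2%:R * G N0 M0 = (2 * (x M0 N0)%:Z +
      (lm M0 N0 + mf M0 + mg N0) - 2 * (lhom N0 M0)%:Z)%:~R) ->
    \sum_(l in lines (chom N (sh M))) X_ (NM l) (cone (NM l)) (H l) =
    t (fun M0 N0 => nlines (W' M0 N0) * #|k| ^ x M0 N0)%N.
  move=> HG G2.
  rewrite (sum_lines_wqcf hKS hCY hsum hind hniso hT v Xb hcoind lft cone hrep HG) exchange_big.
  apply: eq_bigr => M0 _; apply: eq_bigr => N0 _; rewrite addrC; congr (_ *: _).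
  exact: qpow_coef.
(* f_spec depends only on the ends of a morphism: all lines share its values. *)
pose fs (M0 : subm (F T M)) (N0 : subm (F T N)) : rat :=
  2%:R^-1 * (lm M0 N0)%:~R - (lhom M0 N0)%:R.
pose fs' (N0 : subm (F T N)) (M0 : subm (F T M)) : rat :=
  2%:R^-1 * (lam (p N N0) (p M M0))%:~R - (lhom N0 M0)%:R.
have fs2 M0 N0 : 2%:R * fs M0 N0 = (lm M0 N0 - 2 * (lhom M0 N0)%:Z)%:~R.
  by rewrite mulrBr mulrA divff // mul1r rmorphB /= rmorphM.
have fs2' M0 N0 : 2%:R * fs' N0 M0 = (- lm M0 N0 - 2 * (lhom N0 M0)%:Z)%:~R.
  by rewrite mulrBr mulrA divff // mul1r lamC rmorphB /= rmorphM.
have gextpE l M0 N0 : gext_p (MN l) M0 N0 = (\dim (W' M0 N0))%:R.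
  by rewrite /gext_p /g_ext_plus (im_alpha'_gluing hT).
have gextmE l M0 N0 : gext_m (NM l) N0 M0 = (\dim (W M0 N0))%:R.
  rewrite /gext_m /g_ext_minus (shift_p_ker_gluing hCY hT) //; exact: lft_inj.
have dimW M0 N0 : (\dim (W M0 N0) + \dim (W' M0 N0))%N = \dim {:chom M (sh N)}.
  by apply: (dim_gluing hCY hT); exact: lft_inj.
have TfgE l M0 N0 : Tfg l (MN l) M0 N0 = f1 M0 + g1 N0 by exact: TTE.
have TgfE l N0 M0 : Tgf l (NM l) N0 M0 = g1 N0 + f1 M0 by exact: TTE.
have fspecE l M0 N0 : fspec (MN l) M0 N0 = fs M0 N0 by [].
have fspecE' l N0 M0 : fspec (NM l) N0 M0 = fs' N0 M0 by [].
have gskewE l N0 M0 : gskew (NM l) N0 M0 = (lm M0 N0)%:~R by [].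
clearbody fs fs' f1 g1.
have tD c c' : t c + t c' = t (fun M0 N0 => c M0 N0 + c' M0 N0)%N.
  rewrite -big_split; apply: eq_bigr => M0 _; rewrite -big_split /=.
  by apply: eq_bigr => N0 _; rewrite -scalerDl -mulrDl -natrD.
have tE c c' : (forall M0 N0, c M0 N0 = c' M0 N0) -> t c = t c'.
  by move=> cc'; apply: eq_bigr => M0 _; apply: eq_bigr => N0 _; rewrite cc'.
have rhs1E : rhs1 = t (fun M0 N0 =>
    nlines (W M0 N0) * #|k| ^ \dim (W' M0 N0) + nlines (W' M0 N0))%N.
  rewrite /rhs1.
  rewrite (sumMN _ (fun M0 N0 => (\dim (W' M0 N0))%:R + fs M0 N0 + (f1 M0 + g1 N0))
    (fun M0 N0 => \dim (W' M0 N0))) => [|l M0 N0|M0 N0]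
  ; [|by rewrite !starE gextpE fspecE TfgE
     |by rewrite !mulrDr fs2 mfE mgE; ring].
  rewrite (sumNM _ (fun N0 M0 => (lm M0 N0)%:~R + fs' N0 M0 + (g1 N0 + f1 M0))
    (fun _ _ => 0%N)) => [|l N0 M0|M0 N0]
  ; [|by rewrite !starE gskewE fspecE' TgfE
     |by rewrite !mulrDr fs2' mfE mgE; ring].
  by rewrite tD; apply: tE => M0 N0; rewrite muln1.
have rhs2E : rhs2 = t (fun M0 N0 =>
    nlines (W M0 N0) + nlines (W' M0 N0) * #|k| ^ \dim (W M0 N0))%N.
  rewrite /rhs2 (sumMN _ (fun M0 N0 => fs M0 N0 + (f1 M0 + g1 N0)) (fun _ _ => 0%N))
    => [|l M0 N0|M0 N0]
  ; [|by rewrite !starE fspecE TfgE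
     |by rewrite !mulrDr fs2 mfE mgE; ring].
  rewrite (sumNM _ (fun N0 M0 => (\dim (W M0 N0))%:R + (lm M0 N0)%:~R + fs' N0 M0
    + (g1 N0 + f1 M0)) (fun M0 N0 => \dim (W M0 N0))) => [|l N0 M0|M0 N0]
  ; [|by rewrite !starE gextmE gskewE fspecE' TgfE
     |by rewrite !mulrDr fs2' mfE mgE; ring].
  by rewrite tD; apply: tE => M0 N0; rewrite muln1.
rewrite rhs2E lhsE rhs1E; split; apply: tE => M0 N0; have [c1 c2] := nlines_add (dimW M0 N0) => //.
by rewrite -c1 c2.
Qed.
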